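(* Let $n\ge2$. For every pair of real numbers $\mathfrak{d}_0,\mathfrak{d}_\infty\in\left(-1,\frac1{n-1}\right)$, with $r_0=(r_{0,1},\dots,r_{0,n})$ and $r_\infty=(r_{\infty,1},\dots,r_{\infty,n})$ given by $r_{0,i}=1-\mathfrak{d}_0(n-i)$ and $r_{\infty,i}=1-\mathfrak{d}_\infty(n-i)$, there exist a homogeneous in the bi-limit function $\phi_n:\mathbb{R}^n\to\mathbb{R}$ with associated triples $(r_0,1+\mathfrak{d}_0,\phi_{n,0})$ and $(r_\infty,1+\mathfrak{d}_\infty,\phi_{n,\infty})$ and a homogeneous in the bi-limit vector field $K_1:\mathbb{R}^n\to\mathbb{R}^n$ with associated triples $(r_0,\mathfrak{d}_0,K_{1,0})$ and $(r_\infty,\mathfrak{d}_\infty,K_{1,\infty})$ such that, for every real number $L>0$, the origin is a globally asymptotically stable equilibrium of the system with state $(x,\hat{\mathfrak{X}}_n)\in\mathbb{R}^n\times\mathbb{R}^n$, $\hat{\mathfrak{X}}_n=(\hat\chi_1,\dots,\hat\chi_n)$, $$\dot x=\mathcal{S}_n x+B_n u,\qquad \dot{\hat{\mathfrak{X}}}_n=L\left(\mathcal{S}_n\hat{\mathfrak{X}}_n+B_n\phi_n(\hat{\mathfrak{X}}_n)+K_1(x_1-\hat\chi_1)\right),\qquad u=L^n\phi_n(\hat{\mathfrak{X}}_n),$$ and of its homogeneous approximations, i.e. of the two systems obtained from it by replacing $(\phi_n,K_1)$ by $(\phi_{n,0},K_{1,0})$ and by $(\phi_{n,\infty},K_{1,\infty})$,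 respectively.
   Context: $\mathbb{R}_+=[0,+\infty)$. $\mathcal{S}_n$ denotes the shift matrix of order $n$: $\mathcal{S}_n(v_1,\dots,v_n)^T=(v_2,\dots,v_n,0)^T$, and $B_n=(0,\dots,0,1)^T\in\mathbb{R}^n$. For a vector field $K$ on $\mathbb{R}^n$ and a scalar $e$, the compact notation $K(e)$ stands for $K(e,0,\dots,0)$. For $r\in(\mathbb{R}_+\setminus\{0\})^n$, $\lambda\in\mathbb{R}_+$ and $x\in\mathbb{R}^n$, $\lambda^r\diamond x=(\lambda^{r_1}x_1,\dots,\lambda^{r_n}x_n)$. A function $\phi:\mathbb{R}^n\to\mathbb{R}$ is homogeneous in the $0$-limit with associated triple $(r_0,d_0,\phi_0)$ (weight $r_0\in(\mathbb{R}_+\setminus\{0\})^n$, degree $d_0\in\mathbb{R}_+$, approximating function $\phi_0:\mathbb{R}^n\to\mathbb{R}$) if $\phi$ is continuous, $\phi_0$ is continuous and not identically zero, and for each compact set $C\subset\mathbb{R}^n\setminus\{0\}$ and each $\varepsilon>0$ there exists $\lambda_0>0$ such that $\max_{x\in C}\left|\frac{\phi(\lambda^{r_0}\diamond x)}{\lambda^{d_0}}-\phi_0(x)\right|\le\varepsilon$ for all $\lambda\in(0,\lambda_0]$. It is homogeneous in the $\infty$-limit with associated triple $(r_\infty,d_\infty,\phi_\infty)$ if the same holds with $(r_\infty,d_\infty,\phi_\infty)$ in place of $(r_0,d_0,\phi_0)$ and ''there exists $\lambda_\infty>0$ such that ... for all $\lambda\ge\lambda_\infty$''. A vector field $f=(f_1,\dots,f_n)$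 on $\mathbb{R}^n$ is homogeneous in the $0$-limit with associated triple $(r_0,\mathfrak{d}_0,f_0)$, with $\mathfrak{d}_0\in\mathbb{R}$ and $f_0=(f_{0,1},\dots,f_{0,n})$, if for each $i$, $\mathfrak{d}_0+r_{0,i}\ge 0$ and $f_i$ is homogeneous in the $0$-limit with associated triple $(r_0,\mathfrak{d}_0+r_{0,i},f_{0,i})$; similarly in the $\infty$-limit. Functions and vector fields are homogeneous in the bi-limit if they are homogeneous in both limits; the associated triples are the two corresponding triples. *)

(* Defs.v *)
From HB Require Import structures.
From mathcomp Require Import all_boot all_order all_algebra.
From mathcomp Require Import all_classical all_reals all_analysis.

Set Implicit Arguments.
Unset Strict Implicit.
Unset Printing Implicit Defensive.

Import Order.TTheory GRing.Theory Num.Theory.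
Import numFieldNormedType.Exports.

Local Open Scope classical_set_scope.
Local Open Scope ring_scope.

Definition shift_mx (R : realType) (n : nat) : 'M[R]_n :=
  \matrix_(i, j) ((j == i.+1 :> nat)%:R).

Definition last_vec (R : realType) (n : nat) : 'cV[R]_n :=
  \col_i ((i.+1 == n)%:R).

Definition first_ord (n : nat) (hn : (2 <= n)%N) : 'I_n := Ordinal (ltnW hn).

(* K(e) = K(e, 0, ..., 0) *)
Definition at_first (R : realType) (n : nat)
    (K : 'cV[R]_n -> 'cV[R]_n) (e : R) : 'cV[R]_n :=
  K (\col_i (if i == 0%N :> nat then e else 0)).

Definition dilation (R : realType) (n : nat) (r : 'I_n -> R) (lambda : R)
    (x : 'cV[R]_n) : 'cV[R]_n :=
  \col_i (lambda `^ r i * x i 0).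

Definition homogeneous_0_limit (R : realType) (n : nat) (r : 'I_n -> R) (d : R)
    (phi0 phi : 'cV[R]_n -> R) : Prop :=
  [/\ (forall i, 0 < r i) /\ 0 <= d,
      continuous phi,
      continuous phi0,
      exists x, phi0 x != 0 &
      forall C : set 'cV[R]_n, compact C -> ~ C 0 ->
      forall eps : R, 0 < eps ->
      exists2 lambda0 : R, 0 < lambda0 &
        forall lambda : R, 0 < lambda -> lambda <= lambda0 ->
        forall x, C x ->
          `| phi (dilation r lambda x) / lambda `^ d - phi0 x | <= eps].

Definition homogeneous_oo_limit (R : realType) (n : nat) (r : 'I_n -> R) (d : R)
    (phioo phi : 'cV[R]_n -> R) : Prop :=
  [/\ (forall i, 0 < r i) /\ 0 <= d,
      continuous phi,
      continuous phioo,
      exists x, phioo x != 0 &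
      forall C : set 'cV[R]_n, compact C -> ~ C 0 ->
      forall eps : R, 0 < eps ->
      exists2 lambdaoo : R, 0 < lambdaoo &
        forall lambda : R, lambdaoo <= lambda ->
        forall x, C x ->
          `| phi (dilation r lambda x) / lambda `^ d - phioo x | <= eps].

Definition vf_homogeneous_0_limit (R : realType) (n : nat) (r : 'I_n -> R)
    (d : R) (f0 f : 'cV[R]_n -> 'cV[R]_n) : Prop :=
  forall i : 'I_n, 0 <= d + r i /\
    homogeneous_0_limit r (d + r i) (fun x => f0 x i 0) (fun x => f x i 0).

Definition vf_homogeneous_oo_limit (R : realType) (n : nat) (r : 'I_n -> R)
    (d : R) (foo f : 'cV[R]_n -> 'cV[R]_n) : Prop :=
  forall i : 'I_n, 0 <= d + r i /\
    homogeneous_oo_limit r (d + r i) (fun x => foo x i 0) (fun x => f x i 0).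

Definition homogeneous_bilimit (R : realType) (n : nat)
    (r0 : 'I_n -> R) (d0 : R) (phi0 : 'cV[R]_n -> R)
    (roo : 'I_n -> R) (doo : R) (phioo : 'cV[R]_n -> R)
    (phi : 'cV[R]_n -> R) : Prop :=
  homogeneous_0_limit r0 d0 phi0 phi /\ homogeneous_oo_limit roo doo phioo phi.

Definition vf_homogeneous_bilimit (R : realType) (n : nat)
    (r0 : 'I_n -> R) (d0 : R) (f0 : 'cV[R]_n -> 'cV[R]_n)
    (roo : 'I_n -> R) (doo : R) (foo : 'cV[R]_n -> 'cV[R]_n)
    (f : 'cV[R]_n -> 'cV[R]_n) : Prop :=
  vf_homogeneous_0_limit r0 d0 f0 f /\ vf_homogeneous_oo_limit roo doo foo f.

(* The coordinate written i in 1..n on paper is the ordinal of value i - 1. *)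
Definition chain_weight (R : realType) (n : nat) (d : R) (i : 'I_n) : R :=
  1 - d * (n - i.+1)%:R.

(* [X] is a solution of dX/dt = F X on [0, T[, where T may be +oo; for
   continuous F this is the same as being C^1 on [0, T[ (with a one-sided
   derivative at 0) and satisfying the equation there.  Only the values of [X]
   on [0, T[ matter.  No uniqueness is assumed: F need not be Lipschitz. *)
Definition is_solution (R : realType) (V : normedModType R) (F : V -> V)
    (T : \bar R) (X : R -> V) : Prop :=
  [/\ (0 < T)%E,
      {within [set t : R | 0 <= t /\ (t%:E < T)%E], continuous X} &
      forall t : R, 0 < t -> (t%:E < T)%E -> is_derive t 1 X (F (X t))].

Definition is_maximal_solution (R : realType) (V : normedModType R)
    (F : V -> V) (T : \bar R) (X : R -> V) : Prop :=
  is_solution F T X /\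
  ~ exists (T' : \bar R) (Y : R -> V),
      [/\ (T < T')%E, is_solution F T' Y &
          forall t : R, 0 <= t -> (t%:E < T)%E -> Y t = X t].

Definition stable_at_0 (R : realType) (V : normedModType R) (F : V -> V) :
    Prop :=
  forall eps : R, 0 < eps -> exists2 delta : R, 0 < delta &
    forall (T : \bar R) (X : R -> V), is_solution F T X -> `|X 0| < delta ->
    forall t : R, 0 <= t -> (t%:E < T)%E -> `|X t| < eps.

Definition globally_attractive_0 (R : realType) (V : normedModType R)
    (F : V -> V) : Prop :=
  forall (T : \bar R) (X : R -> V), is_maximal_solution F T X ->
    T = +oo%E /\ X t @[t --> +oo] --> (0 : V).

Definition GAS_at_0 (R : realType) (V : normedModType R) (F : V -> V) : Prop :=
  [/\ F 0 = 0, stable_at_0 F & globally_attractive_0 F].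

Definition closed_loop (R : realType) (n : nat) (hn : (2 <= n)%N) (L : R)
    (phi : 'cV[R]_n -> R) (K : 'cV[R]_n -> 'cV[R]_n)
    (z : 'cV[R]_n * 'cV[R]_n) : 'cV[R]_n * 'cV[R]_n :=
  let x := z.1 in
  let chi := z.2 in
  let u := L ^+ n * phi chi in
  (shift_mx R n *m x + u *: last_vec R n,
   L *: (shift_mx R n *m chi + phi chi *: last_vec R n
         + at_first K (x (first_ord hn) 0 - chi (first_ord hn) 0))).

(* Main.v *)
(** In the rescaled errors [L^-k x_k - chi_k] the closed loop is a cascade, up to
    a change of time: the observer error drives the estimate, which obeys a chain
    of integrators under state feedback.  A coordinate of weight [r] is measured
    by its gauge, the odd power [1/r] of it (with the weight at the origin where
    the coordinate is at most 1, and the weight at infinity elsewhere).  The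
    injection evaluates, at the gauge of the first error, the inverses of the
    gauges of the next coordinates; the feedback is the inverse of a gauge at a
    linear combination of the gauges, found by backstepping.

    Stability rests on tubes of width proportional to a scale [s(t)] decreasing to
    0: one tube per coordinate, bounding its gauge plus slower gauges plus a small
    linear term.  If the gains grow fast enough along the chain, then at a first
    contact with the boundary of a tube the fast coordinate moves inwards faster
    than the slow terms and the scale can move.  Only secants to the left of the
    contact time are used, so gauges need not be differentiable.  Since the vector
    field is merely continuous, that maximal solutions are global relies on
    Peano's theorem.  The same gains serve both approximations, for which the two
    weights of each coordinate coincide. *)

Require Import Defs.
From mathcomp Require Import all_boot all_order all_algebra.
From mathcomp Require Import all_classical all_reals all_analysis.
From mathcomp Require Import zify ring lra.

Set Implicit Arguments.
Unset Strict Implicit.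
Unset Printing Implicit Defensive.

Import Order.TTheory GRing.Theory Num.Theory.
Import numFieldNormedType.Exports.

Local Open Scope classical_set_scope.
Local Open Scope ring_scope.

(** * Glued powers *)

(** The linear term of a tube is there because a gauge is a power of exponent at least 1, whose
    slope may vanish at 0: a contact can occur while the fast coordinate is near 0 and the slower
    gauges push outwards. The term [s * (x / rho s)] still moves then, at a rate comparable to
    [s * rate s]; having the sign of the gauge, it does not spoil size bounds. The other rates at a
    contact are multiples of [s * rate s] too: the weights are in arithmetic progression, so
    [rho k.+1 s / rho k s] does not depend on [k]. A contact is thus decided by a numerical
    inequality between gains, the same at every scale. The weights are divided by [n] to make the
    scale functions concave, and concavity supplies lower bounds for slopes. Controller gains are
    chosen from [w] alone, observer gains from [w] and [n], and [kappa] last: the error tubes live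
    at scale [kappa * s], so small that the injection is a minor perturbation of the estimate
    whatever the observer gains. *)

Lemma powR_bernoulli (R : realType) (w t : R) : 0 <= w <= 1 -> 0 <= t ->
  t `^ w <= 1 - w * (1 - t).
Proof.
move=> /andP[w0 w1]; rewrite le_eqVlt => /orP[/eqP <-|t0].
  case: (eqVneq w 0) => [->|wn0]; first by rewrite powRr0; lra.
  by rewrite powR0//; lra.
have E0 : 0 < t `^ w by exact: powR_gt0.
(* Tangent at [w] to a power of [t] as a convex function of its exponent [c]. Taken at 1 with weight
   [w] and at 0 with weight [1 - w], the logarithms cancel. *)
have key c : t `^ w * (1 + (c - w) * ln t) <= t `^ c.
  have -> : t `^ c = t `^ w * expR ((c - w) * ln t).
    by rewrite /powR gt_eqF// -expRD; congr expR; ring.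
  by rewrite ler_pM2l// expR_ge1Dx.
have := key 1; have := key 0.
rewrite powRr0 (powRr1 (ltW t0)) => k0 k1.
have := ler_wpM2l w0 k1.
have w1' : 0 <= 1 - w by rewrite subr_ge0.
have := ler_wpM2l w1' k0.

lra.
Qed.

Lemma powR_gt1 (R : realType) (x d : R) : 1 < x -> 0 < d -> 1 < x `^ d.
Proof.
move=> x1 d0; have -> : 1 = 1 `^ d :> R by rewrite powR1.
by apply: gt0_ltr_powR => //; rewrite nnegrE; lra.
Qed.

(** An order isomorphism of the line is continuous; glued powers are thus continuous without any
    inspection of the gluing point. *)
Lemma can_mono_continuous (R : realType) (f g : R -> R) :
  {mono f : x y / x < y} -> {mono g : x y / x < y} -> cancel f g ->
  cancel g f -> continuous f.
Proof.
move=> fm gm fK gK x; apply/cvgrPdist_lt => e e0.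
near=> y.
rewrite ltr_distlC; apply/andP; split.
  rewrite -gm fK; near: y; apply: lt_nbhsr; rewrite -fm gK; lra.
rewrite -gm fK; near: y; apply: lt_nbhsl; rewrite -fm gK; lra.
Unshelve. all: by end_near.
Qed.

Fact gpow_key : unit. Proof. exact: tt. Qed.

(* Locked, so that unification never unfolds real powers. *)
Definition gpow (R : realType) : R -> R -> R -> R := locked_with gpow_key
  (fun a b x => Num.sg x * (if `|x| <= 1 then `|x| `^ a else `|x| `^ b)).

Section GluedPower.
Context {R : realType}.
Implicit Types a b p q x y : R.

Lemma gpowE a b x :
  gpow a b x = Num.sg x * (if `|x| <= 1 then `|x| `^ a else `|x| `^ b).
Proof. by rewrite /gpow unlock. Qed.

Lemma gpowN a b x : gpow a b (- x) = - gpow a b x.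
Proof. by rewrite !gpowE sgrN normrN mulNr. Qed.

Lemma gpow0 a b : gpow a b 0 = 0.
Proof. by rewrite !gpowE sgr0 mul0r. Qed.

Lemma gpow_pos a b x : 0 < x ->
  gpow a b x = if x <= 1 then x `^ a else x `^ b.
Proof. by move=> x0; rewrite !gpowE gtr0_sg// mul1r gtr0_norm. Qed.

Lemma gpow1 a b : gpow a b 1 = 1.
Proof. by rewrite gpow_pos// lexx powR1. Qed.

Lemma gpow_gt0 a b x : 0 < x -> 0 < gpow a b x.
Proof. by move=> x0; rewrite gpow_pos//; case: ifP => _; exact: powR_gt0. Qed.

Lemma gpow_ge0 a b x : 0 <= x -> 0 <= gpow a b x.
Proof.
by rewrite le_eqVlt => /predU1P[<-|/gpow_gt0/ltW//]; rewrite gpow0.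
Qed.

Lemma norm_gpow a b x : `|gpow a b x| = gpow a b `|x|.
Proof.
case: (ltgtP x 0) => [x0|x0|->]; last by rewrite normr0 gpow0 normr0.
  have x0N : 0 < - x by rewrite oppr_gt0.
  by rewrite -normrN -gpowN (gtr0_norm (gpow_gt0 _ _ x0N)) ltr0_norm.
by rewrite gtr0_norm ?gpow_gt0// gtr0_norm.
Qed.

Lemma gpowM a x l : 0 < l -> gpow a a (l * x) = l `^ a * gpow a a x.
Proof.
move=> l0; rewrite !gpowE !if_same sgrM (gtr0_sg l0) mul1r normrM.
by rewrite (gtr0_norm l0) powRM ?normr_ge0 ?ltW// mulrCA.
Qed.

(** Glued powers fix 1 and preserve each side of it, so the branches compose separately. This is why
    all of them switch at the same point. *)
Lemma gpow_comp a b c d x : 0 < c -> 0 < d ->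
  gpow a b (gpow c d x) = gpow (c * a) (d * b) x.
Proof.
move=> c0 d0; have H y : 0 < y -> gpow a b (gpow c d y) = gpow (c * a) (d * b) y.
  move=> y0; rewrite (gpow_pos _ _ (gpow_gt0 _ _ y0)) !(gpow_pos _ _ y0).
  case: (leP y 1) => y1.
    have -> : y `^ c <= 1.
      by rewrite -(powRr0 y); apply: ger_powR; rewrite ?y0// ltW.
    by rewrite powRrM.
  have -> : y `^ d <= 1 = false.
    by apply/negbTE; rewrite -ltNge powR_gt1.
  by rewrite powRrM.
case: (ltgtP x 0) => [x0|x0|->]; [|exact: H|by rewrite !gpow0].
have x0N : 0 < - x by rewrite oppr_gt0.
by have := H _ x0N; rewrite !gpowN => /oppr_inj.
Qed.

Lemma gpow_id x : gpow 1 1 x = x.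
Proof.
rewrite !gpowE if_same powRr1//; case: (ltgtP x 0) => [x0|x0|->].
- by rewrite ltr0_sg// ltr0_norm// mulN1r opprK.
- by rewrite gtr0_sg// gtr0_norm// mul1r.
- by rewrite sgr0 mul0r.
Qed.

Lemma gpowK a b : 0 < a -> 0 < b -> cancel (gpow a b) (gpow a^-1 b^-1).
Proof. by move=> a0 b0 x; rewrite gpow_comp// !divff ?gt_eqF// gpow_id. Qed.

Lemma gpowVK a b : 0 < a -> 0 < b -> cancel (gpow a^-1 b^-1) (gpow a b).
Proof.
by move=> a0 b0 x; rewrite gpow_comp ?invr_gt0// !mulVf ?gt_eqF// gpow_id.
Qed.

(** On one branch the ratio of the values is an exact power of [y / x]. If 1 separates [x] and [y],
    it is a power of [1 / x] times a power of [y], both with exponents in [[p, q]]. Monotonicity,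
    sublinearity and the slope bound rest on this. *)
Lemma gpow_ratio p q a b x y : p <= a <= q -> p <= b <= q -> 0 < x -> x <= y ->
  gpow a b x * (y / x) `^ p <= gpow a b y <= gpow a b x * (y / x) `^ q.
Proof.
move=> /andP[pa aq] /andP[pb bq] x0 xy.
have y0 : 0 < y by apply: lt_le_trans xy.
rewrite !gpow_pos//.
have yx1 : 1 <= y / x by rewrite ler_pdivlMr ?mul1r.
have key c : y `^ c = x `^ c * (y / x) `^ c.
  by rewrite -powRM ?divr_ge0 ?ltW// mulrC divfK ?gt_eqF.
case: (leP y 1) => y1.
  by rewrite (le_trans xy y1) key !ler_pM2l ?powR_gt0// !ler_powR.
case: (leP x 1) => x1; last by rewrite key !ler_pM2l ?powR_gt0// !ler_powR.
have xx c : x `^ a * (y / x) `^ c = y `^ c * (x `^ a * (x^-1) `^ c).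
  by rewrite powRM ?invr_ge0 ?ltW//; ring.
have xV c : x `^ c * x^-1 `^ c = 1.
  by rewrite -powRM ?invr_ge0 ?ltW// divff ?gt_eqF// powR1.
have xi1 : 1 <= x^-1 by rewrite invf_ge1.
rewrite !xx; apply/andP; split.
  apply: (@le_trans _ _ (y `^ p)); last by apply: ler_powR => //; exact: ltW.
  rewrite -[leRHS]mulr1 ler_pM2l ?powR_gt0// -(xV a) ler_pM2l ?powR_gt0//.
  exact: ler_powR.
apply: (@le_trans _ _ (y `^ q)); first by apply: ler_powR => //; exact: ltW.
rewrite -[leLHS]mulr1 ler_pM2l ?powR_gt0// -[leLHS](xV a) ler_pM2l ?powR_gt0//.
exact: ler_powR.
Qed.

Lemma ltr_gpow a b : 0 < a -> 0 < b -> {mono gpow a b : x y / x < y}.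
Proof.
move=> a0 b0; apply: leW_mono; apply: le_mono.
have pos x y : 0 < x -> x < y -> gpow a b x < gpow a b y.
  move=> x0 xy; pose p := Num.min a b; pose q := Num.max a b.
  have p0 : 0 < p by rewrite /p lt_min a0.
  have /andP[+ _] : gpow a b x * (y / x) `^ p <= gpow a b y
      <= gpow a b x * (y / x) `^ q.
    by apply: gpow_ratio; rewrite ?ge_min ?le_max ?lexx ?orbT ?(ltW xy).
  apply: lt_le_trans; rewrite -[ltLHS]mulr1 ltr_pM2l ?gpow_gt0//.
  by apply: powR_gt1 => //; rewrite ltr_pdivlMr// mul1r.
have neg x : x < 0 -> gpow a b x < 0.
  by move=> x0; rewrite -oppr_gt0 -gpowN gpow_gt0// oppr_gt0.
move=> x y xy; case: (ltgtP x 0) => x0; last first.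
- by rewrite x0 gpow0 gpow_gt0// -x0.
- exact: pos.
case: (ltgtP y 0) => y0; last first.
- by rewrite y0 gpow0 neg.
- by apply: (@lt_trans _ _ 0); [exact: neg|exact: gpow_gt0].
by rewrite -ltrN2 -!gpowN pos ?ltrN2// oppr_gt0.
Qed.

Lemma ler_gpow a b : 0 < a -> 0 < b -> {mono gpow a b : x y / x <= y}.
Proof. by move=> a0 b0; apply: le_mono => x y xy; rewrite ltr_gpow. Qed.

Lemma gpow_continuous a b : 0 < a -> 0 < b -> continuous (gpow a b).
Proof.
move=> a0 b0; apply: (@can_mono_continuous _ _ (gpow a^-1 b^-1)).
- exact: ltr_gpow.
- by apply: ltr_gpow; rewrite invr_gt0.
- exact: gpowK.
- exact: gpowVK.
Qed.

Lemma gpow_sublinear a b x y : 0 <= a <= 1 -> 0 <= b <= 1 -> 0 < x -> x <= y ->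
  gpow a b y <= y / x * gpow a b x.
Proof.
move=> ha hb x0 xy; have /andP[_] := gpow_ratio ha hb x0 xy.
have yx0 : 0 <= y / x by rewrite divr_ge0 ?ltW// (lt_le_trans x0).
by rewrite (powRr1 yx0) mulrC.
Qed.

(* The glued power is concave on the half-line, hence steep on bounded sets. *)
Lemma gpow_slope w a b s B u v : 0 < w -> w <= a <= 1 -> w <= b <= 1 ->
  0 < s -> 1 <= B -> `|u| <= B * s -> `|v| <= B * s -> v <= u ->
  w / B * (gpow a b s / s) * (u - v) <= gpow a b u - gpow a b v.
Proof.
move=> w0 /andP[wa a1] /andP[wb b1] s0 B1.
have a0 : 0 < a by lra.
have b0 : 0 < b by lra.
have B0 : 0 < B by lra.
set k := w / B * _.
have pos x y : 0 <= y -> y <= x -> x <= B * s ->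
    k * (x - y) <= gpow a b x - gpow a b y.
  move=> y0 yx xBs.
  have [x0|x0] := leP x 0.
    have -> : x = 0 by lra.
    have -> : y = 0 by lra.
    by rewrite !subrr mulr0.
  have Hs : gpow a b s * x <= B * s * gpow a b x.
    have h1 : gpow a b s <= gpow a b (B * s).
      by rewrite ler_gpow// ler_peMl// ltW.
    have h2 : gpow a b (B * s) <= B * s / x * gpow a b x.
      by apply: gpow_sublinear => //; lra.
    rewrite -(ler_pM2r x0) in h1; rewrite -(ler_pM2r x0) in h2.
    apply: le_trans h1 (le_trans h2 _).
    by rewrite mulrAC divfK ?gt_eqF.
  have Hy : gpow a b y <= gpow a b x * (y / x) `^ w.
    move: y0; rewrite le_eqVlt => /predU1P[<-|y0].
      by rewrite gpow0 mul0r mulr_ge0 ?powR_ge0 ?gpow_ge0 ?ltW.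
    have ha : w <= a <= 1 by lra.
    have hb : w <= b <= 1 by lra.
    have /andP[+ _] := gpow_ratio ha hb y0 yx.
    have h : 0 < (y / x) `^ w by rewrite powR_gt0 ?divr_gt0.
    have hV : (x / y) `^ w * (y / x) `^ w = 1.
      by rewrite -powRM ?divr_ge0 ?(ltW x0) ?(ltW y0)// mulrA divfK ?gt_eqF//
        divff ?gt_eqF// powR1.
    by rewrite -(ler_pM2r h) -mulrA hV mulr1.
  have Hb : (y / x) `^ w <= 1 - w * (1 - y / x).
    by apply: powR_bernoulli; [lra|exact: divr_ge0 y0 (ltW x0)].
  have gx0 : 0 < gpow a b x by exact: gpow_gt0.
  have h3 : gpow a b x * (w * (1 - y / x)) <= gpow a b x - gpow a b y.
    rewrite -(ler_pM2l gx0) in Hb; lra.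
  apply: le_trans h3.
  have -> : gpow a b x * (w * (1 - y / x)) = gpow a b x / x * (w * (x - y)).
    by field; rewrite gt_eqF.
  have -> : k * (x - y) = gpow a b s / (B * s) * (w * (x - y)).
    by rewrite /k; field; rewrite !gt_eqF.
  apply: ler_wpM2r; first by apply: mulr_ge0; lra.
  by rewrite ler_pdivrMr ?mulr_gt0// mulrAC ler_pdivlMr// [leRHS]mulrC.
(* Negative arguments are handled by oddness; if 0 lies between [v] and [u], the bounds on the two
   sides of 0 are added. *)
move=> uB vB vu; have [v0|v0] := leP 0 v.
  by apply: pos => //; rewrite (le_trans (ler_norm _)).
have [u0|u0] := leP 0 u; last first.
  have := pos (- v) (- u); rewrite !gpowN.
  have hv : - v <= B * s by rewrite (le_trans (ler_norm _))// normrN.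
  have h1 : 0 <= - u by lra.
  have h2 : - u <= - v by lra.
  move=> /(_ h1 h2 hv).
  lra.
have hv : - v <= B * s by rewrite (le_trans (ler_norm _))// normrN.
have hu : u <= B * s by rewrite (le_trans (ler_norm _)).
have v0' : 0 <= - v by lra.
have := pos u 0 (lexx _) u0 hu; have := pos (- v) 0 (lexx _) v0' hv.
rewrite gpowN gpow0 !subr0; lra.
Qed.

Lemma gpow_near_pow a b x : 0 <= a -> 0 <= b ->
  `|gpow a b x - gpow b b x| <= 1.
Proof.
move=> a0 b0.
rewrite !gpowE if_same -mulrBr normrM; case: ifP => [x1|_]; last first.
  by rewrite subrr normr0 mulr0.
have [->|x0] := eqVneq x 0; first by rewrite sgr0 normr0 mul0r.
rewrite normr_sg x0 mul1r.
have P c : c >= 0 -> 0 <= `|x| `^ c <= 1.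
  move=> c0; rewrite powR_ge0 /= -(powRr0 `|x|); apply: ger_powR => //.
  by rewrite normr_gt0 x0.
have := P _ a0; have := P _ b0; rewrite ler_norml; lra.
Qed.

Lemma gpow_small a b x : `|x| <= 1 -> gpow a b x = gpow a a x.
Proof. by rewrite !gpowE if_same => ->. Qed.

(** The slope is at most 1 beyond 1 but may be infinite at 0; the constant 2 pays for the unit
    intervals on both sides of 0. This serves the limit at infinity, where bounded errors are
    harmless. *)
Lemma gpow_quasilipschitz a b x y : 0 < a <= 1 -> 0 < b <= 1 ->
  `|gpow a b x - gpow a b y| <= 2 + `|x - y|.
Proof.
move=> /andP[a0 a1] /andP[b0 b1].
have le1 z : 0 <= z -> gpow a b z <= 1 + z.
  move=> z0; have [z1|z1] := leP z 1.
    have : gpow a b z <= gpow a b 1 by rewrite ler_gpow.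
    rewrite gpow1; lra.
  have := @gpow_sublinear a b 1 z; rewrite gpow1 divr1 mulr1.
  have ha : 0 <= a <= 1 by lra.
  have hb : 0 <= b <= 1 by lra.
  by move=> /(_ ha hb ltr01 (ltW z1)); lra.
have pos z t : 0 <= t -> t <= z -> gpow a b z - gpow a b t <= 2 + (z - t).
  move=> t0 tz; have [t1|t1] := leP t 1.
    have := le1 z (le_trans t0 tz); have := gpow_ge0 a b t0; lra.
  have t0' : 0 < t by lra.
  have ha : 0 <= a <= 1 by lra.
  have hb : 0 <= b <= 1 by lra.
  have h1 := gpow_sublinear ha hb t0' tz.
  have h2 := gpow_sublinear ha hb ltr01 (ltW t1).
  rewrite gpow1 divr1 mulr1 in h2.
  have h3 : (z / t - 1) * gpow a b t <= (z / t - 1) * t.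
    apply: ler_wpM2l => //; rewrite subr_ge0 ler_pdivlMr ?mul1r//; lra.
  have h4 : (z / t - 1) * t = z - t by field; rewrite gt_eqF.
  lra.
wlog yx : x y / y <= x.
  move=> H; have [/H//|/ltW/H] := leP y x.
  by rewrite distrC (distrC y).
rewrite ger0_norm ?subr_ge0 ?ler_gpow// ger0_norm ?subr_ge0//.
have [y0|y0] := leP 0 y; first exact: pos.
have [x0|x0] := leP 0 x.
  have := le1 x x0; have := le1 (- y); rewrite gpowN.
  have y0' : 0 <= - y by lra.
  move=> /(_ y0'); lra.
have := pos (- y) (- x); rewrite !gpowN.
have x0' : 0 <= - x by lra.
have yx' : - x <= - y by lra.
move=> /(_ x0' yx'); lra.
Qed.

End GluedPower.

(** * Barriers and the mean value inequality *)

Section OneVariable.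
Context {R : realType} {V : normedModType R}.

Lemma within_continuousP (A : set R) (f : R -> V) :
  {within A, continuous f} <->
  forall x, A x -> forall e, 0 < e -> \forall y \near x, A y -> `|f y - f x| < e.
Proof.
split.
  move=> /subspace_continuousP H x Ax e e0.
  have /cvgrPdist_lt/(_ e e0) := H x Ax.
  by rewrite near_withinE; apply: filterS => y P /P; rewrite distrC.
move=> H; apply/subspace_continuousP => x Ax; apply/cvgrPdist_lt => e e0.
rewrite near_withinE; apply: filterS (H x Ax e e0) => y P /P.
by rewrite distrC.
Qed.

(** The little-o form suits vector values and can be checked on each side of a point separately, as
    left secants and the gluing of solutions require. *)
Lemma is_deriveP (f : R -> V) (t : R) (v : V) : is_derive t 1 f v <->
  forall e, 0 < e -> \forall u \near t,
    `|f u - f t - (u - t) *: v| <= e * `|u - t|.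
Proof.
split.
  move=> [df dv] e e0.
  have : h^-1 *: ((f \o shift t) (h *: 1) - f t) @[h --> 0^'] --> v.
    by rewrite -dv; exact: df.
  move=> /cvgrPdist_le/(_ e e0)/nbhs_ballP[d /= d0 H].
  apply/nbhs_ballP; exists d => //= u; rewrite /ball /= => utd.
  have [->|ut] := eqVneq u t; first by rewrite !subrr scale0r subr0 !normr0 mulr0.
  have h0 : u - t != 0 by rewrite subr_eq0.
  have /= := H (u - t).
  rewrite /ball /= sub0r normrN distrC => /(_ utd h0).
  have -> : (u - t) *: (1 : R) = u - t by rewrite /GRing.scale /= mulr1.
  rewrite subrK => P.
  have -> : f u - f t - (u - t) *: v =
      (u - t) *: - (v - (u - t)^-1 *: (f u - f t)).
    by rewrite opprB scalerBr scalerA divff// scale1r.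
  by rewrite normrZ normrN mulrC [`|t - u|]distrC ler_wpM2r ?normr_ge0.
move=> H.
have C : h^-1 *: ((f \o shift t) (h *: 1) - f t) @[h --> 0^'] --> v.
  apply/cvgrPdist_le => e e0; have /nbhs_ballP[d /= d0 P] := H e e0.
  apply/nbhs_ballP; exists d => //= h; rewrite /ball /= sub0r normrN => hd h0.
  have -> : h *: (1 : R) = h by rewrite /GRing.scale /= mulr1.
  have := P (h + t); rewrite /ball /= opprD addrCA subrr addr0 normrN => /(_ hd).
  rewrite addrK => Q.
  have -> : v - h^-1 *: (f (h + t) - f t) = - (h^-1 *: (f (h + t) - f t - h *: v)).
    by rewrite [in RHS]scalerBr [in RHS]scalerA mulVf// scale1r opprB.
  rewrite normrN normrZ normfV mulrC ler_pdivrMr ?normr_gt0//.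
split; first by apply/cvg_ex; exists v.
exact/cvg_lim.
Qed.

End OneVariable.

(* If no barrier can be reached from below, no barrier is ever reached: look at
   the first contact. *)
Lemma barrier (R : realType) (I : finType) (g : I -> R -> R) (b : R) :
  (forall i, {within `[0, b], continuous (g i)}) ->
  (forall i, g i 0 < 0) ->
  (forall t i, 0 < t <= b -> (forall j, g j t <= 0) -> g i t = 0 ->
    \forall u \near t^'-, 0 < g i u) ->
  forall t i, 0 <= t <= b -> g i t < 0.
Proof.
move=> gc g0 H t0 i0 t0b; rewrite ltNge; apply/negP => git0.
pose A := [set t : R | 0 <= t <= b /\ exists i, 0 <= g i t].
have At0 : A t0 by split=> //; exists i0.
have Alb : has_lbound A by exists 0 => x [/andP[]].
have Ainf : has_inf A by split => //; exists t0.
pose c := inf A.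
have c0 : 0 <= c by apply: lb_le_inf; [exists t0|move=> x [/andP[]]].
have ct0 : c <= t0 by exact: ge_inf.
have cb : c <= b by move/andP: t0b => [_]; exact: le_trans.
have before s i : 0 <= s -> s < c -> g i s < 0.
  move=> s0 sc; rewrite ltNge; apply/negP => gs.
  have : c <= s.
    by apply: ge_inf => //; split; [rewrite s0 (le_trans (ltW sc) cb)|exists i].
  by rewrite leNgt sc.
have ccont i e : 0 < e ->
    \forall y \near c, (0 <= y <= b) -> `|g i y - g i c| < e.
  move=> e0; have cin : `[0, b]%classic c by rewrite /= in_itv /= c0 cb.
  have := (within_continuousP _ _).1 (gc i) c cin e e0.
  by apply: filterS => y P yb; apply: P; rewrite /= in_itv.
(* The infimum is a contact: if all barriers were negative at [c], then, being finitely many, they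
   would remain so near [c]. *)
have [alln|] := pselect (forall i, g i c < 0).
  have N i : \forall y \near c, (0 <= y <= b) -> g i y < 0.
    have := alln i; rewrite -oppr_gt0 => /(ccont i).
    apply: filterS => y P /P; rewrite ltr_norml; lra.
  have : \forall y \near c, forall i, (0 <= y <= b) -> g i y < 0.
    exact: (filter_forall _ N).
  move=> /nbhs_ballP[d /= d0 Q].
  have [s [sb [i gs]] sc] := inf_adherent d0 Ainf.
  have cs : c <= s by apply: ge_inf => //; split => //; exists i.
  have : g i s < 0.
    apply: (Q s _ i sb); rewrite /ball /= ltr_norml.
    by move: sc; rewrite -/c => sc; lra.
  by rewrite ltNge gs.
move=> /existsNP[i /negP]; rewrite -leNgt => gic.
have cgt0 : 0 < c.
  rewrite lt_neqAle c0 andbT; apply/negP => /eqP c0'.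
  by move: gic; rewrite -c0' leNgt g0.
have left (P : set R) : (\forall y \near c, P y) -> exists s, [/\ 0 <= s, s < c & P s].
  move=> /nbhs_ballP[d /= d0 Q].
  exists (Num.max 0 (c - d / 2)); split.
  - by rewrite le_max lexx.
  - by rewrite gt_max cgt0 /=; lra.
  - apply: Q; rewrite /ball /= ltr_norml; apply/andP; split.
      have : Num.max 0 (c - d / 2) <= c by rewrite ge_max c0 /=; lra.
      lra.
    have : c - d / 2 <= Num.max 0 (c - d / 2) by rewrite le_max lexx orbT.
    lra.
have nonpos j : g j c <= 0.
  rewrite leNgt; apply/negP => gj.
  have [s [s0 sc]] := left _ (ccont j _ gj).
  have sb : 0 <= s <= b by rewrite s0 (le_trans (ltW sc) cb).
  move=> /(_ sb); have := before s j s0 sc; rewrite ltr_norml; lra.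
have gic0 : g i c = 0 by apply/eqP; rewrite eq_le nonpos gic.
have /H : 0 < c <= b by rewrite cgt0 cb.
move=> /(_ i nonpos gic0).
rewrite near_withinE => /left[s [s0 sc]] /(_ sc).
by have := before s i s0 sc; lra.
Qed.

Lemma mean_value_bound (R : realType) (V : normedModType R) (f f' : R -> V)
    (e a b : R) : a <= b -> 0 <= e ->
  {within `[a, b], continuous f} ->
  (forall t, a < t <= b -> is_derive t 1 f (f' t)) ->
  (forall t, a < t <= b -> `|f' t| <= e) ->
  `|f b - f a| <= e * (b - a).
Proof.
move=> ab e0 fc fd f'v; apply/ler_addgt0Pr => eta eta0.
(* [k] is a slack both in the slope, so that a contact is transversal, and in the constant, so that
   the barrier is not touched at the start. *)
pose k := eta / (2 * (b - a + 1)).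
have k0 : 0 < k by rewrite divr_gt0//; lra.
have kb : k * (b - a) + k <= eta.
  have -> : k * (b - a) + k = eta / 2 by rewrite /k; field; lra.
  lra.
pose g (_ : unit) (s : R) : R := `|f (a + s) - f a| - (e + k) * s - k.
suff : g tt (b - a) < 0.
  by rewrite /g (addrC a) subrK mulrDl; lra.
apply: (@barrier _ _ g (b - a)).
- move=> ?; apply/within_continuousP => x; rewrite /= in_itv /= => xab d d0.
  have ax : `[a, b]%classic (a + x) by rewrite /= in_itv /=; lra.
  have d3 : 0 < d / 3 by lra.
  have P := (within_continuousP _ _).1 fc _ ax _ d3.
  have P' : \forall y \near x, `[a, b]%classic (a + y) ->
      `|f (a + y) - f (a + x)| < d / 3.
    move/nbhs_ballP : P => [r /= r0 Q]; apply/nbhs_ballP; exists r => //= y.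
    by rewrite /ball /= => xy; apply: Q; rewrite /ball /= opprD addrACA subrr add0r.
  have ek : 0 < e + k by lra.
  near=> y; rewrite in_itv /= => yab.
  have h1 : `|f (a + y) - f (a + x)| < d / 3.
    have ay : `[a, b]%classic (a + y) by rewrite /= in_itv /=; lra.
    by move: ay; near: y.
  have h2 : (e + k) * `|x - y| < d / 3.
    rewrite mulrC -ltr_pdivlMr//; near: y; apply: cvgr_dist_lt => //.
    by rewrite divr_gt0.
  have h3 : `| `|f (a + y) - f a| - `|f (a + x) - f a| | <=
      `|f (a + y) - f (a + x)|.
    apply: le_trans (ler_dist_dist _ _) _.
    by rewrite opprB addrA subrK.
  rewrite -(gtr0_norm ek) -normrM in h2.
  move: h1 h2 h3; rewrite /g ler_norml !ltr_norml mulrBr; lra.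
- by move=> ?; rewrite /g addr0 subrr normr0 mulr0; lra.
- move=> t i tab _ gt0.
  have atb : a < a + t <= b by lra.
  have k2 : 0 < k / 2 by lra.
  have /is_deriveP/(_ _ k2) := fd _ atb.
  move=> /nbhs_ballP[r /= r0 Q]; rewrite near_withinE; apply/nbhs_ballP.
  exists r => //= u; rewrite /ball /= => tu ut.
  have := Q (a + u); rewrite /ball /= opprD addrACA subrr add0r => /(_ tu).
  have -> : a + u - (a + t) = u - t by ring.
  rewrite [`|u - t|]ltr0_norm ?subr_lt0// => h1.
  have h2 := f'v _ atb.
  have h3 : `|f (a + t) - f a| <= `|f (a + u) - f a| + `|f (a + u) - f (a + t)|.
    by rewrite (distrC _ (f a)) (le_trans (ler_distD (f (a + u)) _ _))//
      (distrC (f a)) lerD2l distrC.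
  have h4 : `|f (a + u) - f (a + t)| <=
      `|f (a + u) - f (a + t) - (u - t) *: f' (a + t)| + (t - u) * e.
    rewrite -[X in `|X| <= _](subrK ((u - t) *: f' (a + t))).
    apply: le_trans (ler_normD _ _) _; rewrite lerD2l normrZ.
    rewrite ltr0_norm ?subr_lt0// opprB ler_wpM2l//; lra.
  have ku : 0 < k * (t - u) by apply: mulr_gt0; lra.
  move: gt0; rewrite /g => gt0.
  have h5 : e * (t - u) = (t - u) * e by ring.
  lra.
- by lra.
Unshelve. all: by end_near.
Qed.

Lemma mean_value_ineq (R : realType) (V : normedModType R) (f f' : R -> V)
    (v : V) (e a b : R) : a <= b -> 0 <= e ->
  {within `[a, b], continuous f} ->
  (forall t, a < t <= b -> is_derive t 1 f (f' t)) ->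
  (forall t, a < t <= b -> `|f' t - v| <= e) ->
  `|f b - f a - (b - a) *: v| <= e * (b - a).
Proof.
move=> ab e0 fc fd f'v.
have := @mean_value_bound _ _ (fun t => f t - t *: v) (fun t => f' t - v) e a b
  ab e0.
have -> : f b - b *: v - (f a - a *: v) = f b - f a - (b - a) *: v.
  by rewrite scalerBl !opprB [LHS]addrACA [RHS]addrACA (addrC (- (b *: v))).
apply => //.
- apply/subspace_continuousP => x xab; apply: cvgB.
    by move/subspace_continuousP : fc; exact.
  by apply: cvg_within_filter; exact: scalel_continuous.
- move=> t tab; apply: is_deriveB; first exact: fd.
  apply/is_deriveP => d d0; near=> u.
  by rewrite -scalerBl subrr normr0 mulr_ge0 // ltW.
Unshelve. all: by end_near.
Qed.

(** * Peano's theorem *)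

Lemma ultra_fmap (T U : Type) (f : T -> U) (F : set_system T) :
  UltraFilter F -> UltraFilter (f @ F).
Proof.
move=> FU; split=> [|G GP FG]; first exact: fmap_proper_filter.
apply/seteqP; split => // A GA.
have [//|FnA] := in_ultra_setVsetC (f @^-1` A) FU.
have GnA : G (~` A) by exact: FG.
have := filter_ex (filterI GA GnA); rewrite setICr.
by case.
Qed.

Section Peano.
Context {R : realType} {V : normedModType R}.
Implicit Types (F : V -> V) (x v : V).

Definition euler F x (h : R) (j : nat) : V := iter j (fun z => z + h *: F z) x.

(** With [v = 0] this is a Lipschitz bound for the polygons; with [v] a value of [F] it controls
    their difference quotients. *)
Lemma euler_increment F x h v e a m : 0 <= h ->
  (forall j, (a <= j < a + m)%N -> `|F (euler F x h j) - v| <= e) ->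
  `|euler F x h (a + m) - euler F x h a - (m%:R * h) *: v| <= m%:R * h * e.
Proof.
move=> h0; elim: m => [|m IH] H.
  by rewrite addn0 subrr !mul0r scale0r subr0 normr0.
rewrite addnS /= -/(euler F x h (a + m)).
have -> : euler F x h (a + m) + h *: F (euler F x h (a + m)) - euler F x h a -
    (m.+1%:R * h) *: v = (euler F x h (a + m) - euler F x h a - (m%:R * h) *: v) +
    h *: (F (euler F x h (a + m)) - v).
  rewrite -natr1 mulrDl mul1r scalerDl scalerBr opprD !addrA.
  by congr (_ - _); rewrite -!addrA; congr (_ + _); rewrite addrC addrA.
apply: le_trans (ler_normD _ _) _; rewrite -natr1 mulrDl mul1r mulrDl.
apply: lerD.
  by apply: IH => j /andP[aj jm]; apply: H; rewrite aj addnS ltnS ltnW.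
by rewrite normrZ ger0_norm// ler_wpM2l// H// leq_addr addnS /=.
Qed.

Lemma norm_increment_perturb (p p' q q' v : V) (c m : R) :
  `|p - q - c *: v| <=
  `|p - p'| + `|q - q'| + `|p' - q' - m *: v| + `|m - c| * `|v|.
Proof.
have -> : p - q - c *: v =
    (p - p') - (q - q') + (p' - q' - m *: v) + (m - c) *: v.
  rewrite scalerBl opprB !addrA.
  rewrite [RHS](ACl ((1 * 4 * 9) * (2 * 5) * (3 * 6) * (7 * 8))%AC) /=.
  by rewrite addNr subrr addNr !addr0.
apply: le_trans (ler_normD _ _) _; rewrite normrZ lerD2r.
apply: le_trans (ler_normD _ _) _; rewrite lerD2r.
exact: ler_normB.
Qed.

(* The solution is the limit of the Euler polygons along an ultrafilter: each
   value converges by compactness, and no uniform convergence is needed. *)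
Lemma peano F x : (forall M : R, compact [set y : V | `|y| <= M]) ->
  continuous F ->
  exists2 tau : R, 0 < tau & exists2 Z : R -> V, Z 0 = x &
    forall t, 0 <= t <= tau -> forall e, 0 < e -> \forall u \near t,
      0 <= u <= tau -> `|Z u - Z t - (u - t) *: F (Z t)| <= e * `|u - t|.
Proof.
move=> cptV Fc.
have [r r0 Hr] : exists2 r, 0 < r & forall y, `|x - y| <= r -> `|F y - F x| <= 1.
  have /cvgrPdist_lt/(_ 1 ltr01)/nbhs_normP[r /= r0 H] := Fc x.
  exists (r / 2); first lra.
  move=> y xy; rewrite distrC; apply/ltW/H; apply: le_lt_trans xy _; lra.
pose M := `|F x| + 1.
have M0 : 0 < M by have := normr_ge0 (F x); rewrite /M; lra.
have FM y : `|x - y| <= r -> `|F y - 0| <= M.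
  move=> /Hr h; rewrite subr0 -(subrK (F x) (F y)).
  by apply: le_trans (ler_normD _ _) _; rewrite /M addrC lerD2l.
(* Polygons of speed at most [M] stay in the ball of radius [r] up to this time. *)
pose tau := r / M.
have tau0 : 0 < tau by rewrite divr_gt0.
pose h (k : nat) : R := k.+1%:R^-1.
have h0 k : 0 < h k by rewrite invr_gt0.
pose Z k j := euler F x (h k) j.
have near_x k j : j%:R * h k <= tau -> `|x - Z k j| <= r.
  elim: j {-2}j (leqnn j) => [|N IH] j jN jt.
    by move: jN; rewrite leqn0 => /eqP ->; rewrite subrr normr0 ltW.
  have := @euler_increment F x (h k) 0 M 0 j (ltW (h0 k)).
  rewrite add0n scaler0 subr0 -/(Z k j) /= distrC => H.
  apply: le_trans (H _) _; last by rewrite -ler_pdivlMr.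
  move=> i /= ij; apply: FM; apply: IH; first by rewrite -ltnS (leq_trans ij).
  by apply: le_trans jt; rewrite ler_pM2r// ler_nat ltnW.
have Zlip k i j : (i <= j)%N -> j%:R * h k <= tau ->
    `|Z k j - Z k i| <= (j%:R * h k - i%:R * h k) * M.
  move=> ij jt; have := @euler_increment F x (h k) 0 M i (j - i) (ltW (h0 k)).
  rewrite subnKC// scaler0 subr0 -mulrBl -natrB//; apply => l /andP[_ lj].
  apply: FM; apply: near_x; apply: le_trans jt.
  by rewrite ler_pM2r// ler_nat ltnW.
pose idx (k : nat) (t : R) : nat := Num.truncn (t * k.+1%:R).
have idxP k t : 0 <= t -> (idx k t)%:R * h k <= t < (idx k t)%:R * h k + h k.
  move=> t0; have := @truncn_itv R (t * k.+1%:R).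
  have k0 : 0 < k.+1%:R :> R by [].
  have hk : h k * k.+1%:R = 1 by rewrite mulVf// gt_eqF.
  rewrite mulr_ge0// => /(_ isT); rewrite -/(idx k t) => /andP[i1 i2].
  have := ler_wpM2r (ltW (h0 k)) i1; rewrite -(ltr_pM2r (h0 k)) in i2.
  rewrite -mulrA (mulrC _ (h k)) hk mulr1 in i2 *.
  by rewrite -natr1 mulrDl mul1r in i2; move=> ->.
(* One ultrafilter makes the polygons converge at all times at once, with no extraction of
   subsequences. *)
have [U [UU Uoo]] := ultraFilterLemma eventually_filter.
have hU e : 0 < e -> U [set k | h k < e].
  by move=> e0; apply: Uoo; exact: near_infty_natSinv_lt (PosNum e0).
have Xex (t : R) : exists y : V,
    0 <= t <= tau -> (fun k => Z k (idx k t)) @ U --> y.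
  have [tt|] := pselect (0 <= t <= tau); last by exists x.
  have := cptV (`|x| + r); rewrite compact_ultra => /(_ ((fun k => Z k (idx k t)) @ U)).
  have UI : UltraFilter ((fun k => Z k (idx k t)) @ U) by exact: ultra_fmap.
  case=> [|y [_ /= cy]]; last by exists y.
  apply: (@filterE _ U) => k /=.
  rewrite -(subrK x (Z k _)); apply: le_trans (ler_normD _ _) _.
  rewrite addrC lerD2l distrC near_x//.
  by have /andP[t0 tt'] := tt; have /andP[+ _] := idxP k t t0; lra.
have [X XP] := choice Xex.
have XU t e : 0 <= t <= tau -> 0 < e -> U [set k | `|X t - Z k (idx k t)| < e].
  by move=> /XP /cvgrPdist_lt/(_ e) H /H.
have idx_le k a b : a <= b -> (idx k a <= idx k b)%N.
  by move=> ab; apply: le_truncn; rewrite ler_pM2r.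
(* Only the limits at [a], [b] and [t] enter, so a single step size approximates them all; between
   [a] and [b] the Lipschitz bound keeps the polygon near [X t], hence [F] near [F (X t)] along
   it. *)
have key a b t e d : 0 <= a -> a <= t -> t <= b -> b <= tau -> 0 < e -> 0 < d ->
    (forall y, `|X t - y| < d -> `|F y - F (X t)| <= e) -> (b - a) * M < d / 4 ->
    `|X b - X a - (b - a) *: F (X t)| <= e * (b - a).
  move=> a0 at_ tb bt e0 d0 Fd bad; apply/ler_addgt0Pr => eta eta0.
  pose W := `|F (X t)| + e.
  have W0 : 0 < W by have := normr_ge0 (F (X t)); rewrite /W; lra.
  have aI : 0 <= a <= tau by lra.
  have bI : 0 <= b <= tau by lra.
  have tI : 0 <= t <= tau by lra.
  have eta4 : 0 < eta / 4 by lra.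
  have d4 : 0 < d / 4 by lra.
  have [k [[[[ka kb] kt] kM] kW]] := filter_ex (filterI (filterI (filterI (filterI
    (XU a _ aI eta4) (XU b _ bI eta4)) (XU t _ tI d4))
    (hU _ (divr_gt0 d4 M0))) (hU _ (divr_gt0 eta4 W0))).
  rewrite /= in ka kb kt kM kW.
  rewrite ltr_pdivlMr// in kM; rewrite ltr_pdivlMr// in kW.
  have hk := h0 k.
  have t0 : 0 <= t by lra.
  have b0 : 0 <= b by lra.
  have /andP[ia ia'] := idxP k a a0.
  have /andP[ib ib'] := idxP k b b0.
  have /andP[it it'] := idxP k t t0.
  have iab : (idx k a <= idx k b)%N by apply: idx_le; lra.
  have := @euler_increment F x (h k) (F (X t)) e (idx k a) (idx k b - idx k a)
    (ltW hk).
  rewrite subnKC// natrB// mulrBl -!/(Z k _).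
  set m := (idx k b)%:R * h k - (idx k a)%:R * h k => Hm.
  have {}Hm : `|Z k (idx k b) - Z k (idx k a) - m *: F (X t)| <= m * e.
    apply: Hm => j /andP[j1 j2]; apply: Fd.
    apply: le_lt_trans (ler_distD (Z k (idx k t)) _ _) _.
    suff : `|Z k (idx k t) - Z k j| <= (b - a) * M + h k * M by lra.
    have ja : (idx k a)%:R * h k <= j%:R * h k by rewrite ler_pM2r// ler_nat.
    have jb : j%:R * h k <= (idx k b)%:R * h k by rewrite ler_pM2r// ler_nat ltnW.
    rewrite -mulrDl; have [jt|tj] := leqP j (idx k t).
      apply: le_trans (Zlip _ _ _ jt _) _; first lra.
      by rewrite ler_pM2r//; lra.
    rewrite distrC; apply: le_trans (Zlip _ _ _ (ltnW tj) _) _; first lra.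
    by rewrite ler_pM2r//; lra.
  apply: le_trans (norm_increment_perturb _ (Z k (idx k b)) _ (Z k (idx k a)) _ _ m) _.
  have mba : `|m - (b - a)| <= h k by rewrite ler_norml /m; lra.
  have h1 := ler_wpM2r (normr_ge0 (F (X t))) mba.
  have h2 : m * e <= (b - a + h k) * e by rewrite ler_pM2r// /m; lra.
  have h3 : h k * W = h k * `|F (X t)| + h k * e by rewrite /W; ring.
  have h4 : (b - a + h k) * e = e * (b - a) + h k * e by ring.
  lra.
exists tau => //; exists X.
  apply/eqP; rewrite -subr_eq0 -normr_le0; apply/ler_addgt0Pr => e e0.
  have z0 : 0 <= (0 : R) <= tau by lra.
  have [k /= +] := filter_ex (XU 0 _ z0 e0).
  by rewrite /idx mul0r truncn0 /Z /= add0r => /ltW.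
move=> t /andP[t0 tt] e e0.
have /cvgrPdist_lt/(_ e e0)/nbhs_normP[d /= d0 Fd] := Fc (X t).
have Fd' y : `|X t - y| < d -> `|F y - F (X t)| <= e.
  by move=> yd; rewrite distrC ltW// Fd.
apply/nbhs_ballP; exists (d / 4 / M) => /=; first by rewrite !divr_gt0.
move=> u; rewrite /ball /= ltr_pdivlMr// => ud /andP[u0 ut].
have [tu|tu] := leP t u.
  rewrite ger0_norm ?subr_ge0//; apply: (key t u t e d) => //.
  by move: ud; rewrite ler0_norm ?subr_le0// opprB.
rewrite ltr0_norm ?subr_lt0// opprB.
have <- : `|X t - X u - (t - u) *: F (X t)| = `|X u - X t - (u - t) *: F (X t)|.
  by rewrite -[RHS]normrN -[u - t]opprB scaleNr opprK opprD opprB.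
apply: (key u t t e d) => //; first exact: ltW.
by move: ud; rewrite gtr0_norm ?subr_gt0.
Qed.

End Peano.

(** * Stability from shrinking tubes *)

Section Stability.
Context {R : realType} {V : normedModType R}.
Hypothesis cptV : forall M : R, compact [set y : V | `|y| <= M].
Variable F : V -> V.
Hypothesis Fc : continuous F.

Lemma continuous_bounded_ball (B : R) :
  exists2 M : R, 0 < M & forall x, `|x| <= B -> `|F x| <= M.
Proof.
have /compact_bounded[M [_ HM]] : compact (F @` [set y : V | `|y| <= B]).
  by apply: continuous_compact => //; exact: continuous_subspaceT.
exists (Num.max M 0 + 1).
  have : 0 <= Num.max M 0 by rewrite le_max lexx orbT.
  lra.
move=> x xB; apply: HM; last by exists x.
have : M <= Num.max M 0 by rewrite le_max lexx.
lra.
Qed.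

(** [F] is bounded on balls, so a bounded solution is Lipschitz and has a limit [XT] at [T]; by
    continuity of [F] its left derivative there is [F XT]. A Peano solution issued from [XT]
    therefore continues it differentiably. *)
Lemma bounded_solution_extends (T : R) (X : R -> V) (B : R) :
  is_solution F T%:E X -> (forall t, 0 <= t -> t < T -> `|X t| <= B) ->
  exists (T' : \bar R) (Y : R -> V),
    [/\ (T%:E < T')%E, is_solution F T' Y &
        forall t : R, 0 <= t -> (t%:E < T%:E)%E -> Y t = X t].
Proof.
move=> [T0 Xc Xd] XB; rewrite lte_fin in T0.
have [M M0 HM] := continuous_bounded_ball B.
have Xsub s t : 0 <= s -> t < T -> {within `[s, t], continuous X}.
  move=> s0 tT; apply: continuous_subspaceW Xc => u /=.
  by rewrite in_itv /= lte_fin => /andP[su ut]; split; lra.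
have Xder s t : 0 <= s -> t < T -> forall u, s < u <= t -> is_derive u 1 X (F (X u)).
  by move=> s0 tT u sut; apply: Xd; rewrite ?lte_fin; lra.
have Xlip s t : 0 <= s -> s <= t -> t < T -> `|X t - X s| <= M * (t - s).
  move=> s0 st tT; apply: (mean_value_bound st (ltW M0) (Xsub _ _ s0 tT)
    (Xder _ _ s0 tT)) => u sut.
  by apply: HM; apply: XB; lra.
(* A limit along an ultrafilter is enough: the Lipschitz bound makes it a genuine left limit in
   [XTlip]. *)
have [U [UU TU]] := ultraFilterLemma (at_left_proper_filter T).
have nearT t : t < T -> U [set s | t < s /\ s < T].
  move=> tT; apply: TU; near=> s; split; near: s.
    exact: nbhs_left_gt.
  exact: nbhs_left_lt.
have [XT XTB XUT] : exists2 XT : V, `|XT| <= B & X @ U --> XT.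
  have := @cptV B; rewrite compact_ultra => /(_ (X @ U) (ultra_fmap X UU)).
  case; last by move=> y [yB cy]; exists y.
  apply: (@filterS _ U _ [set s | 0 < s /\ s < T]); last exact: nearT.
  by move=> s [s0 sT]; apply: XB => //; exact: ltW.
have XTnear t e : t < T -> 0 < e ->
    exists s, [/\ t < s, s < T & `|XT - X s| < e].
  move=> tT e0; have /cvgrPdist_lt/(_ e e0) H := XUT.
  have [s [[s1 s2] s3]] := filter_ex (filterI (nearT t tT) H).
  by exists s.
have XTlip t : 0 <= t -> t < T -> `|XT - X t| <= M * (T - t).
  move=> t0 tT; apply/ler_addgt0Pr => e e0.
  have [s [ts sT se]] := XTnear t e tT e0.
  apply: le_trans (ler_distD (X s) _ _) _; rewrite addrC.
  apply: lerD; last exact: ltW.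
  apply: le_trans (Xlip _ _ t0 (ltW ts) sT) _.
  by rewrite ler_pM2l//; lra.
have FXT e : 0 < e -> exists2 d, 0 < d & forall s, 0 <= s -> s < T -> T - s < d ->
    `|F (X s) - F XT| <= e.
  move=> e0; have /cvgrPdist_lt/(_ e e0)/nbhs_normP[d /= d0 H] := @Fc XT.
  exists (d / M); first by rewrite divr_gt0.
  move=> s s0 sT sd; rewrite distrC; apply/ltW/H.
  apply: le_lt_trans (XTlip _ s0 sT) _.
  by rewrite mulrC -ltr_pdivlMr.
have Xleft e : 0 < e -> exists2 d, 0 < d & forall u, 0 <= u -> u < T -> T - u < d ->
    `|XT - X u - (T - u) *: F XT| <= e * (T - u).
  move=> e0; have [d d0 Hd] := FXT e e0; exists d => // u u0 uT ud.
  apply/ler_addgt0Pr => eta eta0.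
  pose W := 1 + `|F XT|.
  have W0 : 0 < W by have := normr_ge0 (F XT); rewrite /W; lra.
  have eW : 0 < eta / W by rewrite divr_gt0.
  have [s [us sT se]] := XTnear (Num.max u (T - eta / W)) (eta / W)
    (ltac:(rewrite gt_max uT /=; lra)) eW.
  move: us; rewrite gt_max => /andP[us sW].
  apply: le_trans (norm_increment_perturb _ (X s) _ (X u) _ _ (s - u)) _.
  have h1 : `|X s - X u - (s - u) *: F XT| <= e * (s - u).
    apply: (mean_value_ineq (ltW us) (ltW e0) (Xsub _ _ u0 sT) (Xder _ _ u0 sT)).
    by move=> t tus; apply: Hd; lra.
  have h2 : `|s - u - (T - u)| = T - s.
    by rewrite -opprB normrN ger0_norm; lra.
  have h3 : (T - s) * `|F XT| <= eta / W * `|F XT| by apply: ler_wpM2r => //; lra.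
  have h4 : eta / W * W = eta by rewrite divfK// gt_eqF.
  have h5 : e * (s - u) <= e * (T - u) by rewrite ler_pM2l//; lra.
  rewrite h2 subrr normr0; rewrite /W mulrDr mulr1 -/W in h4; lra.
have [tau tau0 [Z Z0 HZ]] := peano XT cptV Fc.
pose Y t := if t < T then X t else Z (t - T).
have YX t : t < T -> Y t = X t by rewrite /Y => ->.
have YZ t : T <= t -> Y t = Z (t - T) by rewrite /Y ltNge => ->.
have Yd t : 0 < t -> t < T + tau -> is_derive t 1 Y (F (Y t)).
  move=> t0 tT'; have [tT|Tt] := ltP t T.
    rewrite YX//; apply: (@near_eq_is_derive _ _ _ X); last exact: Xd.
    by near=> u; rewrite YX//; near: u; exact: lt_nbhsl.
  have Tt' : 0 <= t - T <= tau by lra.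
  apply/is_deriveP => e e0.
  have := HZ _ Tt' e e0.
  rewrite -YZ// => /nbhs_ballP[d1 /= d10 H1].
  have right u : `|t - u| < d1 -> T <= u -> u <= T + tau ->
      `|Y u - Y t - (u - t) *: F (Y t)| <= e * `|u - t|.
    move=> ud Tu uT; rewrite (YZ u)//.
    have <- : u - T - (t - T) = u - t by ring.
    apply: H1; last lra.
    by rewrite /ball /=; move: ud; congr (`|_| < _); ring.
  have TT' : \forall u \near t, u < T + tau by exact: lt_nbhsl.
  move: Tt; rewrite le_eqVlt => /predU1P[Tt|Tt].
    have YT : Y t = XT by rewrite YZ -Tt// subrr.
    have [d2 d20 H2] := Xleft e e0.
    near=> u; have [uT|Tu] := ltP u T; last first.
      apply: right.
      - by near: u; exact: cvgr_dist_lt.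
      - exact: Tu.
      - by apply: ltW; near: u.
    have := H2 u.
    rewrite YX// YT -Tt.
    rewrite [`|u - T|]ltr0_norm ?subr_lt0// opprB.
    have -> : `|X u - XT - (u - T) *: F XT| = `|XT - X u - (T - u) *: F XT|.
      by rewrite -[RHS]normrN -[T - u]opprB scaleNr opprK opprD opprB.
    apply => //.
      by apply: ltW; near: u; exact: lt_nbhsr.
    have : `|t - u| < d2 by near: u; exact: cvgr_dist_lt.
    by rewrite -Tt ltr_norml; lra.
  near=> u; apply: right.
  - by near: u; exact: cvgr_dist_lt.
  - by apply: ltW; near: u; exact: lt_nbhsr.
  - by apply: ltW; near: u.
exists (T + tau)%:E, Y; split.
- by rewrite lte_fin; lra.
- split.
  + by rewrite lte_fin; lra.
  + apply/within_continuousP => t [t0 tT'] e e0; rewrite lte_fin in tT'.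
    move: t0; rewrite le_eqVlt => /predU1P[<-|t0].
      have z0 : 0 <= (0 : R) /\ (0%:E < T%:E)%E by rewrite lte_fin.
      have := (within_continuousP _ _).1 Xc 0 z0 e e0.
      move=> H; near=> u; move=> [u0 _]; rewrite !YX//; last first.
        by near: u; exact: lt_nbhsl.
      have : u < T by near: u; exact: lt_nbhsl.
      rewrite -lte_fin => uT; have := conj u0 uT.
      by near: u.
    have [D _] := Yd t t0 tT'.
    have /cvgrPdist_lt/(_ e e0) : {for t, continuous Y}.
      exact/differentiable_continuous/derivable1_diffP.
    by apply: filterS => u + _; rewrite distrC.
  + by move=> t t0; rewrite lte_fin => tT'; exact: Yd.
- by move=> t t0; rewrite lte_fin => /YX.
Unshelve. all: by end_near.
Qed.

(** [G s] is the tube of scale [s]. Small tubes give stability, boundedness excludes finite escape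
    times through [bounded_solution_extends], and the covering makes attraction global, the scale
    tending to 0 from any [S]. The constant [c] may depend on [S], since attraction asks for no
    uniform rate. *)
Lemma GAS_of_shrinking_tubes (G : R -> set V) : F 0 = 0 ->
  (forall eps, 0 < eps -> exists2 S, 0 < S &
    forall s x, 0 < s -> s <= S -> G s x -> `|x| < eps) ->
  (forall S, 0 < S -> exists B, forall s x, 0 < s -> s <= S -> G s x -> `|x| <= B) ->
  (forall S, 0 < S -> exists2 d, 0 < d & forall x, `|x| < d -> G S x) ->
  (forall x, exists2 S, 0 < S & G S x) ->
  (forall S, 0 < S -> exists2 c, 0 < c & forall T X, is_solution F T X ->
    G S (X 0) -> forall t, 0 <= t -> (t%:E < T)%E -> G ((S^-1 + c * t)^-1) (X t)) ->
  GAS_at_0 F.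
Proof.
move=> F0 small bdd nbh cov inv.
have scale (S c t : R) : 0 < S -> 0 < c -> 0 <= t ->
    0 < (S^-1 + c * t)^-1 /\ (S^-1 + c * t)^-1 <= S.
  move=> S0 c0 t0; have SV : 0 < S^-1 by rewrite invr_gt0.
  have ct : 0 <= c * t by rewrite mulr_ge0// ltW.
  split; first by rewrite invr_gt0; lra.
  by rewrite -[leRHS]invrK lef_pV2 ?posrE; lra.
split => //.
- move=> eps eps0; have [S S0 HS] := small eps eps0.
  have [d d0 Hd] := nbh S S0; have [c c0 Hc] := inv S S0.
  exists d => // T X sol X0 t t0 tT.
  have [s0 sS] := scale S c t S0 c0 t0.
  by apply: HS s0 sS _; apply: Hc sol _ _ t0 tT; exact: Hd.
- move=> T X [sol nomax].
  have [S S0 GS] := cov (X 0); have [c c0 Hc] := inv S S0.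
  have {}Hc := Hc T X sol GS.
  have Too : T = +oo%E.
    case: T sol nomax Hc => [T| |] sol nomax Hc //; last by case: sol.
    exfalso; apply: nomax.
    have [B HB] := bdd S S0.
    apply: (bounded_solution_extends sol (B := B)) => t t0 tT.
    have [s0 sS] := scale S c t S0 c0 t0; apply: (HB _ _ s0 sS); apply: Hc => //; rewrite lte_fin.
  split => //; subst T; apply/cvgrPdist_lt => eps eps0.
  have [S' S'0 HS'] := small eps eps0.
  near=> t.
  have t0 : 0 <= t by near: t; exact: nbhs_pinfty_ge.
  rewrite sub0r normrN.
  have [s0 sS] := scale S c t S0 c0 t0.
  apply: (HS' _ _ s0 _ (Hc t t0 (ltry t))).
  have x0 : 0 < S^-1 + c * t by move: s0; rewrite invr_gt0.
  rewrite -[leRHS]invrK lef_pV2 ?posrE ?invr_gt0//.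
  have h1 : S'^-1 / c <= t.
    by near: t; apply: nbhs_pinfty_ge; exact: num_real.
  rewrite ler_pdivrMr// mulrC in h1.
  have : 0 < S^-1 by rewrite invr_gt0.
  lra.
Unshelve. all: by end_near.
Qed.

End Stability.

(** * First contact *)

Section Contact.
Context {R : realType}.
Implicit Types (xi s q : R -> R) (t d : R).

Lemma derive_left_decrease (g : R -> R) t (d c : R) :
  is_derive t 1 g d -> c < - d -> \forall u \near t^'-, c * (t - u) < g u - g t.
Proof.
move=> /is_deriveP H cd.
have e0 : 0 < (- d - c) / 2 by lra.
have := H _ e0.
rewrite near_withinE; apply: filterS => u + ut.
rewrite [`|u - t|]ltr0_norm ?subr_lt0// /GRing.scale /= ler_norml => /andP[h1 h2].
have tu : 0 < t - u by lra.
have : 0 < (- d - c) / 2 * (t - u) by rewrite mulr_gt0.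
lra.
Qed.

Lemma derive_left_lipschitz (g : R -> R) t (d c : R) :
  is_derive t 1 g d -> `|d| < c -> \forall u \near t^'-, `|g u - g t| <= c * (t - u).
Proof.
move=> gd; rewrite ltr_norml => /andP[d1 d2].
have gNd : is_derive t 1 (- g) (- d) by exact: is_deriveN.
have c1 : - c < - d by lra.
have c2 : - c < - - d by lra.
have H1 := derive_left_decrease gd c1.
have H2 := derive_left_decrease gNd c2.
near=> u.
have : - c * (t - u) < g u - g t by near: u.
have : - c * (t - u) < - g u - - g t by near: u.
by rewrite ler_norml; lra.
Unshelve. all: by end_near.
Qed.

(* Only monotonicity of the gauge is used: the linear term alone must beat the
   drift of [q] and of the scale. *)
Lemma contact (a b : R) xi s q t (d delta al B m Lam : R) :
  0 < a <= 1 -> 0 < b <= 1 -> 0 < s t -> (\forall u \near t^'-, s t <= s u) ->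
  is_derive t 1 xi d -> is_derive t 1 s (- delta) ->
  (\forall u \near t^'-, `|q u - q t| <= Lam * (t - u)) ->
  `|xi t| <= B * gpow a b (s t) -> 0 <= al -> d < 0 ->
  (al * B + m) * delta + Lam < al * (s t / gpow a b (s t)) * - d ->
  0 <= m ->
  \forall u \near t^'-,
    gpow a^-1 b^-1 (xi t) + al * (s t / gpow a b (s t)) * xi t + q t - m * s t <
    gpow a^-1 b^-1 (xi u) + al * (s u / gpow a b (s u)) * xi u + q u - m * s u.
Proof.
move=> /andP[a0 a1] /andP[b0 b1] st0 smono xid sd qL xiB al0 d0 H m0.
set rho := gpow a b in xiB H *; set sg := gpow a^-1 b^-1.
have rho0 : 0 < rho (s t) by exact: gpow_gt0.
set tau := s t / rho (s t) in H *.
(* The factor [s / rho s] is frozen at time [t]; the extra [al * B] in front of [s] pays for its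
   variation, estimated in [key]. *)
have Gd : is_derive t 1 ((al * tau) \*: xi - (al * B + m) \*: s)
    (al * tau * d - (al * B + m) * - delta).
  by apply: is_deriveB; apply: is_deriveZ.
have GL : Lam < - (al * tau * d - (al * B + m) * - delta) by lra.
have Gn := derive_left_decrease Gd GL.
have d2 : 0 < - d by lra.
have xin := derive_left_decrease xid d2.
near=> u.
have ut : u < t by near: u; exact: nbhs_left_lt.
have xiu : xi t <= xi u.
  have : 0 * (t - u) < xi u - xi t by near: u.
  by rewrite mul0r; lra.
have su : s t <= s u by near: u.
have Gu : Lam * (t - u) < al * tau * xi u - (al * B + m) * s u -
   (al * tau * xi t - (al * B + m) * s t) by near: u.
have qu : `|q u - q t| <= Lam * (t - u) by near: u.
have sgu : sg (xi t) <= sg (xi u) by rewrite ler_gpow ?invr_gt0.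
have rhou : rho (s t) <= rho (s u) by rewrite ler_gpow.
have rhou0 : 0 < rho (s u) by lra.
set tau' := s u / rho (s u).
have tau1 : tau <= tau'.
  have ha : 0 <= a <= 1 by lra.
  have hb : 0 <= b <= 1 by lra.
  have h := gpow_sublinear ha hb st0 su; rewrite -/rho in h.
  have {}h := ler_wpM2l (ltW st0) h.
  have e : s t * (s u / s t * rho (s t)) = s u * rho (s t).
    by field; rewrite gt_eqF.
  rewrite e in h.
  by rewrite /tau /tau' ler_pdivrMr// mulrAC ler_pdivlMr.
have tau2 : tau' - tau <= (s u - s t) / rho (s t).
  rewrite mulrBl lerD2r /tau' ler_pM2l; last by lra.
  by rewrite lef_pV2.
(* If [xi u >= 0], monotonicity of [s / rho s] suffices. Otherwise [- xi u <= - xi t] is at most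
   [B * rho (s t)], which cancels the denominator in [tau2]. *)
have key : tau * xi u - B * (s u - s t) <= tau' * xi u.
  have B0 : 0 <= B.
    by rewrite -(pmulr_lge0 _ rho0) (le_trans (normr_ge0 _) xiB).
  have [xu|xu] := leP 0 (xi u).
    have h1 := ler_wpM2r xu tau1.
    have : 0 <= B * (s u - s t) by rewrite mulr_ge0// subr_ge0.
    lra.
  have xu' : - xi u <= B * rho (s t).
    by apply: le_trans xiB; rewrite ler0_norm; lra.
  have h1 : (tau' - tau) * - xi u <= (s u - s t) / rho (s t) * (B * rho (s t)).
    by apply: ler_pM => //; lra.
  have h2 : (s u - s t) / rho (s t) * (B * rho (s t)) = B * (s u - s t).
    by rewrite [B * _]mulrC mulrA divfK ?gt_eqF// mulrC.
  lra.
have key2 := ler_wpM2l al0 key.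
have qu' : - (Lam * (t - u)) <= q u - q t by move: qu; rewrite ler_norml; lra.
have e1 : al * tau * xi u = al * (tau * xi u) by rewrite mulrA.
have e2 : al * tau' * xi u = al * (tau' * xi u) by rewrite mulrA.
rewrite e1 in Gu; rewrite e2; lra.
Unshelve. all: by end_near.
Qed.

(** The gauge inverts a function that is steep by [gpow_slope], so it is Lipschitz on bounded sets.
    Its size is known at [t] only; by continuity the bound at most doubles just before, hence the
    factor 2. *)
Lemma gauge_left_lipschitz (w a b B Lam s : R) xi t d :
  0 < w -> w <= a <= 1 -> w <= b <= 1 -> 1 <= B -> 0 < s ->
  is_derive t 1 xi d -> `|d| < Lam -> `|gpow a^-1 b^-1 (xi t)| <= B * s ->
  \forall u \near t^'-, `|gpow a^-1 b^-1 (xi u) - gpow a^-1 b^-1 (xi t)| <=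
    2 * B / w * (s / gpow a b s) * Lam * (t - u).
Proof.
move=> w0 wa wb B1 s0 xid dL sgB.
have a0 : 0 < a by lra.
have b0 : 0 < b by lra.
set sg := gpow a^-1 b^-1 in sgB *; set rho := gpow a b.
have rhos : 0 < rho s by exact: gpow_gt0.
have Bs : 0 < B * s by rewrite mulr_gt0//; lra.
have xic : {for t, continuous xi}.
  by apply/differentiable_continuous/derivable1_diffP; case: xid.
have sgc : \forall u \near t, `|sg (xi t) - sg (xi u)| < B * s.
  have : {for t, continuous (sg \o xi)}.
    by apply: continuous_comp => //; apply: gpow_continuous; rewrite invr_gt0.
  by move=> /cvgrPdist_lt/(_ _ Bs).
have xiL := derive_left_lipschitz xid dL.
near=> u.
have ut : u < t by near: u; exact: nbhs_left_lt.
have h1 : `|sg (xi t) - sg (xi u)| < B * s.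
  by near: u; rewrite near_withinE; apply: filterS sgc.
have h2 : `|xi u - xi t| <= Lam * (t - u) by near: u.
have sgB2 : `|sg (xi t)| <= 2 * B * s by lra.
have sguB : `|sg (xi u)| <= 2 * B * s.
  have := ler_normB (sg (xi t)) (sg (xi t) - sg (xi u)).
  by rewrite opprB addrC subrK; lra.
have B2 : 1 <= 2 * B by lra.
pose k := w / (2 * B) * (rho s / s).
have k0 : 0 < k by rewrite mulr_gt0// divr_gt0//; lra.
have slope x y : `|sg x| <= 2 * B * s -> `|sg y| <= 2 * B * s ->
    k * `|sg x - sg y| <= `|x - y|.
  move=> xB yB; wlog yx : x y xB yB / sg y <= sg x.
    move=> W; have [/W|/ltW/W] := leP (sg y) (sg x); first exact.
    by rewrite distrC [`|y - x|]distrC; apply.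
  have := gpow_slope w0 wa wb s0 B2 xB yB yx.
  rewrite !gpowVK// -/rho -/k ger0_norm ?subr_ge0// => h.
  exact: le_trans (ler_norm _).
have := slope _ _ sguB sgB2.
move=> h3; have {}h3 := le_trans h3 h2.
rewrite mulrC -ler_pdivlMr// in h3; apply: le_trans h3 _.
have -> : Lam * (t - u) / k = 2 * B / w * (s / rho s) * Lam * (t - u).
  by rewrite /k; field; rewrite !gt_eqF//; lra.
exact: lexx.
Unshelve. all: by end_near.
Qed.

End Contact.

(** The solution of [s' = - c s^2] with [s(0) = S]. Quadratic decay is slow enough for every degree
    considered, by [le_rate]. *)
Definition shrinking_scale (R : realType) (S c t : R) : R := (S^-1 + c * t)^-1.

Section ShrinkingScale.
Context {R : realType}.
Variables (S c : R).
Hypotheses (S0 : 0 < S) (c0 : 0 < c).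

Let den_gt0 t : 0 <= t -> 0 < S^-1 + c * t.
Proof.
move=> t0; have : 0 < S^-1 by rewrite invr_gt0.
have : 0 <= c * t by rewrite mulr_ge0// ltW.
lra.
Qed.

Lemma shrinking_scale_gt0 t : 0 <= t -> 0 < shrinking_scale S c t.
Proof. by move=> /den_gt0 h; rewrite invr_gt0. Qed.

Lemma shrinking_scale_le t u : 0 <= u -> u <= t ->
  shrinking_scale S c t <= shrinking_scale S c u.
Proof.
move=> u0 ut; rewrite lef_pV2 ?posrE ?den_gt0//; last exact: le_trans ut.
by rewrite lerD2l ler_pM2l.
Qed.

Lemma shrinking_scale0 : shrinking_scale S c 0 = S.
Proof. by rewrite /shrinking_scale mulr0 addr0 invrK. Qed.

Lemma is_derive_shrinking_scale (t : R) : 0 <= t ->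
  is_derive t 1 (shrinking_scale S c) (- (c * shrinking_scale S c t ^+ 2)).
Proof.
move=> t0; have h := den_gt0 t0.
have D : is_derive t 1 (fun u : R => S^-1 + c * u) c.
  apply/is_deriveP => e e0; near=> u.
  have -> : S^-1 + c * u - (S^-1 + c * t) - (u - t) *: c = 0.
    by rewrite /GRing.scale /=; ring.
  by rewrite normr0 mulr_ge0// ltW.
have h' : S^-1 + c * t != 0 by rewrite gt_eqF.
have [D1 D2] := D.
split; first exact: derivableV.
rewrite deriveV// D2 /GRing.scale /= /shrinking_scale exprVn mulNr mulrC.
by [].
Unshelve. all: by end_near.
Qed.

End ShrinkingScale.

(** * Gains and tubes *)

(** Majorant, in units of [s], of the sum of the widths [8 ^+ k * s] of the error tubes, hence of
    every error gauge. *)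
Definition err_size (R : realType) (n : nat) : R := 8 ^+ n.

Lemma err_size_ge1 (R : realType) (n : nat) : 1 <= err_size R n.
Proof. by rewrite exprn_ege1 ?ler1n. Qed.

(** Lets the linear term of a tube be discarded when a gauge is bounded. *)
Lemma norm_add_same_sign (R : realType) (u y a : R) : 0 <= a -> 0 <= u * y -> `|u| <= `|u + a * y|.
Proof.
move=> a0 uy; have [u0|u0] := leP 0 u.
  move: u0; rewrite le_eqVlt => /predU1P[<-|u0]; first by rewrite normr0.
  have y0 : 0 <= y by rewrite -(pmulr_rge0 _ u0).
  have : 0 <= a * y by rewrite mulr_ge0.
  by move=> ?; rewrite !ger0_norm; lra.
have y0 : y <= 0 by rewrite -(nmulr_rge0 _ u0).
have : a * y <= 0 by rewrite mulr_ge0_le0.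
by move=> ?; rewrite !ler0_norm; lra.
Qed.

(** * Geometry of the error tubes *)

Section ErrorTubes.
Context {R : realType}.
Variables (n : nat) (s : R) (v y : nat -> R).
Hypotheses (s0 : 0 < s) (vy : forall k, 0 <= v k * y k) (vn : v n = 0)
  (yM : forall k M, 1 <= M -> `|v k| <= M * s -> `|y k| <= M).
Hypothesis tubes : forall k, (k < n)%N ->
  `|v k - v k.+1 + (8 * err_size R n)^-1 * (s * y k)| <= 8 ^+ k * s.

(** Descending induction from [v n = 0]: the widths from [8 ^+ k] to [8 ^+ n.-1] sum to
    [(8 ^+ n - 8 ^+ k) / 7]. *)
Lemma err_bound k : (k <= n)%N -> `|v k| <= err_size R n * s.
Proof.
move=> kn; suff : `|v k| <= (8 ^+ n - 8 ^+ k) / 7 * s.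
  move/le_trans; apply; rewrite ler_pM2r// /err_size.
  have : (0 : R) < 8 ^+ n by rewrite exprn_gt0.
  have : (0 : R) < 8 ^+ k by rewrite exprn_gt0.
  lra.
rewrite -(subKn kn); move: (n - k)%N (leq_subr k n) => {k kn}.
elim=> [|m IH] mn; first by rewrite subn0 vn normr0 subrr !mul0r.
have {}IH := IH (ltnW mn).
have e : (n - m = (n - m.+1).+1)%N by lia.
have kn : (n - m.+1 < n)%N by lia.
move: IH (tubes kn); rewrite e => IH h.
have sy : 0 <= v (n - m.+1)%N * (s * y (n - m.+1)%N).
  by rewrite mulrCA mulr_ge0 ?vy// ltW.
have b0 : 0 <= (8 * err_size R n)^-1.
  by rewrite invr_ge0 mulr_ge0// (le_trans ler01)// err_size_ge1.
have h1 := norm_add_same_sign b0 sy.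
have e1 : v (n - m.+1)%N + (8 * err_size R n)^-1 * (s * y (n - m.+1)%N) =
  (v (n - m.+1)%N - v (n - m.+1).+1 + (8 * err_size R n)^-1 * (s * y (n - m.+1)%N)) +
  v (n - m.+1).+1 by ring.
rewrite e1 in h1; have h2 := le_trans h1 (ler_normD _ _).
move: IH; rewrite exprS; lra.
Qed.

(** The coefficient of the linear term is tuned to the bound [err_size] on [y]: this term is at most
    [s / 8], an eighth of the smallest width. *)
Lemma err_gap k : (k < n)%N -> `|v k - v k.+1| <= 9 / 8 * 8 ^+ k * s.
Proof.
move=> kn; have h := err_bound (ltnW kn).
have /= h1 := yM (err_size_ge1 R n) h.
have B0 : 0 < err_size R n by have := err_size_ge1 R n; lra.
have h2 : `|(8 * err_size R n)^-1 * (s * y k)| <= 8^-1 * s.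
  rewrite normrM normrM (gtr0_norm s0) gtr0_norm ?invr_gt0 ?mulr_gt0//.
  have -> : (8 * err_size R n)^-1 * (s * `|y k|) = 8^-1 * s * (`|y k| / err_size R n).
    by field; rewrite gt_eqF.
  rewrite -[leRHS]mulr1 ler_wpM2l//; first by rewrite mulr_ge0 ?ltW// invr_gt0.
  by rewrite ler_pdivrMr// mul1r.
have h3 := tubes kn.
have k8 : (1 : R) <= 8 ^+ k by rewrite exprn_ege1 ?ler1n.
have : 1 * s <= 8 ^+ k * s by rewrite ler_pM2r.
by move: h2 h3; rewrite !ler_norml; lra.
Qed.

(** Geometric sum of ratio 8 of the previous gaps: [9 / 56] is [9 / 8] divided by 7. *)
Lemma err_gap0 k : (k <= n)%N -> `|v 0%N - v k| <= 9 / 56 * 8 ^+ k * s.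
Proof.
move=> kn; suff : `|v 0%N - v k| <= 9 / 56 * (8 ^+ k - 1) * s.
  by move/le_trans; apply; rewrite ler_pM2r//; lra.
elim: k kn => [|k IH] kn; first by rewrite subrr normr0 expr0 subrr mulr0 mul0r.
have := IH (ltnW kn); have := err_gap kn.
by rewrite exprS !ler_norml; lra.
Qed.

(** The tube controls [v k - v k.+1], but the k-th error moves according to [v k.+1] against [v 0].
    Since the widths grow by the factor 8, the gaps before [k] cannot undo the one at [k]: at least
    [1 - 9 / 56 - 1 / 8 = 5 / 7] remains. *)
Lemma err_contact k : (k < n)%N ->
  v k - v k.+1 + (8 * err_size R n)^-1 * (s * y k) = 8 ^+ k * s ->
  s / 2 <= v 0%N - v k.+1.
Proof.
move=> kn E; have h := err_bound (ltnW kn).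
have /= h1 := yM (err_size_ge1 R n) h.
have B0 : 0 < err_size R n by have := err_size_ge1 R n; lra.
have h2 : `|(8 * err_size R n)^-1 * (s * y k)| <= 8^-1 * s.
  rewrite normrM normrM (gtr0_norm s0) gtr0_norm ?invr_gt0 ?mulr_gt0//.
  have -> : (8 * err_size R n)^-1 * (s * `|y k|) = 8^-1 * s * (`|y k| / err_size R n).
    by field; rewrite gt_eqF.
  rewrite -[leRHS]mulr1 ler_wpM2l//; first by rewrite mulr_ge0 ?ltW// invr_gt0.
  by rewrite ler_pdivrMr// mul1r.
have h3 := err_gap0 (ltnW kn).
have k8 : (1 : R) <= 8 ^+ k by rewrite exprn_ege1 ?ler1n.
have : 1 * s <= 8 ^+ k * s by rewrite ler_pM2r.
by move: h2 h3; rewrite !ler_norml; lra.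
Qed.

End ErrorTubes.

(** * Gains, and geometry of the controller tubes *)

Section Gains.
Context {R : realType}.
Variables (w : R) (n : nat).
(** Each error is made faster than the next one by a fixed factor. In it, [112 = 16 * 7]: the inward
    motion in [err_contact_tube] carries a denominator 16, and of the 7 parts that are left 6 absorb
    the drift of the next gauge and 1 the moving scale. *)
Definition obs_rate (j : nat) : R := (112 * err_size R n ^+ 4 / w ^+ 2) ^+ (n - j).

Definition obs_gain (j : nat) : R := \prod_(i < j) obs_rate i.

(* Sizes [mu k] of the tubes of the controller, chosen one after the other: the
   second component bounds the drift of the slow part of the k-th tube. *)
Fixpoint ctrl_data (k : nat) : R * R :=
  if k is k'.+1 then
    let: (m, z) := ctrl_data k' in
    let m' := (48 * (z + 2)) `^ w^-1 in
    (m', 4 * m' / m * (96 * m * m' / w + z))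
  else (1, 0).

Definition tube_size k := (ctrl_data k).1.
Definition drift k := (ctrl_data k).2.
Definition ctrl_gain k := 4 * tube_size k.+1 / tube_size k.

(** The backstepping variable: deviation of the k-th gauge from its virtual control
    [- ctrl_gain k' * backstep u k']. *)
Fixpoint backstep (u : nat -> R) (k : nat) : R :=
  if k is k'.+1 then u k + ctrl_gain k' * backstep u k' else u 0%N.

(* The gauge of the value of x_{k+1} seen by x_k: for the last coordinate this
   is the gauge of the control. *)
Definition next_gauge (u : nat -> R) (k : nat) : R :=
  if (k.+1 < n)%N then u k.+1 else - (ctrl_gain k * backstep u k).

Lemma obs_rateS j : (j < n)%N ->
  obs_rate j = 112 * err_size R n ^+ 4 / w ^+ 2 * obs_rate j.+1.
Proof.
by move=> jn; rewrite /obs_rate -exprS; congr (_ ^+ _); lia.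
Qed.

Lemma obs_gain0 : obs_gain 0 = 1. Proof. by rewrite /obs_gain big_ord0. Qed.

Lemma obs_gainS j : obs_gain j.+1 = obs_gain j * obs_rate j.
Proof. by rewrite /obs_gain big_ord_recr. Qed.

Hypothesis w01 : 0 < w <= 1.

Lemma w_gt0 : 0 < w. Proof. by case/andP: w01. Qed.

Lemma ctrl_data_ge k : 1 <= tube_size k /\ 0 <= drift k.
Proof.
have w0 := w_gt0; rewrite /tube_size /drift.
elim: k => [|k [m1 z0]] //=.
case E : (ctrl_data k) m1 z0 => [m z] /= m1 z0.
set m' := _ `^ _; have m'1 : 1 <= m'.
  rewrite /m' -[leLHS](powRr0 (48 * (z + 2))); apply: ler_powR; first lra.
  by rewrite invr_ge0 ltW.
split => //; apply: mulr_ge0; first by rewrite divr_ge0 ?mulr_ge0//; lra.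
by apply: addr_ge0 => //; rewrite divr_ge0 ?mulr_ge0//; lra.
Qed.

Lemma tube_size_ge1 k : 1 <= tube_size k. Proof. by case: (ctrl_data_ge k). Qed.

Lemma tube_size_gt0 k : 0 < tube_size k.
Proof. by have := tube_size_ge1 k; lra. Qed.

Lemma drift_ge0 k : 0 <= drift k. Proof. by case: (ctrl_data_ge k). Qed.

Lemma ctrl_gain_gt0 k : 0 < ctrl_gain k.
Proof. by rewrite divr_gt0 ?mulr_gt0 ?tube_size_gt0. Qed.

(** A scale function grows at least by the power [w] of [M] when its argument is multiplied by
    [M >= 1]; the exponent [w^-1] in [ctrl_data] is chosen so that the speed at a contact dominates
    the drift. *)
Lemma tube_sizeS k : tube_size k.+1 `^ w = 48 * (drift k + 2).
Proof.
have w0 := w_gt0; have := drift_ge0 k; rewrite /tube_size /drift /=.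
case: (ctrl_data k) => m z /= z0.
by rewrite -powRrM mulVf ?gt_eqF// powRr1; lra.
Qed.

Lemma driftS k : drift k.+1 =
  ctrl_gain k * (96 * tube_size k * tube_size k.+1 / w + drift k).
Proof.
by rewrite /ctrl_gain /drift /tube_size /=; case: (ctrl_data k) => m z.
Qed.

Lemma ctrl_gainE k a : ctrl_gain k * (a * tube_size k) = 4 * a * tube_size k.+1.
Proof. by rewrite /ctrl_gain; field; rewrite gt_eqF// tube_size_gt0. Qed.

Section Tubes.
Variables (s : R) (u y : nat -> R).
Hypotheses (s0 : 0 < s) (uy : forall k, 0 <= u k * y k)
  (yM : forall k M, 1 <= M -> `|u k| <= M * s -> `|y k| <= M).

Let sy_le k M : 1 <= M -> `|u k| <= M * s -> `|s * y k| <= M * s.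
Proof.
move=> M1 /(yM M1) h; rewrite normrM (gtr0_norm s0) mulrC.
by rewrite ler_pM2r.
Qed.

(** Both bounds go through one induction: the virtual control is at most [4 * 5 / 4 = 5] widths, so
    the gauge is at most 6 widths, and the linear term, at most [6 / 24] of a width, leaves [5 / 4]
    for [backstep]. *)
Lemma ctrl_tube_bounds :
  (forall k, (k < n)%N -> `|backstep u k + 24^-1 * (s * y k)| <= tube_size k * s) ->
  forall k, (k < n)%N -> `|u k| <= 6 * tube_size k * s /\
    `|backstep u k| <= 5 / 4 * tube_size k * s.
Proof.
move=> H k kn.
have step j p : (j < n)%N -> backstep u j = u j + p -> `|p| <= 5 * tube_size j * s ->
    `|u j| <= 6 * tube_size j * s /\ `|backstep u j| <= 5 / 4 * tube_size j * s.
  move=> jn E pj; have := H j jn.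
  have m1 := tube_size_ge1 j.
  have sy : 0 <= u j * (s * y j) by rewrite mulrCA mulr_ge0 ?uy// ltW.
  have h := @norm_add_same_sign _ (u j) (s * y j) 24^-1 _ sy.
  have {}h : `|u j| <= `|u j + 24^-1 * (s * y j)| by apply: h; rewrite invr_ge0.
  have e : u j + 24^-1 * (s * y j) = backstep u j + 24^-1 * (s * y j) - p.
    by rewrite E; ring.
  rewrite e in h => h2.
  have h3 := le_trans h (ler_normB _ _).
  have uj : `|u j| <= 6 * tube_size j * s by lra.
  split => //.
  have m6 : 1 <= 6 * tube_size j by lra.
  have := sy_le m6 uj; move: h2; rewrite !ler_norml; lra.
elim: k kn => [|k IH] kn.
  apply: (step 0%N 0) => //=; first by rewrite addr0.
  have : 0 < tube_size 0 * s by rewrite mulr_gt0// tube_size_gt0.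
  by rewrite normr0; lra.
apply: (step k.+1 (ctrl_gain k * backstep u k)) => //.
have [_ h] := IH (ltnW kn).
rewrite normrM (gtr0_norm (ctrl_gain_gt0 k)).
apply: le_trans (ler_wpM2l (ltW (ctrl_gain_gt0 k)) h) _.
rewrite mulrA ctrl_gainE; apply: ler_wpM2r; first exact: ltW.
by have := tube_size_gt0 k.+1; lra.
Qed.

Hypothesis tubes :
  forall k, (k < n)%N -> `|backstep u k + 24^-1 * (s * y k)| <= tube_size k * s.

Lemma next_gauge_bound k : (k < n)%N -> `|next_gauge u k| <= 7 * tube_size k.+1 * s.
Proof.
move=> kn; have [_ h] := ctrl_tube_bounds tubes kn.
have ms : 0 < tube_size k.+1 * s by rewrite mulr_gt0// tube_size_gt0.
rewrite /next_gauge; case: ifP => kn'.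
  by have [+ _] := ctrl_tube_bounds tubes kn'; lra.
rewrite normrN normrM (gtr0_norm (ctrl_gain_gt0 k)).
apply: le_trans (ler_wpM2l (ltW (ctrl_gain_gt0 k)) h) _.
by rewrite mulrA ctrl_gainE; lra.
Qed.

(** At a contact [backstep] is at least [1 - 6 / 24 = 3 / 4] of the width, which the factor 4 of
    [ctrl_gain] turns into 3 widths of the next tube. The next backstepping variable being at most
    [5 / 4] of a width, the next gauge is below minus one width. *)
Lemma next_gauge_contact k : (k < n)%N ->
  backstep u k + 24^-1 * (s * y k) = tube_size k * s ->
  next_gauge u k <= - (tube_size k.+1 * s).
Proof.
move=> kn E; have [h1 h2] := ctrl_tube_bounds tubes kn.
have m1 := tube_size_ge1 k.
have m6 : 1 <= 6 * tube_size k by lra.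
have := sy_le m6 h1; rewrite ler_norml => /andP[_ h3].
have h4 : 3 / 4 * tube_size k * s <= backstep u k by lra.
have := ler_wpM2l (ltW (ctrl_gain_gt0 k)) h4.
rewrite mulrA ctrl_gainE => h5.
have ms : 0 < tube_size k.+1 * s by rewrite mulr_gt0// tube_size_gt0.
rewrite /next_gauge; case: ifP => kn'; last by lra.
have [_] := ctrl_tube_bounds tubes kn'; rewrite /= ler_norml; lra.
Qed.

End Tubes.

Lemma obs_rate_gt0 j : 0 < obs_rate j.
Proof.
have w0 := w_gt0; have B1 := err_size_ge1 R n.
have B0 : 0 < err_size R n by lra.
rewrite /obs_rate exprn_gt0// divr_gt0//; last exact: exprn_gt0.
by rewrite mulr_gt0// exprn_gt0.
Qed.

Lemma obs_rate_ge1 j : 1 <= obs_rate j.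
Proof.
have w0 := w_gt0; have B1 := err_size_ge1 R n.
apply: exprn_ege1; rewrite ler_pdivlMr ?exprn_gt0// mul1r.
have h1 : w ^+ 2 <= 1.
  by case/andP: w01 => _ w1; rewrite -(expr1n _ 2) lerXn2r// nnegrE ltW.
have h2 : 1 <= err_size R n ^+ 4 by rewrite exprn_ege1.
lra.
Qed.

Lemma obs_gain_gt0 j : 0 < obs_gain j.
Proof. by apply: prodr_gt0 => i _; exact: obs_rate_gt0. Qed.

Lemma obs_gain_homo i j : (i <= j)%N -> obs_gain i <= obs_gain j.
Proof.
move=> ij; rewrite -(subnKC ij); elim: (j - i)%N => [|m IH]; first by rewrite addn0.
rewrite addnS obs_gainS (le_trans IH)// ler_peMr ?obs_rate_ge1//.
exact: ltW (obs_gain_gt0 _).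
Qed.

End Gains.

(** * Trajectories in tubes *)

Section Dynamics.
Context {R : realType}.
Variables (w : R) (n : nat) (alpha beta : nat -> R) (da db : R).
Hypotheses (w0 : 0 < w) (wa : forall k, w <= alpha k <= 1)
  (wb : forall k, w <= beta k <= 1)
  (alphaS : forall k, (k < n)%N -> alpha k.+1 = alpha k + da)
  (betaS : forall k, (k < n)%N -> beta k.+1 = beta k + db)
  (da1 : -1 <= da <= 1) (db1 : -1 <= db <= 1).

Let w1 : 0 < w <= 1. Proof. by case/andP: (wa 0) => wa0 wa1; rewrite w0 (le_trans wa0). Qed.
Let a0 k : 0 < alpha k. Proof. by have := w0; have := wa k; lra. Qed.
Let b0 k : 0 < beta k. Proof. by have := w0; have := wb k; lra. Qed.
Let a01 k : 0 < alpha k <= 1. Proof. by have := w0; have := wa k; lra. Qed.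
Let b01 k : 0 < beta k <= 1. Proof. by have := w0; have := wb k; lra. Qed.

Definition scale_fun k : R -> R := gpow (alpha k) (beta k).
Definition gauge_fun k : R -> R := gpow (alpha k)^-1 (beta k)^-1.

Local Notation rho := scale_fun.
Local Notation sg := gauge_fun.
Local Notation mu := (tube_size w).
Local Notation Bv := (err_size R n).
Local Notation lam := (obs_rate w n).
Local Notation gn := (obs_gain w n).

(** Common ratio of consecutive scale functions, by [rhoS]; [s * rate s] is the unit for all rates
    of change of gauges at scale [s]. *)
Definition rate (s : R) : R := if s <= 1 then s `^ da else s `^ db.

Lemma rho_gt0 k s : 0 < s -> 0 < rho k s. Proof. exact: gpow_gt0. Qed.

Lemma rhoK k : cancel (sg k) (rho k). Proof. exact: gpowVK. Qed.

Lemma ler_rho k : {mono rho k : x y / x <= y}. Proof. exact: ler_gpow. Qed.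

Lemma norm_rho k x : `|rho k x| = rho k `|x|. Proof. exact: norm_gpow. Qed.

Lemma rhoS k s : (k < n)%N -> 0 < s -> rho k.+1 s = rho k s * rate s.
Proof.
move=> kn s0; rewrite /rho !gpow_pos// /rate alphaS// betaS//.
by case: ifP => _; rewrite powRD//; apply/implyP => _; rewrite gt_eqF.
Qed.

Lemma rate_gt0 s : 0 < s -> 0 < rate s.
Proof. by move=> s0; rewrite /rate; case: ifP => _; exact: powR_gt0. Qed.

(** For [c] small, this puts the decay [c * s ^+ 2] of the scale below a given multiple of
    [s * rate s]. Small scales use [da <= 1], large ones [-1 <= db]. *)
Lemma le_rate s S : 0 < s -> s <= S -> s <= Num.max 1 S ^+ 2 * rate s.
Proof.
move=> s0 sS; set M := Num.max 1 S.
have M1 : 1 <= M by rewrite le_max lexx.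
have SM : S <= M by rewrite le_max lexx orbT.
have sE : s = s `^ 1 by rewrite powRr1// ltW.
rewrite /rate; case: (leP s 1) => s1.
  have h : s <= s `^ da.
    by rewrite {1}sE; apply: ger_powR; [rewrite s0 s1|have := da1; lra].
  apply: le_trans h _; rewrite ler_peMl ?powR_ge0//.
  by rewrite exprn_ege1.
have h : s = s `^ (1 - db) * s `^ db.
  by rewrite -powRD ?subrK//; apply/implyP => _; rewrite gt_eqF.
rewrite {1}h ler_pM2r ?powR_gt0//.
apply: (@le_trans _ _ (s `^ 2)); first by apply: ler_powR; have := db1; lra.
by rewrite (powR_mulrn _ (ltW s0)) lerXn2r ?nnegrE; lra.
Qed.

Lemma rho_le_mul k M s : 0 < s -> 1 <= M -> rho k (M * s) <= M * rho k s.
Proof.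
move=> s0 M1; have sM : s <= M * s by rewrite ler_peMl// ltW.
have ha : 0 <= alpha k <= 1 by have := a01 k; lra.
have hb : 0 <= beta k <= 1 by have := b01 k; lra.
by have := gpow_sublinear ha hb s0 sM; rewrite mulfK ?gt_eqF.
Qed.

Lemma rho_ge_mul k M s : 0 < s -> 1 <= M -> M `^ w * rho k s <= rho k (M * s).
Proof.
move=> s0 M1; have sM : s <= M * s by rewrite ler_peMl// ltW.
have /andP[+ _] := gpow_ratio (wa k) (wb k) s0 sM.
by rewrite mulfK ?gt_eqF// mulrC.
Qed.

Lemma rho_le_shrink k M s : 0 < s -> 0 < M -> M <= 1 ->
  rho k (M * s) <= M `^ w * rho k s.
Proof.
move=> s0 M0 M1; have Ms0 : 0 < M * s by rewrite mulr_gt0.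
have MV1 : 1 <= M^-1 by rewrite invf_ge1.
have := rho_ge_mul k Ms0 MV1; rewrite mulKf ?gt_eqF// => h.
have Mw0 : 0 < M `^ w by exact: powR_gt0.
have := ler_wpM2l (ltW Mw0) h; rewrite mulrA -powRM ?(ltW M0) ?invr_ge0 ?(ltW M0)//.
by rewrite divff ?gt_eqF// powR1 mul1r.
Qed.

Lemma gauge_le_abs k M s x : 0 < s -> 1 <= M -> `|sg k x| <= M * s ->
  `|x| <= M * rho k s.
Proof.
move=> s0 M1 h; apply: le_trans (rho_le_mul k s0 M1).
by rewrite -{1}(rhoK k x) norm_rho ler_rho.
Qed.

Lemma gauge_same_sign k c x : 0 <= c -> 0 <= sg k x * (x * c).
Proof.
move=> c0; rewrite mulrA mulr_ge0//.
have aV : 0 < (alpha k)^-1 by rewrite invr_gt0.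
have bV : 0 < (beta k)^-1 by rewrite invr_gt0.
have [x0|x0] := leP 0 x.
  by rewrite mulr_ge0// -(gpow0 (alpha k)^-1 (beta k)^-1) ler_gpow.
apply: mulr_le0; last exact: ltW.
by rewrite -(gpow0 (alpha k)^-1 (beta k)^-1) ler_gpow// ltW.
Qed.

Definition ctrl_gauge (chi : nat -> R) k := sg k (chi k).
(** Zero from index [n] on because the input cancels in the last error equation; this starts the
    descending induction of [err_bound]. *)
Definition err_gauge (eps : nat -> R) k := if (k < n)%N then sg k (eps k) else 0.

(** Right-hand side of the estimate, up to the factor [L]. As [rho k.+1] undoes the gauge, the first
    term is the next coordinate or, at the end of the chain, the feedback. *)
Definition ctrl_field (chi eps : nat -> R) k : R :=
  rho k.+1 (next_gauge w n (ctrl_gauge chi) k) +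
  gn k.+1 * rho k.+1 (err_gauge eps 0).
Definition err_field (eps : nat -> R) k : R :=
  lam k * (rho k.+1 (err_gauge eps k.+1) - rho k.+1 (err_gauge eps 0)).

Definition ctrl_tube (s : R) (chi : nat -> R) k : R :=
  backstep w (ctrl_gauge chi) k + 24^-1 * (s * (chi k / rho k s)).
Definition err_tube (s : R) (eps : nat -> R) k : R :=
  err_gauge eps k - err_gauge eps k.+1 + (8 * Bv)^-1 * (s * (eps k / rho k s)).

Definition ctrl_ratio (s : R) (chi : nat -> R) k := chi k / rho k s.
Definition err_ratio (s : R) (eps : nat -> R) k :=
  if (k < n)%N then eps k / rho k s else 0.

Lemma ctrl_ratio_sign s chi k : 0 < s ->
  0 <= ctrl_gauge chi k * ctrl_ratio s chi k.
Proof.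
move=> s0; apply: gauge_same_sign; rewrite invr_ge0; exact/ltW/rho_gt0.
Qed.

Lemma ctrl_ratio_le s chi k M : 0 < s -> 1 <= M -> `|ctrl_gauge chi k| <= M * s ->
  `|ctrl_ratio s chi k| <= M.
Proof.
move=> s0 M1 /(gauge_le_abs s0 M1) h.
have r0 := rho_gt0 k s0.
by rewrite normrM normfV (gtr0_norm r0) ler_pdivrMr.
Qed.

Lemma err_ratio_sign s eps k : 0 < s -> 0 <= err_gauge eps k * err_ratio s eps k.
Proof.
move=> s0; rewrite /err_gauge /err_ratio; case: ifP => _; last by rewrite mul0r.
by apply: gauge_same_sign; rewrite invr_ge0; exact/ltW/rho_gt0.
Qed.

Lemma err_ratio_le s eps k M : 0 < s -> 1 <= M -> `|err_gauge eps k| <= M * s ->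
  `|err_ratio s eps k| <= M.
Proof.
move=> s0 M1; rewrite /err_gauge /err_ratio; case: ifP => _; last first.
  by rewrite normr0; lra.
move=> /(gauge_le_abs s0 M1) h; have r0 := rho_gt0 k s0.
by rewrite normrM normfV (gtr0_norm r0) ler_pdivrMr.
Qed.

Lemma err_gauge_n eps : err_gauge eps n = 0.
Proof. by rewrite /err_gauge ltnn. Qed.

Definition in_ctrl_tubes (s : R) chi :=
  forall k, (k < n)%N -> `|ctrl_tube s chi k| <= mu k * s.
Definition in_err_tubes (s : R) eps :=
  forall k, (k < n)%N -> `|err_tube s eps k| <= 8 ^+ k * s.

Lemma in_err_tubesE s eps : in_err_tubes s eps -> forall k, (k < n)%N ->
  `|err_gauge eps k - err_gauge eps k.+1 +
    (8 * Bv)^-1 * (s * err_ratio s eps k)| <= 8 ^+ k * s.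
Proof. by move=> H k kn; have := H k kn; rewrite /err_tube /err_ratio kn. Qed.

Variables (kappa : R).
Hypotheses (kappa0 : 0 < kappa) (Bkappa1 : Bv * kappa <= 1)
  (gkappa : gn n * (Bv * kappa) `^ w <= 2^-1).

Let Bv1 : 1 <= Bv. Proof. exact: err_size_ge1. Qed.
Let Bv0 : 0 < Bv. Proof. by have := Bv1; lra. Qed.

(** [err_bound] holds at scale [kappa * s], and [kappa] is small compared with the largest observer
    gain. *)
Lemma injection_small s eps k : 0 < s -> in_err_tubes (kappa * s) eps ->
  (k < n)%N -> `|gn k.+1 * rho k.+1 (err_gauge eps 0)| <= 2^-1 * rho k.+1 s.
Proof.
move=> s0 He kn; have ks0 : 0 < kappa * s by rewrite mulr_gt0.
have := err_bound ks0 (fun j => err_ratio_sign eps j ks0) (err_gauge_n eps)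
  (in_err_tubesE He) (leq0n n).
rewrite mulrA => h.
have g0 := obs_gain_gt0 n w1 k.+1.
rewrite normrM (gtr0_norm g0) norm_rho.
have h1 : rho k.+1 `|err_gauge eps 0| <= (Bv * kappa) `^ w * rho k.+1 s.
  apply: le_trans (rho_le_shrink _ s0 _ Bkappa1); last by rewrite mulr_gt0.
  by rewrite ler_rho.
apply: le_trans (ler_wpM2l (ltW g0) h1) _; rewrite mulrA.
apply: ler_wpM2r; first exact/ltW/rho_gt0.
apply: le_trans gkappa; rewrite ler_pM2r ?powR_gt0 ?mulr_gt0//.
exact: obs_gain_homo.
Qed.

(** * Contact of a trajectory with a tube *)

Section Contact.
Variables (L : R) (chi eps : nat -> R -> R) (s : R -> R) (t delta : R).
Hypotheses (L0 : 0 < L) (s0 : 0 < s t) (smono : \forall u \near t^'-, s t <= s u)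
  (sd : is_derive t 1 s (- delta))
  (chid : forall k, (k < n)%N ->
    is_derive t 1 (chi k) (L * ctrl_field (chi ^~ t) (eps ^~ t) k))
  (epsd : forall k, (k < n)%N ->
    is_derive t 1 (eps k) (L * err_field (eps ^~ t) k))
  (Hc : in_ctrl_tubes (s t) (chi ^~ t))
  (He : in_err_tubes (kappa * s t) (eps ^~ t)).

Local Notation S0 := (s t).
Local Notation u0 := (ctrl_gauge (chi ^~ t)).

Let uy k : 0 <= u0 k * ctrl_ratio S0 (chi ^~ t) k.
Proof. exact: ctrl_ratio_sign. Qed.
Let yM k M : 1 <= M -> `|u0 k| <= M * S0 -> `|ctrl_ratio S0 (chi ^~ t) k| <= M.
Proof. exact: ctrl_ratio_le. Qed.

Lemma ctrl_speed k : (k < n)%N ->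
  `|L * ctrl_field (chi ^~ t) (eps ^~ t) k| < 8 * L * mu k.+1 * rho k.+1 S0.
Proof.
move=> kn; rewrite normrM (gtr0_norm L0).
have -> : 8 * L * mu k.+1 * rho k.+1 S0 = L * (8 * mu k.+1 * rho k.+1 S0) by ring.
rewrite ltr_pM2l//.
have h1 := next_gauge_bound w1 s0 uy yM Hc kn.
have h2 := injection_small s0 He kn.
have m1 := tube_size_ge1 w1 k.+1; have r0 := rho_gt0 k.+1 s0.
have m7 : 1 <= 7 * mu k.+1 by lra.
have h3 : `|rho k.+1 (next_gauge w n u0 k)| <= 7 * mu k.+1 * rho k.+1 S0.
  by apply: le_trans (rho_le_mul _ s0 m7); rewrite norm_rho ler_rho.
apply: le_lt_trans (ler_normD _ _) _.
have : 1 * rho k.+1 S0 <= mu k.+1 * rho k.+1 S0 by rewrite ler_pM2r.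
lra.
Qed.

Lemma scale_rate k : (k < n)%N -> S0 / rho k S0 * rho k.+1 S0 = S0 * rate S0.
Proof.
by move=> kn; rewrite rhoS// mulrA divfK// gt_eqF// rho_gt0.
Qed.

Lemma backstep_left_lipschitz k : (k < n)%N ->
  \forall u \near t^'-,
    `|backstep w (ctrl_gauge (chi ^~ u)) k - backstep w u0 k| <=
    (96 * mu k * mu k.+1 / w + drift w k) * (L * (S0 * rate S0)) * (t - u).
Proof.
(* [96 = 2 * 6 * 8]: the factor 2 of [gauge_left_lipschitz], the gauge bound [6 * mu j] and the
   speed bound [8 * mu j.+1]. *)
have G j : (j < n)%N -> \forall u \near t^'-,
    `|sg j (chi j u) - sg j (chi j t)| <=
    (96 * mu j * mu j.+1 / w) * (L * (S0 * rate S0)) * (t - u).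
  move=> jn; have [h _] := ctrl_tube_bounds w1 s0 uy yM Hc jn.
  have m1 := tube_size_ge1 w1 j.
  have m6 : 1 <= 6 * mu j by lra.
  have := gauge_left_lipschitz w0 (wa j) (wb j) m6 s0 (chid jn) (ctrl_speed jn) h.
  apply: filterS => u; rewrite -/(rho j) -/(sg j) => /le_trans; apply.
  rewrite -(scale_rate jn) le_eqVlt; apply/orP; left; apply/eqP.
  by field; rewrite !gt_eqF// rho_gt0.
elim: k => [|k IH] kn.
  by rewrite {2}/drift /= addr0; apply: G.
have Hk := IH (ltnW kn); have Gk := G _ kn.
near=> u.
have h1 : `|backstep w (ctrl_gauge (chi ^~ u)) k - backstep w u0 k| <=
    (96 * mu k * mu k.+1 / w + drift w k) * (L * (S0 * rate S0)) * (t - u).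
  by near: u.
have h2 : `|sg k.+1 (chi k.+1 u) - sg k.+1 (chi k.+1 t)| <=
    (96 * mu k.+1 * mu k.+2 / w) * (L * (S0 * rate S0)) * (t - u) by near: u.
have c0 := ctrl_gain_gt0 w1 k.
have h3 := ler_wpM2l (ltW c0) h1; rewrite -(gtr0_norm c0) -normrM (gtr0_norm c0) in h3.
have -> : backstep w (ctrl_gauge (chi ^~ u)) k.+1 - backstep w u0 k.+1 =
    (sg k.+1 (chi k.+1 u) - sg k.+1 (chi k.+1 t)) +
    ctrl_gain w k * (backstep w (ctrl_gauge (chi ^~ u)) k - backstep w u0 k).
  by rewrite /= /ctrl_gauge; ring.
apply: le_trans (ler_normD _ _) _.
by rewrite driftS//; lra.
Unshelve. all: by end_near.
Qed.

Lemma ctrl_contact k : (k < n)%N -> 5 / 4 * mu k * delta < L * (S0 * rate S0) ->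
  ctrl_tube S0 (chi ^~ t) k = mu k * S0 ->
  \forall u \near t^'-, 0 < ctrl_tube (s u) (chi ^~ u) k - mu k * s u.
Proof.
move=> kn Hd E.
have m1 := tube_size_ge1 w1 k; have m1' := tube_size_ge1 w1 k.+1.
have [h _] := ctrl_tube_bounds w1 s0 uy yM Hc kn.
have m6 : 1 <= 6 * mu k by lra.
have chiB : `|chi k t| <= 6 * mu k * rho k S0 by exact: gauge_le_abs h.
pose q u := if k is k'.+1 then
  ctrl_gain w k' * backstep w (ctrl_gauge (chi ^~ u)) k' else 0.
have qE u : backstep w (ctrl_gauge (chi ^~ u)) k = sg k (chi k u) + q u.
  by rewrite /q; case: (k) => //=; rewrite addr0.
have qL : \forall u \near t^'-,
    `|q u - q t| <= drift w k * (L * (S0 * rate S0)) * (t - u).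
  rewrite /q; case: (k) kn => [|k'] kn.
    near=> u; rewrite subrr normr0 /drift /= !mul0r//.
  apply: filterS (backstep_left_lipschitz (ltnW kn)) => u hu.
  have c0 := ctrl_gain_gt0 w1 k'.
  rewrite -mulrBr normrM (gtr0_norm c0).
  by apply: le_trans (ler_wpM2l (ltW c0) hu) _; rewrite driftS//; lra.
have r0 := rho_gt0 k.+1 s0.
have sr0 : 0 < S0 * rate S0 by rewrite mulr_gt0// rate_gt0.
set d := L * ctrl_field (chi ^~ t) (eps ^~ t) k.
(* [tube_sizeS] provides [48 * (drift + 2)], of which the injection takes at most one half. *)
have dle : d <= - (L * (48 * drift w k + 95) * rho k.+1 S0).
  rewrite /d -mulrA -mulrN ler_pM2l// /ctrl_field.
  have h1 := injection_small s0 He kn.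
  have h2 := next_gauge_contact w1 s0 uy yM Hc kn E.
  have h3 : rho k.+1 (next_gauge w n u0 k) <= - rho k.+1 (mu k.+1 * S0).
    by rewrite -[X in _ <= X](gpowN (alpha k.+1) (beta k.+1)) -/(rho k.+1) ler_rho.
  have h4 := rho_ge_mul k.+1 s0 m1'.
  rewrite tube_sizeS// in h4.
  by move: h1; rewrite ler_norml; lra.
have z0 := drift_ge0 w1 k.
have P0 : 0 < L * (48 * drift w k + 95) * rho k.+1 S0.
  by apply: mulr_gt0 => //; apply: mulr_gt0 => //; lra.
have d0 : d < 0 by apply: le_lt_trans dle _; rewrite oppr_lt0.
have al0 : (0 : R) <= 24^-1 by rewrite invr_ge0.
have := contact (a01 k) (b01 k) s0 smono (chid kn) sd qL chiB al0 d0 _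
  (ltW (tube_size_gt0 w1 k)).
rewrite -/(rho k) -/(sg k).
(* In units of [L * (S0 * rate S0)], the inward motion is at least [2 * drift + 95 / 24], against
   [drift] for the slower gauges and less than 1 for the scale, whose coefficient is
   [6 / 24 + 1 = 5 / 4] widths. *)
have H : (24^-1 * (6 * mu k) + mu k) * delta +
    drift w k * (L * (S0 * rate S0)) < 24^-1 * (S0 / rho k S0) * - d.
  have h1 : 24^-1 * (S0 / rho k S0) * (L * (48 * drift w k + 95) * rho k.+1 S0) =
     24^-1 * (48 * drift w k + 95) * (L * (S0 * rate S0)).
    by rewrite -(scale_rate kn); ring.
  have h2 : 0 <= 24^-1 * (S0 / rho k S0).
    by rewrite mulr_ge0// divr_ge0 ?ltW// rho_gt0.
  have h3 : L * (48 * drift w k + 95) * rho k.+1 S0 <= - d by rewrite lerNr.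
  have := ler_wpM2l h2 h3; rewrite h1.
  have : 0 < L * (S0 * rate S0) by rewrite mulr_gt0.
  have := mulr_ge0 z0 (ltW (mulr_gt0 L0 sr0)).
  lra.
move=> /(_ H); apply: filterS => u; rewrite -/(rho k) -/(sg k) => Hu.
have e1 : sg k (chi k t) + 24^-1 * (S0 / rho k S0) * chi k t + q t - mu k * S0 = 0.
  by move: E; rewrite /ctrl_tube qE; lra.
rewrite e1 in Hu.
have -> : ctrl_tube (s u) (chi ^~ u) k - mu k * s u =
    sg k (chi k u) + 24^-1 * (s u / rho k (s u)) * chi k u + q u - mu k * s u.
  by rewrite /ctrl_tube qE; ring.
exact: Hu.
Unshelve. all: by end_near.
Qed.

Local Notation S1 := (kappa * s t).
Local Notation v0 := (err_gauge (eps ^~ t)).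

Let S10 : 0 < S1. Proof. by rewrite mulr_gt0. Qed.
Let vy k : 0 <= v0 k * err_ratio S1 (eps ^~ t) k.
Proof. exact: err_ratio_sign. Qed.
Let yM' k M : 1 <= M -> `|v0 k| <= M * S1 -> `|err_ratio S1 (eps ^~ t) k| <= M.
Proof. exact: err_ratio_le. Qed.

Lemma scale_rate_err k : (k < n)%N -> S1 / rho k S1 * rho k.+1 S1 = S1 * rate S1.
Proof.
by move=> kn; rewrite rhoS// mulrA divfK// gt_eqF// rho_gt0.
Qed.

Lemma err_speed k : (k < n)%N ->
  `|L * err_field (eps ^~ t) k| < 3 * L * lam k * Bv * rho k.+1 S1.
Proof.
move=> kn; rewrite !normrM (gtr0_norm L0).
have l0 := obs_rate_gt0 n w1 k.
have -> : 3 * L * lam k * Bv * rho k.+1 S1 = L * (lam k * (3 * Bv * rho k.+1 S1))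
  by ring.
rewrite ltr_pM2l// (gtr0_norm l0) ltr_pM2l//.
have B j : (j <= n)%N -> `|rho k.+1 (v0 j)| <= Bv * rho k.+1 S1.
  move=> jn; apply: le_trans (rho_le_mul _ S10 Bv1); rewrite norm_rho ler_rho.
  exact: (err_bound S10 vy (err_gauge_n _) (in_err_tubesE He)).
have h0 := B 0%N isT; have h1 := B k.+1 kn.
apply: le_lt_trans (ler_normB _ _) _.
have : 0 < Bv * rho k.+1 S1 by rewrite mulr_gt0// rho_gt0.
lra.
Qed.

Lemma err_contact_tube k : (k < n)%N ->
  4 * delta < L * (s t * rate S1) ->
  err_tube S1 (eps ^~ t) k = 8 ^+ k * S1 ->
  \forall u \near t^'-, 0 < err_tube (kappa * s u) (eps ^~ u) k - 8 ^+ k * (kappa * s u).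
Proof.
move=> kn Hd E.
have l0 := obs_rate_gt0 n w1 k; have l0' := obs_rate_gt0 n w1 k.+1.
have l1' := obs_rate_ge1 n w1 k.+1.
have E' : err_gauge (eps ^~ t) k - err_gauge (eps ^~ t) k.+1 +
    (8 * Bv)^-1 * (S1 * err_ratio S1 (eps ^~ t) k) = 8 ^+ k * S1.
  by move: E; rewrite /err_tube /err_ratio kn.
have TE := in_err_tubesE He.
have h : `|v0 k| <= Bv * S1.
  exact: (err_bound S10 vy (err_gauge_n _) TE (ltnW kn)).
have epsB : `|eps k t| <= Bv * rho k S1.
  by apply: gauge_le_abs S10 Bv1 _; move: h; rewrite /err_gauge kn.
pose q u := - err_gauge (eps ^~ u) k.+1.
pose Lam := 2 * Bv / w * 3 * L * lam k.+1 * Bv * (S1 * rate S1).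
have sr0 : 0 < S1 * rate S1 by rewrite mulr_gt0// rate_gt0.
have LsrE : 0 < L * (S1 * rate S1) by rewrite mulr_gt0.
have qL : \forall u \near t^'-, `|q u - q t| <= Lam * (t - u).
  rewrite /q /err_gauge; case: ifP => kn'; last first.
    near=> u; rewrite subrr normr0 mulr_ge0//; last first.
      by rewrite subr_ge0 ltW//; near: u; exact: nbhs_left_lt.
    by rewrite /Lam !mulr_ge0// ?invr_ge0 ?ltW//; apply: rate_gt0.
  have h1 : `|sg k.+1 (eps k.+1 t)| <= Bv * S1.
    have := err_bound S10 vy (err_gauge_n _) TE kn.
    by rewrite /err_gauge kn'.
  have := gauge_left_lipschitz w0 (wa k.+1) (wb k.+1) Bv1 S10 (epsd kn')
    (err_speed kn') h1.
  apply: filterS => u; rewrite -/(sg k.+1) -/(rho k.+1).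
  rewrite -opprD normrN => /le_trans; apply.
  rewrite /Lam -(scale_rate_err kn') le_eqVlt; apply/orP; left; apply/eqP.
  by field; rewrite !gt_eqF// rho_gt0.
set d := L * err_field (eps ^~ t) k.
have r0 := rho_gt0 k.+1 S10.
(* The gap [S1 / 2] of [err_contact] times the slope of the scale function on arguments up to
   [Bv * S1]. *)
have dle : d <= - (L * lam k * (w / (2 * Bv)) * rho k.+1 S1).
  rewrite /d /err_field -!mulrA -mulrN ler_pM2l// -mulrN ler_pM2l//.
  have h1 := err_contact S10 vy (err_gauge_n _) yM' TE kn E'.
  have h2 := err_bound S10 vy (err_gauge_n _) TE (leq0n n).
  have h3 := err_bound S10 vy (err_gauge_n _) TE kn.
  have h4 : v0 k.+1 <= v0 0%N by have := S10; lra.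
  have := gpow_slope w0 (wa k.+1) (wb k.+1) S10 Bv1 h2 h3 h4.
  rewrite -/(rho k.+1) => h5.
  have c0 : 0 <= w / Bv * (rho k.+1 S1 / S1).
    by rewrite !mulr_ge0// ?invr_ge0 ?ltW.
  have := ler_wpM2l c0 h1.
  have -> : w / Bv * (rho k.+1 S1 / S1) * (S1 / 2) =
      w * ((2 * Bv)^-1 * rho k.+1 S1).
    by field; rewrite !gt_eqF.
  lra.
have P0 : 0 < L * lam k * (w / (2 * Bv)) * rho k.+1 S1.
  by rewrite !mulr_gt0// invr_gt0 mulr_gt0.
have d0 : d < 0 by apply: le_lt_trans dle _; rewrite oppr_lt0.
have al0 : 0 <= (8 * Bv)^-1 by rewrite invr_ge0 mulr_ge0// ltW.
have k8 : 0 <= 8 ^+ k :> R by rewrite exprn_ge0.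
have sd' : is_derive t 1 (fun u => kappa * s u) (- (kappa * delta)).
  by rewrite -mulrN; apply: is_deriveZ.
have smono' : \forall u \near t^'-, kappa * s t <= kappa * s u.
  by apply: filterS smono => u su; rewrite ler_pM2l.
(* In units of [L * (S1 * rate S1)], the inward motion is at least [7 * Bv ^+ 2 * lam k.+1 / w]. The
   next gauge takes 6 parts out of 7; the seventh is at least [Bv], which exceeds the contribution
   of the scale. *)
have H : ((8 * Bv)^-1 * Bv + 8 ^+ k) * (kappa * delta) + Lam <
    (8 * Bv)^-1 * (S1 / rho k S1) * - d.
  have h1 : (8 * Bv)^-1 * (S1 / rho k S1) *
      (L * lam k * (w / (2 * Bv)) * rho k.+1 S1) =
      lam k * w / (16 * Bv ^+ 2) * (L * (S1 * rate S1)).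
    by rewrite -(scale_rate_err kn); field; rewrite !gt_eqF// rho_gt0.
  have h2 : 0 <= (8 * Bv)^-1 * (S1 / rho k S1).
    by rewrite mulr_ge0// divr_ge0 ?ltW// rho_gt0.
  have h3 : L * lam k * (w / (2 * Bv)) * rho k.+1 S1 <= - d by rewrite lerNr.
  have h4 := ler_wpM2l h2 h3; rewrite h1 in h4.
  have h5 : lam k * w / (16 * Bv ^+ 2) = 7 * Bv ^+ 2 * lam k.+1 / w.
    by rewrite obs_rateS//; field; rewrite !gt_eqF.
  have h6 : Lam = 6 * Bv ^+ 2 * lam k.+1 / w * (L * (S1 * rate S1)).
    by rewrite /Lam; ring.
  have h7 : Bv <= Bv ^+ 2 * lam k.+1 / w.
    rewrite ler_pdivlMr//; apply: (@le_trans _ _ (Bv * 1)).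
      by rewrite ler_pM2l//; case/andP: w1.
    rewrite expr2 -mulrA ler_pM2l//.
    have := ler_pM ler01 ler01 Bv1 l1'; rewrite mulr1; exact.
  have h8 : 8 ^+ k <= Bv by rewrite /err_size ler_weXn2l ?ler1n// ltnW.
  have h9 : (8 * Bv)^-1 * Bv = 8^-1 by field; rewrite gt_eqF.
  have h10 : kappa * delta < 4^-1 * (L * (S1 * rate S1)).
    have h10 : 4 * (kappa * delta) < L * (S1 * rate S1).
      have -> : 4 * (kappa * delta) = kappa * (4 * delta) by ring.
      have -> : L * (S1 * rate S1) = kappa * (L * (s t * rate S1)) by ring.
      by rewrite ltr_pM2l.
    lra.
  set Q := L * (S1 * rate S1) in LsrE h4 h6 h10 *.
  have h11 : (8^-1 + 8 ^+ k) * (kappa * delta) <= (8^-1 + 8 ^+ k) * (4^-1 * Q).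
    by rewrite ler_wpM2l ?addr_ge0 ?invr_ge0// ltW.
  have h12 : (8^-1 + 8 ^+ k) * (4^-1 * Q) < Bv * Q.
    rewrite mulrA ltr_pM2r//; have := Bv1; lra.
  have h13 : Bv * Q <= Bv ^+ 2 * lam k.+1 / w * Q by rewrite ler_pM2r.
  rewrite h5 in h4; rewrite h6 h9; lra.
have := @contact _ _ _ (eps k) (fun u => kappa * s u) q t _ _ _ _ _ _
  (a01 k) (b01 k) S10 smono' (epsd kn) sd' qL epsB al0 d0 H k8.
rewrite -/(rho k) -/(sg k).
apply: filterS => u; rewrite -/(rho k) -/(sg k) => Hu.
have e1 : sg k (eps k t) + (8 * Bv)^-1 * (S1 / rho k S1) * eps k t + q t
   - 8 ^+ k * S1 = 0.
  by move: E; rewrite /err_tube /q {1}/err_gauge kn; lra.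
rewrite e1 in Hu.
have -> : err_tube (kappa * s u) (eps ^~ u) k - 8 ^+ k * (kappa * s u) =
    sg k (eps k u) + (8 * Bv)^-1 * (kappa * s u / rho k (kappa * s u)) * eps k u +
    q u - 8 ^+ k * (kappa * s u).
  by rewrite /err_tube /q {1}/err_gauge kn; ring.
exact: Hu.
Unshelve. all: by end_near.
Qed.

End Contact.

(** By oddness of gauges, fields and tubes, a contact with the lower boundary is one with the upper
    boundary for the opposite trajectory. *)
Lemma gaugeN k x : sg k (- x) = - sg k x. Proof. exact: gpowN. Qed.

Lemma ctrl_gaugeN chi : ctrl_gauge (fun k => - chi k) = fun k => - ctrl_gauge chi k.
Proof. by apply/funext => k; exact: gaugeN. Qed.

Lemma err_gaugeN eps : err_gauge (fun k => - eps k) = fun k => - err_gauge eps k.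
Proof.
by apply/funext => k; rewrite /err_gauge; case: ifP => _; [exact: gaugeN|rewrite oppr0].
Qed.

Lemma backstepN u k : backstep w (fun k => - u k) k = - backstep w u k.
Proof. by elim: k => //= k ->; rewrite mulrN opprD. Qed.

Lemma ctrl_fieldN chi eps k :
  ctrl_field (fun k => - chi k) (fun k => - eps k) k = - ctrl_field chi eps k.
Proof.
rewrite /ctrl_field ctrl_gaugeN err_gaugeN /next_gauge backstepN.
by case: ifP => _; rewrite /rho ?mulrN ?gpowN mulrN opprD.
Qed.

Lemma err_fieldN eps k : err_field (fun k => - eps k) k = - err_field eps k.
Proof. by rewrite /err_field err_gaugeN /rho !gpowN -mulrN -opprB opprK addrC. Qed.

Lemma ctrl_tubeN s chi k : ctrl_tube s (fun k => - chi k) k = - ctrl_tube s chi k.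
Proof. by rewrite /ctrl_tube ctrl_gaugeN backstepN mulNr !mulrN opprD. Qed.

Lemma err_tubeN s eps k : err_tube s (fun k => - eps k) k = - err_tube s eps k.
Proof. by rewrite /err_tube err_gaugeN; ring. Qed.

Lemma gauge_continuous k : continuous (sg k).
Proof. by apply: gpow_continuous; rewrite invr_gt0. Qed.

Section TubeConvergence.
Variables (F : set_system R) (FF : Filter F) (chi eps : nat -> R -> R)
  (s : R -> R) (x : R).
Hypotheses (chiF : forall k, (k < n)%N -> chi k @ F --> chi k x)
  (epsF : forall k, (k < n)%N -> eps k @ F --> eps k x)
  (sF : s @ F --> s x) (sx0 : 0 < s x).

Let gauge_cvg k (f : R -> R) : f @ F --> f x -> (fun u => sg k (f u)) @ F --> sg k (f x).
Proof. by move=> fF; apply: (cvg_comp _ _ fF); exact: gauge_continuous. Qed.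

Lemma backstep_cvg k : (k < n)%N ->
  (fun u => backstep w (ctrl_gauge (chi ^~ u)) k) @ F -->
  backstep w (ctrl_gauge (chi ^~ x)) k.
Proof.
elim: k => [|k IH] kn /=; first by apply: gauge_cvg; exact: chiF.
apply: cvgD; first by apply: gauge_cvg; exact: chiF.
by apply: cvgMl_tmp; exact/IH/ltnW.
Qed.

Let ratio_cvg k (f : R -> R) (c : R) : 0 < c -> f @ F --> f x ->
  (fun u => c * s u * (f u / rho k (c * s u))) @ F -->
  c * s x * (f x / rho k (c * s x)).
Proof.
move=> c0 fF; have csF : (fun u => c * s u) @ F --> c * s x by exact: cvgMl_tmp.
apply: cvgM => //; apply: cvgM => //; apply: cvgV.
  by rewrite gt_eqF// rho_gt0// mulr_gt0.
by apply: (cvg_comp _ _ csF); exact: gpow_continuous.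
Qed.

Lemma ctrl_tube_cvg k : (k < n)%N ->
  (fun u => ctrl_tube (s u) (chi ^~ u) k - mu k * s u) @ F -->
  ctrl_tube (s x) (chi ^~ x) k - mu k * s x.
Proof.
move=> kn; apply: cvgB; last exact: cvgMl_tmp.
apply: cvgD; first exact: backstep_cvg.
apply: cvgMl_tmp; have := @ratio_cvg k _ _ ltr01 (chiF kn).
by rewrite mul1r; apply: cvg_trans; apply: near_eq_cvg; near=> u; rewrite mul1r.
Unshelve. all: by end_near.
Qed.

Lemma err_gauge_cvg k : (k <= n)%N ->
  (fun u => err_gauge (eps ^~ u) k) @ F --> err_gauge (eps ^~ x) k.
Proof.
rewrite /err_gauge; case: ifP => kn _; last exact: cvg_cst.
by apply: gauge_cvg; exact: epsF.
Qed.

Lemma err_tube_cvg k : (k < n)%N ->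
  (fun u => err_tube (kappa * s u) (eps ^~ u) k - 8 ^+ k * (kappa * s u)) @ F -->
  err_tube (kappa * s x) (eps ^~ x) k - 8 ^+ k * (kappa * s x).
Proof.
move=> kn; apply: cvgB; last by apply: cvgMl_tmp; exact: cvgMl_tmp.
apply: cvgD; last by apply: cvgMl_tmp; apply: ratio_cvg => //; exact: epsF.
by apply: cvgB; apply: err_gauge_cvg => //; exact: ltnW.
Qed.

End TubeConvergence.

(** Strict, as [barrier] propagates strict inequalities; at a first contact only [in_ctrl_tubes] and
    [in_err_tubes] are available. *)
Definition inside_tubes (s : R) (chi eps : nat -> R) := forall k, (k < n)%N ->
  `|ctrl_tube s chi k| < mu k * s /\ `|err_tube (kappa * s) eps k| < 8 ^+ k * (kappa * s).

Lemma inside_tubes_invariant (L S : R) : 0 < L -> 0 < S ->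
  exists2 c, 0 < c & forall (chi eps : nat -> R -> R) (b : R),
    (forall k, (k < n)%N -> {within `[0, b], continuous (chi k)}) ->
    (forall k, (k < n)%N -> {within `[0, b], continuous (eps k)}) ->
    (forall k t, (k < n)%N -> 0 < t <= b ->
      is_derive t 1 (chi k) (L * ctrl_field (chi ^~ t) (eps ^~ t) k)) ->
    (forall k t, (k < n)%N -> 0 < t <= b ->
      is_derive t 1 (eps k) (L * err_field (eps ^~ t) k)) ->
    inside_tubes S (chi ^~ 0) (eps ^~ 0) ->
    forall t, 0 <= t <= b ->
      inside_tubes (shrinking_scale S c t) (chi ^~ t) (eps ^~ t).
Proof.
move=> L0 S0.
pose Mu := \sum_(k < n) mu k + 1.
have muM k : (k < n)%N -> mu k <= Mu.
  move=> kn; rewrite /Mu (bigD1 (Ordinal kn))//= -addrA lerDl.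
  by rewrite addr_ge0// sumr_ge0// => i _; exact/ltW/tube_size_gt0.
have Mu0 : 0 < Mu.
  by rewrite /Mu ltr_pwDr// sumr_ge0// => i _; exact/ltW/tube_size_gt0.
pose M1 := Num.max 1 S ^+ 2; pose M2 := Num.max 1 (kappa * S) ^+ 2.
have M10 : 0 < M1 by rewrite exprn_gt0// lt_max ltr01.
have M20 : 0 < M2 by rewrite exprn_gt0// lt_max ltr01.
have D10 : 0 < 2 * Mu * M1 by apply: mulr_gt0 => //; apply: mulr_gt0.
have N20 : 0 < L * kappa by exact: mulr_gt0.
have D20 : 0 < 8 * M2 by exact: mulr_gt0.
(* With [le_rate] at scales [s] and [kappa * s], these bounds yield the conditions on [delta] in
   [ctrl_contact] and [err_contact_tube]; the constants 2 and 8 leave strict room over [5 / 4] and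
   4. *)
pose c := Num.min (L / (2 * Mu * M1)) (L * kappa / (8 * M2)).
have c0 : 0 < c.
  by rewrite lt_min; apply/andP; split; apply: divr_gt0.
have c1 : c * (2 * Mu * M1) <= L.
  by rewrite -ler_pdivlMr// ge_min lexx.
have c2 : c * (8 * M2) <= L * kappa.
  by rewrite -ler_pdivlMr// ge_min lexx orbT.
exists c => // chi eps b chic epsc chid epsd ins.
pose s := shrinking_scale S c.
have s_gt0 t : 0 <= t -> 0 < s t by exact: shrinking_scale_gt0.
(* A barrier is indexed by the side of the tube, its kind (true for errors) and the coordinate. *)
pose sgn (i : bool) : R := if i then -1 else 1.
pose g (i : bool * bool * 'I_n) (u : R) : R :=
  if i.1.2 then err_tube (kappa * s u) (fun k => sgn i.1.1 * eps k u) i.2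
    - 8 ^+ i.2 * (kappa * s u)
  else ctrl_tube (s u) (fun k => sgn i.1.1 * chi k u) i.2 - mu i.2 * s u.
have gE t : 0 <= t -> ((forall i, g i t < 0) <->
    inside_tubes (s t) (chi ^~ t) (eps ^~ t)).
  move=> t0.
  have eN : (fun k => - 1 * eps k t) = fun k => - eps k t.
    by apply/funext => k; rewrite mulN1r.
  have e1 : (fun k => 1 * eps k t) = (eps ^~ t).
    by apply/funext => k; rewrite mul1r.
  have cN : (fun k => - 1 * chi k t) = fun k => - chi k t.
    by apply/funext => k; rewrite mulN1r.
  have c1' : (fun k => 1 * chi k t) = (chi ^~ t).
    by apply/funext => k; rewrite mul1r.
  split.
    move=> H k kn; rewrite !ltr_norml.
    have := H (true, true, Ordinal kn); have := H (true, false, Ordinal kn).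
    have := H (false, true, Ordinal kn); have := H (false, false, Ordinal kn).
    rewrite /g /sgn /= eN e1 cN c1' ctrl_tubeN err_tubeN.
    by move=> *; split; lra.
  move=> H [[[] []] k]; have [] := H k (ltn_ord k); rewrite !ltr_norml /g /sgn /=.
  - by rewrite eN err_tubeN; lra.
  - by rewrite cN ctrl_tubeN; lra.
  - by rewrite e1; lra.
  - by rewrite c1'; lra.
have gE' t : 0 <= t -> (forall i, g i t <= 0) ->
    forall i, in_ctrl_tubes (s t) (fun k => sgn i * chi k t) /\
      in_err_tubes (kappa * s t) (fun k => sgn i * eps k t).
  move=> t0 H i.
  have E (f : nat -> R) : (fun k => sgn (~~ i) * f k) = fun k => - (sgn i * f k).
    by apply/funext => k; rewrite /sgn; case: (i) => /=; rewrite ?mulN1r ?mul1r ?opprK.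
  split=> k kn; rewrite ler_norml.
    have := H (i, false, Ordinal kn); have := H (~~ i, false, Ordinal kn).
    by rewrite /g /= E ctrl_tubeN; lra.
  have := H (i, true, Ordinal kn); have := H (~~ i, true, Ordinal kn).
  by rewrite /g /= E err_tubeN; lra.
move=> t tb; apply/gE; first by case/andP: tb.
move=> i; apply: (@barrier _ _ g b) tb => {t i}.
- move=> [[i e] k]; apply/subspace_continuousP => x xb.
  have x0 : 0 <= x by move: xb; rewrite /= in_itv /= => /andP[].
  have sF : s @ within `[0, b]%classic (nbhs x) --> s x.
    apply: cvg_within_filter; apply/differentiable_continuous/derivable1_diffP.
    by case: (is_derive_shrinking_scale S0 c0 x0).
  have chiF j : (j < n)%N ->
      (fun u => sgn i * chi j u) @ within `[0, b]%classic (nbhs x) --> sgn i * chi j x.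
    by move=> jn; apply: cvgMl_tmp; have /subspace_continuousP := chic j jn; exact.
  have epsF j : (j < n)%N ->
      (fun u => sgn i * eps j u) @ within `[0, b]%classic (nbhs x) --> sgn i * eps j x.
    by move=> jn; apply: cvgMl_tmp; have /subspace_continuousP := epsc j jn; exact.
  case: e; rewrite /g /=.
    by apply: (@err_tube_cvg _ _ (fun j u => sgn i * eps j u) s x) => //;
      exact: s_gt0.
  by apply: (@ctrl_tube_cvg _ _ (fun j u => sgn i * chi j u) s x) => //;
    exact: s_gt0.
- apply/gE => //; rewrite /s shrinking_scale0; exact: ins.
- move=> t [[i e] k] tb gt0 gi.
  have t0 : 0 <= t by lra.
  have [Hc He] := gE' t t0 gt0 i.
  have kn := ltn_ord k.
  have st0 := s_gt0 t t0.
  have sS : s t <= S.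
    by have := shrinking_scale_le S0 c0 (lexx 0) t0; rewrite shrinking_scale0.
  have tpos : 0 < t by lra.
  have smono : \forall u \near t^'-, s t <= s u.
    near=> u; apply: (shrinking_scale_le S0 c0).
    - by near: u; exact: nbhs_left_ge.
    - by near: u; apply: nbhs_left_le.
  have sd := is_derive_shrinking_scale S0 c0 t0; rewrite -/s in sd.
  have field_sgn (f : nat -> R) : (fun k => sgn i * f k) =
      if i then (fun k => - f k) else f.
    by apply/funext => j; rewrite /sgn; case: (i); rewrite ?mulN1r ?mul1r.
  have chid' j : (j < n)%N -> is_derive t 1 (fun u => sgn i * chi j u)
      (L * ctrl_field (fun k => sgn i * chi k t) (fun k => sgn i * eps k t) j).
    move=> jn; rewrite (field_sgn (chi ^~ t)) (field_sgn (eps ^~ t)).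
    have D := is_deriveZ (sgn i) (chid j t jn tb).
    apply: (is_derive_eq D); rewrite /GRing.scale /= /sgn; case: (i); last by rewrite mul1r.
    by rewrite ctrl_fieldN mulrN mulN1r.
  have epsd' j : (j < n)%N -> is_derive t 1 (fun u => sgn i * eps j u)
      (L * err_field (fun k => sgn i * eps k t) j).
    move=> jn; rewrite (field_sgn (eps ^~ t)).
    have D := is_deriveZ (sgn i) (epsd j t jn tb).
    apply: (is_derive_eq D); rewrite /GRing.scale /= /sgn; case: (i); last by rewrite mul1r.
    by rewrite err_fieldN mulrN mulN1r.
  have r1 := le_rate st0 sS; rewrite -/M1 in r1.
  have ks0 : 0 < kappa * s t by rewrite mulr_gt0.
  have ksS : kappa * s t <= kappa * S by rewrite ler_pM2l.
  have r2 := le_rate ks0 ksS; rewrite -/M2 in r2.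
  move: gi; case: e; rewrite /g /= => gi.
    apply: (@err_contact_tube L (fun j u => sgn i * eps j u) s t
      (c * s t ^+ 2)) => //; last by apply/eqP; rewrite -subr_eq0; apply/eqP.
    have -> : 4 * (c * s t ^+ 2) = s t * (4 * (c * s t)) by ring.
    rewrite [ltRHS]mulrCA ltr_pM2l// -(ltr_pM2l kappa0).
    have -> : kappa * (4 * (c * s t)) = 4 * c * (kappa * s t) by ring.
    apply: (@le_lt_trans _ _ (4 * c * (M2 * rate (kappa * s t)))).
      by rewrite ler_pM2l ?mulr_gt0.
    have R0 := rate_gt0 ks0.
    rewrite (mulrA (4 * c)) (mulrA kappa) ltr_pM2r//.
    have : 0 < c * M2 by rewrite mulr_gt0.
    lra.
  apply: (@ctrl_contact L (fun j u => sgn i * chi j u) (fun j u => sgn i * eps j u)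
    s t (c * s t ^+ 2)) => //; last by apply/eqP; rewrite -subr_eq0; apply/eqP.
  have -> : 5 / 4 * mu k * (c * s t ^+ 2) = s t * (5 / 4 * mu k * c * s t) by ring.
  rewrite [ltRHS]mulrCA ltr_pM2l//.
  have mk := muM k kn; have mk0 := tube_size_gt0 w1 k.
  apply: (@le_lt_trans _ _ (5 / 4 * mu k * c * (M1 * rate (s t)))).
    by rewrite ler_pM2l// !mulr_gt0.
  rewrite mulrA ltr_pM2r ?rate_gt0//.
  have h : mu k * (c * M1) <= Mu * (c * M1) by rewrite ler_pM2r// mulr_gt0.
  have : 0 < Mu * (c * M1) by apply: mulr_gt0 => //; exact: mulr_gt0.
  lra.
Unshelve. all: by end_near.
Qed.

End Dynamics.

(** * Comparison of tubes with boxes *)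

Section Boxes.
Context {R : realType}.
Variables (w : R) (n : nat) (alpha beta : nat -> R) (kappa : R).
Hypotheses (w0 : 0 < w) (wa : forall k, w <= alpha k <= 1)
  (wb : forall k, w <= beta k <= 1) (kappa0 : 0 < kappa).

Let w1 : 0 < w <= 1.
Proof. by case/andP: (wa 0%N) => wa0 wa1; rewrite w0 (le_trans wa0). Qed.

Local Notation rho := (scale_fun alpha beta).
Local Notation sg := (gauge_fun alpha beta).

Lemma inside_tubes_bound (s : R) (chi eps : nat -> R) : 0 < s ->
  inside_tubes w n alpha beta kappa s chi eps -> forall k, (k < n)%N ->
  `|chi k| <= 6 * tube_size w k * rho k s /\
  `|eps k| <= err_size R n * rho k (kappa * s).
Proof.
move=> s0 H k kn; have ks0 : 0 < kappa * s by exact: mulr_gt0.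
have Hc : in_ctrl_tubes w n alpha beta s chi by move=> j /H[/ltW].
have He : in_err_tubes n alpha beta (kappa * s) eps by move=> j /H[_ /ltW].
have m1 := tube_size_ge1 w1 k.
split.
  have [h _] := ctrl_tube_bounds w1 s0 (fun j => ctrl_ratio_sign w0 wa wb chi j s0)
    (fun j M => @ctrl_ratio_le _ _ _ _ w0 wa wb s chi j M s0) Hc kn.
  have m6 : 1 <= 6 * tube_size w k by lra.
  exact: (gauge_le_abs w0 wa wb s0 m6 h).
have h := err_bound ks0 (fun j => err_ratio_sign n w0 wa wb eps j ks0)
  (err_gauge_n n _ _ _) (in_err_tubesE He) (ltnW kn).
rewrite /err_gauge kn in h.
exact: (gauge_le_abs w0 wa wb ks0 (err_size_ge1 _ _) h).
Qed.

Lemma backstep_bound u (M : R) k : 0 <= M -> (forall j, (j <= k)%N -> `|u j| <= M) ->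
  `|backstep w u k| <= M * backstep w (fun=> 1) k.
Proof.
move=> M0; elim: k => [|k IH] H /=; first by rewrite mulr1 H.
apply: le_trans (ler_normD _ _) _; rewrite mulrDr mulr1 lerD ?H//.
have c0 := ctrl_gain_gt0 w1 k.
rewrite normrM (gtr0_norm c0) mulrCA ler_pM2l//.
by apply: IH => j jk; apply: H; exact: leqW.
Qed.

(** At a fixed scale this gives a neighbourhood of 0 inside the tubes; at a large scale it captures
    any given state. Thanks to [b <= kappa / 4] a box uses at most [1 / 2 + 1 / 8] of an error
    width, and thanks to [b * W <= 1 / 2] at most [1 / 2 + 1 / 24] of a controller width. *)
Lemma box_inside_tubes : exists2 b : R, 0 < b & forall (s : R) (chi eps : nat -> R),
  0 < s ->
  (forall k, (k < n)%N -> `|sg k (chi k)| <= b * s /\ `|sg k (eps k)| <= b * s) ->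
  inside_tubes w n alpha beta kappa s chi eps.
Proof.
have W0 k : 0 <= backstep w (fun=> 1) k.
  elim: k => [|k IH] //=; apply: addr_ge0 => //; apply: mulr_ge0 => //.
  exact: ltW (ctrl_gain_gt0 w1 k).
pose W := \sum_(k < n) backstep w (fun=> 1) k + 1.
have WS : 0 <= \sum_(k < n) backstep w (fun=> 1) k by apply: sumr_ge0.
have Wgt0 : 0 < W by rewrite /W; lra.
have W1 : 1 <= W by rewrite /W; lra.
have WM k : (k < n)%N -> backstep w (fun=> 1) k <= W.
  move=> kn; rewrite /W (bigD1 (Ordinal kn))//= -addrA lerDl.
  by apply: addr_ge0 => //; apply: sumr_ge0.
pose b := Num.min (kappa / 4) (2 * W)^-1.
have b0 : 0 < b by rewrite lt_min divr_gt0//= invr_gt0 mulr_gt0.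
have b1 : b <= kappa / 4 by rewrite ge_min lexx.
have b2 : b * W <= 2^-1.
  rewrite -ler_pdivlMr// -invfM mulrC ge_min; apply/orP; right; rewrite mulrC.
  exact: lexx.
have b3 : b <= 1.
  have : b * 1 <= b * W by rewrite ler_pM2l.
  lra.
exists b => // s chi eps s0 H k kn; have ks0 : 0 < kappa * s by exact: mulr_gt0.
have bs0 : 0 <= b * s by rewrite mulr_ge0 ?ltW.
have bs1 : b * s <= 1 * s by rewrite ler_pM2r.
have bs2 : b * s <= kappa / 4 * s by rewrite ler_pM2r.
have m1 := tube_size_ge1 w1 k.
have ms : 1 * s <= tube_size w k * s by rewrite ler_pM2r.
split.
  have h1 : `|backstep w (ctrl_gauge alpha beta chi) k| <= 2^-1 * s.
    have hj j : (j <= k)%N -> `|ctrl_gauge alpha beta chi j| <= b * s.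
      by move=> jk; have [] := H j (leq_ltn_trans jk kn).
    apply: le_trans (backstep_bound bs0 hj) _.
    apply: (@le_trans _ _ (b * W * s)); last by rewrite ler_pM2r.
    by rewrite mulrAC ler_pM2r// ler_pM2l// WM.
  have h2 : `|ctrl_ratio alpha beta s chi k| <= 1.
    apply: (ctrl_ratio_le w0 wa wb s0 (lexx 1)).
    by have [h _] := H k kn; exact: le_trans bs1.
  have h3 : `|24^-1 * (s * (chi k / rho k s))| <= 24^-1 * s.
    rewrite normrM gtr0_norm// normrM (gtr0_norm s0) ler_pM2l//.
    by rewrite -[leRHS]mulr1 ler_pM2l.
  apply: le_lt_trans (ler_normD _ _) _; lra.
have hv j : `|err_gauge n alpha beta eps j| <= b * s.
  rewrite /err_gauge; case: ifP => jn; last by rewrite normr0.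
  by have [] := H j jn.
have h2 : `|err_ratio n alpha beta (kappa * s) eps k| <= 1.
  apply: (err_ratio_le w0 wa wb ks0 (lexx 1)); rewrite mul1r.
  by apply: le_trans (hv k) _; lra.
rewrite /err_ratio kn in h2.
have B1 := err_size_ge1 R n.
have h3 : `|(8 * err_size R n)^-1 * (kappa * s * (eps k / rho k (kappa * s)))| <=
    8^-1 * (kappa * s).
  rewrite normrM normrM (gtr0_norm ks0) gtr0_norm; last by rewrite invr_gt0; lra.
  apply: ler_pM => //.
  - by rewrite invr_ge0; lra.
  - by rewrite mulr_ge0// ltW.
  - by rewrite lef_pV2 ?posrE; lra.
  - by rewrite -[leRHS]mulr1 ler_pM2l.
have k8 : (1 : R) <= 8 ^+ k by rewrite exprn_ege1 ?ler1n.
have k8s : 1 * (kappa * s) <= 8 ^+ k * (kappa * s) by rewrite ler_pM2r.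
rewrite /err_tube; apply: le_lt_trans (ler_normD _ _) _.
have := ler_normB (err_gauge n alpha beta eps k) (err_gauge n alpha beta eps k.+1).
have := hv k; have := hv k.+1; lra.
Qed.

End Boxes.

(** * Column vectors *)

Section ColumnVectors.
Context {R : realType} {n : nat}.
Implicit Types (v : 'cV[R]_n) (k : nat).

(** The value 0 beyond the end agrees with the last row of the shift matrix and frees the index
    [k.+1] from a bound. *)
Definition entry v k : R := if insub k is Some i then v i 0 else 0.

Lemma entry_ord v (i : 'I_n) : entry v i = v i 0.
Proof. by rewrite /entry valK. Qed.

Lemma entry_out v k : (n <= k)%N -> entry v k = 0.
Proof. by move=> nk; rewrite /entry insubF// ltnNge nk. Qed.

Lemma entryB u v k : entry (u - v) k = entry u k - entry v k.
Proof. by rewrite /entry; case: insubP => [i _ _|_]; rewrite ?mxE ?subr0. Qed.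

Lemma entryD u v k : entry (u + v) k = entry u k + entry v k.
Proof. by rewrite /entry; case: insubP => [i _ _|_]; rewrite ?mxE ?addr0. Qed.

Lemma entryZ a v k : entry (a *: v) k = a * entry v k.
Proof. by rewrite /entry; case: insubP => [i _ _|_]; rewrite ?mxE ?mulr0. Qed.

Lemma norm_cV_le v (M : R) : 0 <= M -> (forall i, `|v i 0| <= M) -> `|v| <= M.
Proof.
move=> M0 H; rewrite [leLHS]/Num.norm/= mx_normrE; apply: bigmax_le => // [[i j] _].
by rewrite /= (ord1 j); exact: H.
Qed.

Lemma norm_entry v k : `|entry v k| <= `|v|.
Proof.
rewrite /entry; case: insubP => [i _ _|_]; last by rewrite normr0.
rewrite [leRHS]/Num.norm/= mx_normrE.
exact: (le_bigmax _ (fun ij : 'I_n * 'I_1 => `|v ij.1 ij.2|) (i, 0)).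
Qed.

Lemma entry_continuous k : continuous (entry ^~ k).
Proof.
rewrite /entry; case: insubP => [i _ _|_]; first exact: coord_continuous.
exact: cst_continuous.
Qed.

Lemma cvg_cV (T : Type) (F : set_system T) {FF : Filter F} (f : T -> 'cV[R]_n) v :
  (forall i, (fun t => f t i 0) @ F --> v i 0) -> f @ F --> v.
Proof.
move=> H; apply/cvgrPdist_le => e e0.
have N i : \forall t \near F, `|v i 0 - f t i 0| <= e.
  by have /cvgrPdist_le/(_ e e0) := H i.
have : \forall t \near F, forall i, `|v i 0 - f t i 0| <= e.
  exact: (filter_forall _ N).
apply: filterS => t Ht; apply: norm_cV_le; first exact: ltW.
by move=> i; rewrite !mxE; exact: Ht.
Qed.

(** Along an ultrafilter each coordinate converges, by compactness of a segment, and coordinatewise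
    limits are limits. *)
Lemma cV_ball_compact (M : R) : compact [set v : 'cV[R]_n | `|v| <= M].
Proof.
rewrite compact_ultra => U UU UM.
have lim i : exists a : R, `|a| <= M /\ (fun v : 'cV[R]_n => v i 0) @ U --> a.
  have := @segment_compact R (- M) M; rewrite compact_ultra.
  move=> /(_ ((fun v : 'cV[R]_n => v i 0) @ U) (ultra_fmap _ UU)).
  case; last by move=> a [/= aM Ua]; exists a; split => //;
    move: aM; rewrite in_itv /= ler_norml.
  apply: (@filterS _ U _ _ _ _ UM) => v /= vM; rewrite in_itv /= -ler_norml.
  by have := norm_entry v i; rewrite entry_ord => /le_trans; exact.
have [f Hf] := choice lim.
exists (\col_i f i); split => /=; last first.
  by apply: (@cvg_cV _ U _ id) => i; rewrite mxE; have [] := Hf i.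
have [v vM] := filter_ex UM.
apply: norm_cV_le; first exact: le_trans vM.
by move=> i; rewrite mxE; have [] := Hf i.
Qed.

End ColumnVectors.

Lemma prod_ball_compact (R : realType) (U V : normedModType R) :
  (forall M : R, compact [set x : U | `|x| <= M]) ->
  (forall M : R, compact [set y : V | `|y| <= M]) ->
  forall M : R, compact [set z : U * V | `|z| <= M].
Proof.
move=> cU cV M; suff -> : [set z : U * V | `|z| <= M] =
    [set x : U | `|x| <= M] `*` [set y : V | `|y| <= M].
  by apply: compact_setX; [exact: cU|exact: cV].
by apply/seteqP; split => z /=; rewrite prod_normE /= ge_max => /andP.
Qed.

Section LinearFunctional.
Context {R : realType} {V : normedModType R}.
Variables (l : V -> R) (C : R).
Hypotheses (C0 : 0 < C) (lB : forall u v, l (u - v) = l u - l v)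
  (lZ : forall a v, l (a *: v) = a * l v) (lC : forall v, `|l v| <= C * `|v|).

(** Solutions are vector-valued while tubes see scalars: [estimate] and [error] are bounded linear
    functionals of the state, so regularity passes to them. *)
Lemma functional_within_continuous (A : set R) (X : R -> V) :
  {within A, continuous X} -> {within A, continuous (l \o X)}.
Proof.
move=> /within_continuousP H; apply/within_continuousP => x Ax e e0.
have := H x Ax _ (divr_gt0 e0 C0); apply: filterS => y Hy /Hy.
rewrite ltr_pdivlMr// mulrC -lB => h.
exact: le_lt_trans (lC _) h.
Qed.

Lemma functional_is_derive (X : R -> V) (t : R) (v : V) :
  is_derive t 1 X v -> is_derive t 1 (l \o X) (l v).
Proof.
move=> /is_deriveP H; apply/is_deriveP => e e0.
have := H _ (divr_gt0 e0 C0); apply: filterS => u.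
rewrite mulrAC ler_pdivlMr// mulrC => h.
apply: le_trans h; apply: le_trans (lC _).
by rewrite /= !lB lZ.
Qed.

End LinearFunctional.

(* For functions on an abstract topological space, so that the neighbourhood
   filter of matrices does not get unfolded. *)
Section ContinuousFunctions.
Context {R : realType} {T : topologicalType}.
Implicit Types f g : T -> R.

Lemma continuous_mull (c : R) f : continuous f -> continuous (fun x => c * f x).
Proof. by move=> fc x; apply: cvgMl_tmp; exact: fc. Qed.

Lemma continuous_mulr (c : R) f : continuous f -> continuous (fun x => f x * c).
Proof. by move=> fc x; apply: cvgMr_tmp; exact: fc. Qed.

Lemma continuous_add f g :
  continuous f -> continuous g -> continuous (fun x => f x + g x).
Proof. by move=> fc gc x; apply: cvgD; [exact: fc|exact: gc]. Qed.

Lemma continuous_opp f : continuous f -> continuous (fun x => - f x).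
Proof. by move=> fc x; apply: cvgN; exact: fc. Qed.

Lemma continuous_sum (I : finType) (f : I -> T -> R) :
  (forall i, continuous (f i)) -> continuous (fun x => \sum_i f i x).
Proof.
move=> fc; elim: (index_enum I) => [|i r IH].
  under eq_fun do rewrite big_nil.
  exact: cst_continuous.
under eq_fun do rewrite big_cons.
exact: continuous_add.
Qed.

End ContinuousFunctions.

Lemma continuous_compose (T U W : topologicalType) (f : T -> U) (g : U -> W) :
  continuous f -> continuous g -> continuous (fun x => g (f x)).
Proof. by move=> fc gc x; apply: (@continuous_comp _ _ _ f g); [exact: fc|exact: gc]. Qed.

(** * The closed loop *)

Section ClosedLoop.
Context {R : realType}.
Variables (w : R) (n : nat) (hn : (2 <= n)%N) (alpha beta : nat -> R) (da db : R).
Hypotheses (w0 : 0 < w) (wa : forall k, w <= alpha k <= 1)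
  (wb : forall k, w <= beta k <= 1)
  (alphaS : forall k, (k < n)%N -> alpha k.+1 = alpha k + da)
  (betaS : forall k, (k < n)%N -> beta k.+1 = beta k + db)
  (da1 : -1 <= da <= 1) (db1 : -1 <= db <= 1).

Local Notation rho := (scale_fun alpha beta).
Local Notation sg := (gauge_fun alpha beta).
Local Notation gn := (obs_gain w n).

Definition feedback (v : 'cV[R]_n) : R :=
  rho n (next_gauge w n (ctrl_gauge alpha beta (entry v)) n.-1).

(** Only the first entry is read, so [at_first] loses nothing. *)
Definition injection (v : 'cV[R]_n) : 'cV[R]_n :=
  \col_(i < n) (gn i.+1 * rho i.+1 (sg 0 (entry v 0))).

Variables (L : R).
Hypothesis L0 : 0 < L.

Local Notation V := ('cV[R]_n * 'cV[R]_n)%type.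
Local Notation F := (closed_loop hn L feedback injection).

Let w1 : 0 < w <= 1.
Proof. by case/andP: (wa 0%N) => wa0 wa1; rewrite w0 (le_trans wa0). Qed.
Let n0 : (0 < n)%N. Proof. exact: ltnW hn. Qed.
Let nP : n.-1.+1 = n. Proof. exact: prednK. Qed.

Definition estimate (z : V) (k : nat) : R := entry z.2 k.
(** Dividing by [gn k] turns the gains [gn k.+1 = gn k * lam k] into the rates [lam k], common
    factors of both terms of [err_field]. The powers of [L] start at 0, so the first error is the
    measured one. *)
Definition error (z : V) (k : nat) : R :=
  (L ^- k * entry z.1 k - entry z.2 k) / gn k.

Lemma entry_shift (v : 'cV[R]_n) k : (k < n)%N ->
  entry (shift_mx R n *m v) k = entry v k.+1.
Proof.
move=> kn; rewrite -[k]/(nat_of_ord (Ordinal kn)) entry_ord !mxE /=.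
have [kn'|nk] := ltnP k.+1 n.
  rewrite -[k.+1]/(nat_of_ord (Ordinal kn')) entry_ord (bigD1 (Ordinal kn'))//=.
  rewrite !mxE /= eqxx mul1r big1 ?addr0// => i ik.
  rewrite mxE; suff /negbTE -> : (i != k.+1 :> nat) by rewrite mul0r.
  by apply: contraNneq ik => ik; apply/eqP/val_inj.
rewrite entry_out// big1// => i _; rewrite mxE.
suff /negbTE -> : (i != k.+1 :> nat) by rewrite mul0r.
by apply/eqP => ik; have := ltn_ord i; rewrite ik ltnNge nk.
Qed.

Lemma entry_last k : (k < n)%N -> entry (last_vec R n) k = (k.+1 == n)%:R.
Proof.
by move=> kn; rewrite -[k]/(nat_of_ord (Ordinal kn)) entry_ord mxE.
Qed.

Lemma entry_first (v : 'cV[R]_n) : entry v 0 = v (first_ord hn) 0.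
Proof. exact: (entry_ord v (first_ord hn)). Qed.

Lemma closed_loop_state z k : (k < n)%N ->
  entry (F z).1 k = entry z.1 k.+1 + L ^+ n * feedback z.2 * (k.+1 == n)%:R.
Proof. by move=> kn; rewrite /closed_loop /= entryD entryZ entry_shift// entry_last. Qed.

Lemma closed_loop_estimate z k : (k < n)%N ->
  entry (F z).2 k = L * (entry z.2 k.+1 + feedback z.2 * (k.+1 == n)%:R +
    gn k.+1 * rho k.+1 (sg 0 (entry z.1 0 - entry z.2 0))).
Proof.
move=> kn; rewrite /closed_loop /= entryZ !entryD entryZ entry_shift// entry_last//.
congr (_ * (_ + _)).
have E (v : 'cV[R]_n) : entry v k = v (Ordinal kn) 0 := entry_ord v (Ordinal kn).
rewrite E /at_first /injection mxE /=.
congr (_ * rho _ (sg _ _)).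
by rewrite !entry_first mxE.
Qed.

Lemma estimate_field z k : (k < n)%N ->
  estimate (F z) k = L * ctrl_field w n alpha beta (estimate z) (error z) k.
Proof.
move=> kn; rewrite /estimate closed_loop_estimate// /ctrl_field; congr (_ * (_ + _)).
  rewrite /next_gauge; case: ifP => kn'.
    have /negbTE -> : k.+1 != n by rewrite neq_ltn kn'.
    by rewrite mulr0 addr0 /ctrl_gauge (rhoK w0 wa wb).
  have kE : k.+1 = n by apply/eqP; rewrite eqn_leq kn leqNgt kn'.
  rewrite kE eqxx mulr1 entry_out// add0r /feedback /next_gauge nP ltnn.
  by have -> : n.-1 = k by move: kE; lia.
by rewrite /err_gauge n0 /error expr0 invr1 mul1r obs_gain0 divr1.
Qed.

Lemma error_field z k : (k < n)%N ->
  error (F z) k = L * err_field w n alpha beta (error z) k.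
Proof.
have e0 : err_gauge n alpha beta (error z) 0 = sg 0 (entry z.1 0 - entry z.2 0).
  by rewrite /err_gauge n0 /error expr0 invr1 mul1r obs_gain0 divr1.
move=> kn; rewrite {1}/error closed_loop_state// closed_loop_estimate//.
have g0 := obs_gain_gt0 n w1 k; have l0 := obs_rate_gt0 n w1 k.
rewrite /err_field e0.
set rv := rho k.+1 (sg 0 _); rewrite obs_gainS.
rewrite /err_gauge; case: ifP => kn'.
  have /negbTE -> : k.+1 != n by rewrite neq_ltn kn'.
  rewrite (rhoK w0 wa wb) /error obs_gainS exprS !mulr0 !addr0.
  by field; rewrite !gt_eqF// exprn_gt0.
have kE : k.+1 = n by apply/eqP; rewrite eqn_leq kn leqNgt kn'.
(* In the last row [L ^- k * L ^+ n = L], so the input cancels between state and estimate. *)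
have Ln : L ^+ n = L * L ^+ k by rewrite -exprS kE.
rewrite kE eqxx !entry_out// Ln {1}/scale_fun gpow0.
by field; rewrite !gt_eqF// exprn_gt0.
Qed.

Lemma state_of_error z k : entry z.1 k = L ^+ k * (gn k * error z k + estimate z k).
Proof.
rewrite /error /estimate; have g0 := obs_gain_gt0 n w1 k.
by field; rewrite !gt_eqF// exprn_gt0.
Qed.

Lemma estimate_bound (z : V) k : `|estimate z k| <= 1 * `|z|.
Proof.
rewrite mul1r; apply: le_trans (norm_entry _ _) _.
by rewrite prod_normE le_max lexx orbT.
Qed.

Lemma error_bound (z : V) k : `|error z k| <= (L ^- k + 1) / gn k * `|z|.
Proof.
have g0 := obs_gain_gt0 n w1 k.
rewrite /error normrM normfV (gtr0_norm g0) mulrAC ler_pM2r ?invr_gt0//.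
apply: le_trans (ler_normB _ _) _; rewrite mulrDl mul1r.
have Lk : 0 < L ^- k by rewrite invr_gt0 exprn_gt0.
have h1 : `|entry z.1 k| <= `|z|.
  by apply: le_trans (norm_entry _ _) _; rewrite prod_normE le_max lexx.
have h2 : `|entry z.2 k| <= `|z|.
  by apply: le_trans (norm_entry _ _) _; rewrite prod_normE le_max lexx orbT.
by rewrite normrM (gtr0_norm Lk); apply: lerD => //; rewrite ler_pM2l.
Qed.

Lemma error_bound_gt0 k : 0 < (L ^- k + 1) / gn k.
Proof.
have g0 := obs_gain_gt0 n w1 k.
have Lk : 0 < L ^- k by rewrite invr_gt0 exprn_gt0.
by apply: divr_gt0 => //; lra.
Qed.

Let gauge_cont k : continuous (sg k). Proof. exact: gauge_continuous w0 wa wb k. Qed.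

Let rho_cont k : continuous (rho k).
Proof.
by apply: gpow_continuous; have := w0; have := wa k; have := wb k; lra.
Qed.

Lemma next_gauge_continuous k : continuous (fun v : 'cV[R]_n =>
  next_gauge w n (ctrl_gauge alpha beta (entry v)) k).
Proof.
have G j : continuous (fun v : 'cV[R]_n => sg j (entry v j)).
  by apply: continuous_compose; [exact: entry_continuous|exact: gauge_cont].
have B j : continuous (fun v : 'cV[R]_n =>
    backstep w (ctrl_gauge alpha beta (entry v)) j).
  elim: j => [|j IH] /=; first exact: G.
  by apply: continuous_add; [exact: G|exact: continuous_mull].
rewrite /next_gauge; case: (_ < n)%N; first exact: G.
by apply: continuous_opp; exact: continuous_mull.
Qed.

Lemma feedback_continuous : continuous feedback.
Proof.
by apply: continuous_compose; [exact: next_gauge_continuous|exact: rho_cont].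
Qed.

Lemma injection_continuous i : continuous (fun v : 'cV[R]_n => injection v i 0).
Proof.
have -> : (fun v : 'cV[R]_n => injection v i 0) =
    (fun v => gn i.+1 * rho i.+1 (sg 0 (entry v 0))).
  by apply/funext => v; rewrite mxE.
apply: continuous_mull; apply: continuous_compose; last exact: rho_cont.
by apply: continuous_compose; [exact: entry_continuous|exact: gauge_cont].
Qed.

Lemma closed_loop_continuous : continuous F.
Proof.
have c1 : continuous (fst : V -> 'cV[R]_n) by move=> z; exact: cvg_fst.
have c2 : continuous (snd : V -> 'cV[R]_n) by move=> z; exact: cvg_snd.
have E1 k : continuous (fun z : V => entry z.1 k).
  exact: continuous_compose c1 (@entry_continuous _ _ k).
have E2 k : continuous (fun z : V => entry z.2 k).
  exact: continuous_compose c2 (@entry_continuous _ _ k).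
have Fb : continuous (fun z : V => feedback z.2).
  exact: continuous_compose c2 feedback_continuous.
have D1 (i : 'I_n) : continuous (fun z => (F z).1 i 0).
  have -> : (fun t => (F t).1 i 0) = (fun z => entry z.1 i.+1 +
      L ^+ n * feedback z.2 * (i.+1 == n :> nat)%:R).
    by apply/funext => t; rewrite -entry_ord closed_loop_state.
  apply: continuous_add; first exact: E1.
  apply: continuous_mulr.
  exact: (continuous_mull (f := fun z : V => feedback z.2)).

have D2 (i : 'I_n) : continuous (fun z => (F z).2 i 0).
  have -> : (fun t => (F t).2 i 0) = (fun z => L * (entry z.2 i.+1 +
      feedback z.2 * (i.+1 == n :> nat)%:R +
      gn i.+1 * rho i.+1 (sg 0 (entry z.1 0 - entry z.2 0)))).
    by apply/funext => t; rewrite -entry_ord closed_loop_estimate.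
  apply: continuous_mull; apply: continuous_add.
    apply: continuous_add; first exact: E2.
    exact: (continuous_mulr (f := fun z : V => feedback z.2)).
  apply: continuous_mull; apply: continuous_compose; last exact: rho_cont.
  apply: continuous_compose; last exact: gauge_cont.
  by apply: continuous_add; [exact: E1|apply: continuous_opp; exact: E2].
have C1 z : (fun z => (F z).1) @ z --> (F z).1 by apply: cvg_cV => i; exact: D1.
have C2 z : (fun z => (F z).2) @ z --> (F z).2 by apply: cvg_cV => i; exact: D2.
have E : (fun z => ((F z).1, (F z).2)) = F by apply/funext => z; case: (F z).
by rewrite -E => z; exact: cvg_pair (C1 z) (C2 z).
Qed.

Lemma closed_loop0 : F 0 = 0.
Proof.
have e0 k : entry (0 : 'cV[R]_n) k = 0.
  by rewrite /entry; case: insubP => // i _ _; rewrite mxE.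
have ng : next_gauge w n (ctrl_gauge alpha beta (entry (0 : 'cV[R]_n))) n.-1 = 0.
  have -> : ctrl_gauge alpha beta (entry (0 : 'cV[R]_n)) = fun=> 0.
    by apply/funext => k; rewrite /ctrl_gauge e0 /gauge_fun gpow0.
  rewrite /next_gauge; case: ifP => // _.
  (* By oddness the value at 0 is its own opposite. *)
  have := backstepN w (fun=> 0) n.-1; rewrite oppr0.
  by move=> h; have -> : backstep w (fun=> 0) n.-1 = 0 by [lra]; rewrite mulr0 oppr0.
have fb0 : feedback 0 = 0 by rewrite /feedback ng /scale_fun gpow0.
have z1 : (0 : V).1 = 0 by [].
have z2 : (0 : V).2 = 0 by [].
have E1 : (F 0).1 = 0.
  apply/matrixP => i j; rewrite (ord1 j) -entry_ord closed_loop_state// mxE.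
  by rewrite z1 z2 e0 fb0 mulr0 mul0r addr0.
have E2 : (F 0).2 = 0.
  apply/matrixP => i j; rewrite (ord1 j) -entry_ord closed_loop_estimate// mxE.
  by rewrite z1 z2 !e0 fb0 mul0r !add0r oppr0 /gauge_fun gpow0 /scale_fun gpow0 !mulr0.
by rewrite [LHS]surjective_pairing E1 E2.
Qed.

Lemma error_size_scale : exists2 kappa : R, 0 < kappa &
  err_size R n * kappa <= 1 /\ gn n * (err_size R n * kappa) `^ w <= 2^-1.
Proof.
have g0 := obs_gain_gt0 n w1 n; have B1 := err_size_ge1 R n.
have B0 : 0 < err_size R n by lra.
have g1 : 1 <= gn n by have := obs_gain_homo n w1 (leq0n n); rewrite obs_gain0.
(* The value of [err_size R n * kappa] for which the second condition is an equality. *)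
pose a := (2 * gn n)^-1 `^ w^-1.
have q0 : 0 < (2 * gn n)^-1 by rewrite invr_gt0 mulr_gt0.
have a0 : 0 < a by exact: powR_gt0.
exists (a / err_size R n); first by rewrite divr_gt0.
rewrite mulrC divfK ?gt_eqF//; split.
  rewrite /a -[leRHS](@powRr0 _ (2 * gn n)^-1); apply: ger_powR.
    by rewrite q0 invf_le1 ?mulr_gt0//; lra.
  by rewrite invr_ge0 ltW.
rewrite /a -powRrM mulVf ?gt_eqF// powRr1 ?(ltW q0)//.
by rewrite invfM mulrCA divff ?gt_eqF// mulr1.
Qed.

Lemma GAS_closed_loop : GAS_at_0 F.
Proof.
have [kappa kappa0 [Bk gk]] := error_size_scale.
have B1 := err_size_ge1 R n.
pose G (s : R) (z : V) := inside_tubes w n alpha beta kappa s (estimate z) (error z).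
have a0 k : 0 < alpha k by have := w0; have := wa k; lra.
have b0 k : 0 < beta k by have := w0; have := wb k; lra.
(* Dominates the k-th entries of both the estimate and the state, the latter through
   [state_of_error]. Nondecreasing and continuous in [s] with value 0 at 0, it serves for small and
   for bounded scales. *)
pose bd (k : nat) (s : R) : R := 6 * tube_size w k * rho k s +
  L ^+ k * (gn k * (err_size R n * rho k (kappa * s)) + 6 * tube_size w k * rho k s).
have rho0 k s : 0 <= s -> 0 <= rho k s by exact: gpow_ge0.
have bd_mono k s t : s <= t -> bd k s <= bd k t.
  move=> st; have h1 : rho k s <= rho k t by rewrite ler_gpow.
  have h2 : rho k (kappa * s) <= rho k (kappa * t) by rewrite ler_gpow// ler_pM2l.
  have m0 : 0 < 6 * tube_size w k by rewrite mulr_gt0// tube_size_gt0.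
  have B0 : 0 < err_size R n by lra.
  rewrite /bd; apply: lerD; first by rewrite ler_pM2l.
  rewrite ler_pM2l ?exprn_gt0//; apply: lerD; last by rewrite ler_pM2l.
  by rewrite ler_pM2l ?obs_gain_gt0// ler_pM2l.
have bd0 k : bd k 0 = 0 by rewrite /bd mulr0 /scale_fun gpow0 !mulr0 addr0 mulr0 addr0.
have Gbd s z : 0 < s -> G s z -> `|z| <= \sum_(k < n) bd k s.
  move=> s0 Gz.
  have bdle (i : 'I_n) : bd i s <= \sum_(k < n) bd k s.
    rewrite (bigD1 i)//= lerDl; apply: sumr_ge0 => j _.
    by rewrite -(bd0 j); apply: bd_mono; exact: ltW.
  have S0 : 0 <= \sum_(k < n) bd k s.
    by apply: sumr_ge0 => j _; rewrite -(bd0 j); apply: bd_mono; exact: ltW.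
  have Gk (i : 'I_n) := inside_tubes_bound w0 wa wb kappa0 s0 Gz (ltn_ord i).
  have nn (i : 'I_n) : 0 <= L ^+ i * (gn i * (err_size R n * rho i (kappa * s)) +
      6 * tube_size w i * rho i s) /\ 0 <= 6 * tube_size w i * rho i s.
    have h1 : 0 <= 6 * tube_size w i * rho i s.
      by rewrite mulr_ge0 ?rho0 ?(ltW s0)// mulr_ge0// ltW// tube_size_gt0.
    split => //; rewrite mulr_ge0 ?exprn_ge0 ?(ltW L0)// addr_ge0//.
    rewrite mulr_ge0 ?(ltW (obs_gain_gt0 n w1 _))// mulr_ge0//; first lra.
    by apply: rho0; rewrite mulr_ge0 ?ltW.
  rewrite prod_normE /= ge_max; apply/andP; split; apply: norm_cV_le => // i.
    apply: le_trans (bdle i); rewrite -entry_ord state_of_error normrM.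
    have [h1 h2] := Gk i; have [h3 h4] := nn i.
    rewrite (gtr0_norm (exprn_gt0 _ L0)) /bd.
    suff : L ^+ i * `|gn i * error z i + estimate z i| <=
       L ^+ i * (gn i * (err_size R n * rho i (kappa * s)) + 6 * tube_size w i * rho i s)
      by lra.
    rewrite ler_pM2l ?exprn_gt0//; apply: le_trans (ler_normD _ _) _.
    apply: lerD => //; rewrite normrM (gtr0_norm (obs_gain_gt0 n w1 i)).
    by rewrite ler_pM2l// obs_gain_gt0.
  apply: le_trans (bdle i); rewrite -entry_ord.
  have [h1 h2] := Gk i; have [h3 h4] := nn i; rewrite /bd.
  by apply: le_trans h1 _; lra.
apply: (@GAS_of_shrinking_tubes _ _ _ _ _ G).
- by apply: prod_ball_compact; exact: cV_ball_compact.
- exact: closed_loop_continuous.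
- exact: closed_loop0.
- move=> e e0.
  have C : continuous (fun s => \sum_(k < n) bd k s).
    apply: continuous_sum => k; rewrite /bd.
    have rc : continuous (fun s => rho k (kappa * s)).
      apply: continuous_compose; last exact: rho_cont.
      by apply: continuous_mull => x; exact: cvg_id.
    apply: continuous_add; first by apply: continuous_mull; exact: rho_cont.
    apply: continuous_mull; apply: continuous_add.
      by apply: continuous_mull; exact: continuous_mull.
    by apply: continuous_mull; exact: rho_cont.
  have /cvgrPdist_lt/(_ e e0)/nbhs_ballP[d /= d0 H] := C 0.
  exists (d / 2); first lra.
  move=> s z s0 sd Gz; apply: le_lt_trans (Gbd s z s0 Gz) _.
  have := H s; rewrite /ball /= sub0r normrN big1; last by move=> k _; exact: bd0.
  rewrite sub0r normrN => /(_ _)/(le_lt_trans (ler_norm _)); apply.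
  by rewrite gtr0_norm//; lra.
- move=> S S0; exists (\sum_(k < n) bd k S) => s z s0 sS Gz.
  apply: le_trans (Gbd s z s0 Gz) _; apply: ler_sum => k _; exact: bd_mono.
- have [b bb Hb] := box_inside_tubes n w0 wa wb kappa0.
  move=> S S0; have bS0 : 0 < b * S by rewrite mulr_gt0.
  have sgc k : \forall x \near (0 : R), `|sg k x| <= b * S.
    have /cvgrPdist_le/(_ _ bS0) : {for 0, continuous (sg k)}.
      by move=> ?; exact: (gauge_continuous w0 wa wb).
    by apply: filterS => x; rewrite {1}/gauge_fun gpow0 sub0r normrN.
  have small k (C : R) : 0 < C -> \forall d \near (0 : R)^'+,
      forall x, `|x| <= C * d -> `|sg k x| <= b * S.
    move=> C0; have /nbhs_ballP[r /= r0 H] := sgc k.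
    near=> d => x xd; apply: H; rewrite /ball /= sub0r normrN.
    apply: le_lt_trans xd _; rewrite mulrC -ltr_pdivlMr//.
    by near: d; apply: nbhs_right_lt; rewrite divr_gt0.
  have ev : \forall d \near (0 : R)^'+, forall i : 'I_n,
      (forall x, `|x| <= 1 * d -> `|sg i x| <= b * S) /\
      (forall x, `|x| <= (L ^- i + 1) / gn i * d -> `|sg i x| <= b * S).
    apply: (@filter_forall _ _ (fun (i : 'I_n) d => _)) => i.
    apply: filterI; first exact: small.
    by apply: small; exact: error_bound_gt0.
  have [d [d0 Hd]] : exists d : R, 0 < d /\ forall i : 'I_n,
      (forall x, `|x| <= 1 * d -> `|sg i x| <= b * S) /\
      (forall x, `|x| <= (L ^- i + 1) / gn i * d -> `|sg i x| <= b * S).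
    apply: (@filter_ex _ (0 : R)^'+); near=> d; split; near: d => //.
    exact: nbhs_right_gt.
  exists d => // z zd; apply: Hb => // k kn.
  have [h1 h2] := Hd (Ordinal kn); split.
    apply: h1; apply: le_trans (estimate_bound z k) _.
    by rewrite !mul1r ltW.
  apply: h2; apply: le_trans (error_bound z k) _.
  by rewrite ler_pM2l ?error_bound_gt0// ltW.
- have [b bb Hb] := box_inside_tubes n w0 wa wb kappa0.
  move=> z; pose T (i : 'I_n) := `|sg i (estimate z i)| + `|sg i (error z i)|.
  have T0 i : 0 <= T i by rewrite addr_ge0.
  have TS : 0 <= \sum_i T i by apply: sumr_ge0.
  (* A scale so large that the box of size [b * S] contains the given state; the added 1 keeps it
     positive. *)
  exists ((\sum_i T i + 1) / b); first by rewrite divr_gt0//; lra.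
  apply: Hb; first by rewrite divr_gt0//; lra.
  move=> k kn; rewrite mulrC divfK ?gt_eqF//.
  have : T (Ordinal kn) <= \sum_i T i.
    by rewrite (bigD1 (Ordinal kn))//= lerDl; apply: sumr_ge0.
  rewrite /T /=; have := normr_ge0 (sg k (estimate z k)).
  have := normr_ge0 (sg k (error z k)); lra.
- move=> S S0.
  have [c c0 H] := inside_tubes_invariant w0 wa wb alphaS betaS da1 db1 kappa0 Bk gk L0 S0.
  exists c => // T X [T0 Xc Xd] GX t t0 tT.
  have eB k (u v : V) : estimate (u - v) k = estimate u k - estimate v k.
    by rewrite /estimate entryB.
  have eZ k a (v : V) : estimate (a *: v) k = a * estimate v k.
    by rewrite /estimate entryZ.
  have rB k (u v : V) : error (u - v) k = error u k - error v k.
    by rewrite /error /= !entryB; ring.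
  have rZ k a (v : V) : error (a *: v) k = a * error v k.
    by rewrite /error /= !entryZ; ring.
  have Xct : {within `[0, t], continuous X}.
    apply: continuous_subspaceW Xc => u /=; rewrite in_itv /= => /andP[u0 ut].
    by split => //; apply: le_lt_trans tT; rewrite lee_fin.
  have Xdt u : 0 < u <= t -> is_derive u 1 X (F (X u)).
    by move=> /andP[u0 ut]; apply: Xd => //; apply: le_lt_trans tT; rewrite lee_fin.
  apply: (H (fun k u => estimate (X u) k) (fun k u => error (X u) k) t) => //.
  + move=> k kn; apply: (functional_within_continuous ltr01 (eB k)) => //.
    by move=> v; exact: estimate_bound.
  + move=> k kn; apply: (functional_within_continuous (error_bound_gt0 k) (rB k)) => //.
    by move=> v; exact: error_bound.
  + move=> k u kn ut; rewrite -estimate_field//.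
    apply: (functional_is_derive ltr01 (eB k) (eZ k)); last exact: Xdt.
    by move=> v; exact: estimate_bound.
  + move=> k u kn ut; rewrite -error_field//.
    apply: (functional_is_derive (error_bound_gt0 k) (rB k) (rZ k)); last exact: Xdt.
    by move=> v; exact: error_bound.
  + by rewrite t0 lexx.
Unshelve. all: by end_near.
Qed.

End ClosedLoop.

(** * Homogeneity *)

Lemma continuous_small (R : realType) (V : normedModType R) (f : V -> R) (e : R) :
  continuous f -> f 0 = 0 -> 0 < e ->
  exists2 d, 0 < d & forall x, `|x| < d -> `|f x| <= e.
Proof.
move=> fc f0 e0.
have /cvgrPdist_lt/(_ e e0)/nbhs_normP[d /= d0 H] := @fc 0.
exists d => // x xd; have := H x; rewrite /= sub0r normrN f0 sub0r normrN.
by move=> /(_ xd)/ltW.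
Qed.

Section HomogeneousLimits.
Context {R : realType} {n : nat}.
Variables (r : 'I_n -> R) (d : R) (phi0 phi : 'cV[R]_n -> R).
Hypotheses (r0 : forall i, 0 < r i) (phic : continuous phi)
  (phi0c : continuous phi0) (phi0_neq0 : exists x, phi0 x != 0)
  (phi0_hom : forall l x, 0 < l -> phi0 (dilation r l x) = l `^ d * phi0 x).

(** Small dilations bring a compact set into the ball where the functions agree, and there
    homogeneity makes the quotient exactly [phi0 x]. *)
Lemma homogeneous_0_limit_of_eq (delta : R) : 0 <= d -> 0 < delta ->
  (forall x, `|x| < delta -> phi x = phi0 x) -> homogeneous_0_limit r d phi0 phi.
Proof.
move=> d0 delta0 E; split => // C Cc C0 eps eps0.
have [M [_ HM]] := compact_bounded Cc.
pose B := Num.max M 0 + 1.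
have B0 : 0 < B.
  have : 0 <= Num.max M 0 by rewrite le_max lexx orbT.
  by rewrite /B; lra.
have CB x : C x -> `|x| <= B.
  apply: HM; have : M <= Num.max M 0 by rewrite le_max lexx.
  by rewrite /B; lra.
pose e := delta / (2 * B).
have e0 : 0 < e by rewrite divr_gt0// mulr_gt0.
have N i : \forall l \near (0 : R)^'+, l `^ r i < e.
  have /cvgrPdist_lt/(_ e e0) := powR_cvg0 (r0 i).
  by apply: filterS => l; rewrite sub0r normrN => /(le_lt_trans (ler_norm _)).
have : \forall l \near (0 : R)^'+, forall i, l `^ r i < e.
  exact: (filter_forall _ N).
rewrite near_withinE => /nbhs_ballP[l0 /= l00 H].
exists (l0 / 2); first lra.
move=> l lgt0 ll0 x Cx.
have small : `|dilation r l x| < delta.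
  apply: (@le_lt_trans _ _ (e * B)); last first.
    have -> : e * B = delta / 2 by rewrite /e; field; rewrite gt_eqF.
    lra.
  apply: norm_cV_le; first by rewrite mulr_ge0// ltW.
  move=> i; rewrite mxE normrM ger0_norm ?powR_ge0//.
  apply: ler_pM => //; first exact: powR_ge0.
    apply/ltW/H => //; rewrite /ball /= sub0r normrN gtr0_norm//; lra.
  by rewrite -entry_ord; apply: le_trans (norm_entry _ _) (CB _ Cx).
rewrite E// phi0_hom// mulrAC divff ?mul1r ?subrr ?normr0 ?ltW//.
by rewrite gt_eqF// powR_gt0.
Qed.

(** A bounded difference disappears after division by a positive power of a large factor. *)
Lemma homogeneous_oo_limit_of_bounded (D : R) : 0 < d ->
  (forall x, `|phi x - phi0 x| <= D) -> homogeneous_oo_limit r d phi0 phi.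
Proof.
move=> d0 HD; split => //; first by split => //; exact: ltW.
move=> C Cc C0 eps eps0.
have D0 : 0 <= D by exact: le_trans (normr_ge0 _) (HD 0).
have q0 : 0 < (D + 1) / eps by rewrite divr_gt0//; lra.
exists (((D + 1) / eps) `^ d^-1); first exact: powR_gt0.
move=> l ll x Cx.
have l0 : 0 < l by apply: lt_le_trans ll; exact: powR_gt0.
have ld0 : 0 < l `^ d by exact: powR_gt0.
have ld : (D + 1) / eps <= l `^ d.
  have <- : (((D + 1) / eps) `^ d^-1) `^ d = (D + 1) / eps.
    by rewrite -powRrM mulVf ?gt_eqF// powRr1// ltW.
  by apply: ge0_ler_powR => //; rewrite ?nnegrE ?powR_ge0// ltW.
have -> : phi0 x = phi0 (dilation r l x) / l `^ d.
  by rewrite phi0_hom// mulrAC divff ?mul1r// gt_eqF.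
rewrite -mulrBl normrM normfV (gtr0_norm ld0) ler_pdivrMr//.
apply: le_trans (HD _) _.
rewrite ler_pdivrMr// in ld; lra.
Qed.

End HomogeneousLimits.

Section Homogeneity.
Context {R : realType}.
Variables (w : R) (n : nat) (hn : (2 <= n)%N) (alpha beta : nat -> R)
  (r : 'I_n -> R) (N : R).
Hypotheses (w0 : 0 < w) (wa : forall k, w <= alpha k <= 1)
  (wb : forall k, w <= beta k <= 1).

Let a0 k : 0 < alpha k. Proof. by have := w0; have := wa k; lra. Qed.
Let b0 k : 0 < beta k. Proof. by have := w0; have := wb k; lra. Qed.
Let w1 : 0 < w <= 1. Proof. by have := w0; have := wa 0%N; lra. Qed.

Lemma backstepZ c u k : backstep w (fun j => c * u j) k = c * backstep w u k.
Proof. by elim: k => //= k ->; rewrite mulrDr mulrCA. Qed.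

Lemma backstepB u v k :
  backstep w (fun j => u j - v j) k = backstep w u k - backstep w v k.
Proof. by elim: k => //= k ->; ring. Qed.

Lemma feedbackE (a b : nat -> R) (v : 'cV[R]_n) : feedback w a b v =
  scale_fun a b n (- (ctrl_gain w n.-1 * backstep w (ctrl_gauge a b (entry v)) n.-1)).
Proof. by rewrite /feedback /next_gauge prednK ?ltnn// ltnW. Qed.

(** The composite is again a glued power, so its limits need only [gpow_small] near 0 and
    [gpow_near_pow] at infinity. *)
Lemma injectionE (a b : nat -> R) (v : 'cV[R]_n) i : (forall k, 0 < a k) ->
  (forall k, 0 < b k) -> injection w a b v i 0 =
  obs_gain w n i.+1 * gpow ((a 0%N)^-1 * a i.+1) ((b 0%N)^-1 * b i.+1) (entry v 0).
Proof.
by move=> a_gt0 b_gt0; rewrite mxE /scale_fun /gauge_fun gpow_comp ?invr_gt0.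
Qed.

Lemma entry_dilation l (x : 'cV[R]_n) : (forall i : 'I_n, r i = N * alpha i) ->
  forall k, entry (dilation r l x) k = l `^ (N * alpha k) * entry x k.
Proof.
move=> rE k; have [kn|nk] := ltnP k n; last by rewrite !entry_out// mulr0.
by rewrite -[k]/(nat_of_ord (Ordinal kn)) !entry_ord mxE rE.
Qed.

(** A dilation multiplies all gauges by the same power [N] of [l], which passes through the linear
    [backstep]; the last scale function converts it into the degree [N * alpha n]. *)
Lemma feedback_homogeneous l x : (forall i : 'I_n, r i = N * alpha i) -> 0 < l ->
  feedback w alpha alpha (dilation r l x) =
  l `^ (N * alpha n) * feedback w alpha alpha x.
Proof.
move=> rE l0; rewrite !feedbackE.
have -> : ctrl_gauge alpha alpha (entry (dilation r l x)) =
    fun k => l `^ N * ctrl_gauge alpha alpha (entry x) k.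
  apply/funext => k; rewrite /ctrl_gauge entry_dilation// /gauge_fun.
  by rewrite gpowM ?powR_gt0// -powRrM mulfK// gt_eqF.
rewrite backstepZ mulrCA -mulrN /scale_fun gpowM ?powR_gt0//.
by rewrite -powRrM.
Qed.

Lemma injection_homogeneous l x i : (forall i : 'I_n, r i = N * alpha i) -> 0 < l ->
  injection w alpha alpha (dilation r l x) i 0 =
  l `^ (N * alpha i.+1) * injection w alpha alpha x i 0.
Proof.
move=> rE l0; rewrite !injectionE// entry_dilation// gpowM ?powR_gt0//.
have e : N * alpha 0%N * ((alpha 0%N)^-1 * alpha i.+1) = N * alpha i.+1.
  by field; rewrite gt_eqF.
by rewrite -powRrM e mulrCA.
Qed.

Lemma feedback_neq0 : exists x : 'cV[R]_n, feedback w alpha beta x != 0.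
Proof.
(* Only the last gauge of this vector is nonzero, so nothing cancels in [backstep]. *)
exists (last_vec R n); rewrite feedbackE.
have c0 := ctrl_gain_gt0 w1 n.-1.
have n1 : (0 < n)%N by exact: ltnW hn.
have last1 : ctrl_gauge alpha beta (entry (last_vec R n)) n.-1 = 1.
  by rewrite /ctrl_gauge entry_last ?prednK// eqxx /gauge_fun gpow1.
have -> : backstep w (ctrl_gauge alpha beta (entry (last_vec R n))) n.-1 = 1.
  move: last1; case E : n.-1 => [|m] //= ->.
  suff -> : backstep w (ctrl_gauge alpha beta (entry (last_vec R n))) m = 0.
    by rewrite mulr0 addr0.
  apply/eqP; rewrite -normr_le0.
  apply: le_trans (backstep_bound w0 wa (lexx 0) _) _; last by rewrite mul0r.
  move=> j jm; have jn : (j.+1 < n)%N by move: E jm; lia.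
  rewrite /ctrl_gauge entry_last; last exact: ltnW.
  have /negbTE -> : j.+1 != n by rewrite neq_ltn jn.
  by rewrite /gauge_fun gpow0 normr0.
by rewrite mulr1 /scale_fun gpowN oppr_eq0 gt_eqF// gpow_gt0.
Qed.

Lemma injection_neq0 i : exists x : 'cV[R]_n, injection w alpha beta x i 0 != 0.
Proof.
exists (\col_j 1); rewrite injectionE// (entry_first hn) mxE gpow1 mulr1.
by rewrite gt_eqF// obs_gain_gt0.
Qed.

(** Small entries put the gauges on their branch at 0. The outer scale function also needs an
    argument of size at most 1, which continuity provides. *)
Lemma feedback_near0 : exists2 d : R, 0 < d &
  forall x : 'cV[R]_n, `|x| < d -> feedback w alpha beta x = feedback w alpha alpha x.
Proof.
have f0 : next_gauge w n (ctrl_gauge alpha alpha (entry (0 : 'cV[R]_n))) n.-1 = 0.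
  have -> : ctrl_gauge alpha alpha (entry (0 : 'cV[R]_n)) = fun k => 0 * 0.
    apply/funext => k; rewrite mul0r /ctrl_gauge /entry.
    by case: insubP => [j _ _|_]; rewrite ?mxE /gauge_fun gpow0.
  by rewrite /next_gauge prednK ?ltnn ?(ltnW hn)// backstepZ mul0r mulr0 oppr0.
have [d d0 H] := continuous_small
  (@next_gauge_continuous R w n alpha alpha w0 wa wa n.-1) f0 ltr01.
exists (Num.min d 1); first by rewrite lt_min d0 ltr01.
move=> x; rewrite lt_min => /andP[xd x1].
rewrite /feedback.
have -> : ctrl_gauge alpha beta (entry x) = ctrl_gauge alpha alpha (entry x).
  apply/funext => k; rewrite /ctrl_gauge /gauge_fun gpow_small//.
  exact: le_trans (norm_entry _ _) (ltW x1).
by rewrite /scale_fun gpow_small// H.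
Qed.

Lemma injection_near0 (x : 'cV[R]_n) i : `|x| < 1 ->
  injection w alpha beta x i 0 = injection w alpha alpha x i 0.
Proof.
move=> x1; rewrite !injectionE// gpow_small//.
exact: le_trans (norm_entry _ _) (ltW x1).
Qed.

(** Replacing the weight of the outer scale function costs at most 1. Inside, each gauge changes by
    at most 1, so their combination changes by at most [c * W], and [gpow_quasilipschitz] passes
    this through the outer function at the price of 2. *)
Lemma feedback_bounded_diff : exists D : R, forall x : 'cV[R]_n,
  `|feedback w alpha beta x - feedback w beta beta x| <= D.
Proof.
pose c := ctrl_gain w n.-1; pose W := backstep w (fun=> 1) n.-1.
have c0 : 0 < c by exact: ctrl_gain_gt0.
exists (1 + (2 + c * W)) => x; rewrite !feedbackE -/c.
set X := - (c * _); set Y := - (c * _).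
apply: le_trans (ler_distD (scale_fun beta beta n X) _ _) _; apply: lerD.
  by apply: gpow_near_pow; exact: ltW.
have bn : 0 < beta n <= 1 by have := w0; have := wb n; lra.
apply: le_trans (gpow_quasilipschitz _ _ bn bn) _; rewrite lerD2l.
rewrite /X /Y -opprD normrN -mulrBr -backstepB normrM (gtr0_norm c0) ler_pM2l//.
have := @backstep_bound R w alpha w0 wa (fun j =>
  ctrl_gauge alpha beta (entry x) j - ctrl_gauge beta beta (entry x) j) 1 n.-1 ler01.
rewrite mul1r; apply => j _; apply: gpow_near_pow; rewrite invr_ge0; exact: ltW.
Qed.

Lemma injection_bounded_diff i : exists D : R, forall x : 'cV[R]_n,
  `|injection w alpha beta x i 0 - injection w beta beta x i 0| <= D.
Proof.
exists (obs_gain w n i.+1) => x; have g0 := obs_gain_gt0 n w1 i.+1.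
rewrite !injectionE// -mulrBr normrM (gtr0_norm g0) ger_pMr//.
by apply: gpow_near_pow; rewrite mulr_ge0 ?invr_ge0 ?ltW.
Qed.

End Homogeneity.

(** * Normalised weights *)

Section Weights.
Context {R : realType}.
Variables (n : nat) (hn : (2 <= n)%N).

(* The weights r_1, ..., r_n, r_n + d divided by n, so that they are at most 1
   and the scale functions are concave; constant after index n. *)
Definition normal_weight (d : R) (k : nat) : R :=
  (1 - d * (n%:R - 1 - (minn k n)%:R)) / n%:R.

Let n0 : 0 < n%:R :> R. Proof. by rewrite ltr0n ltnW. Qed.
Let n2 : 2 <= n%:R :> R. Proof. by rewrite ler_nat. Qed.

Lemma normal_weightS d k : (k < n)%N ->
  normal_weight d k.+1 = normal_weight d k + d / n%:R.
Proof.
move=> kn; rewrite /normal_weight !(minn_idPl _)//; last exact: ltnW.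
by rewrite -natr1; field; rewrite gt_eqF.
Qed.

Lemma chain_weightE d (i : 'I_n) : chain_weight d i = n%:R * normal_weight d i.
Proof.
rewrite /normal_weight mulrC divfK ?gt_eqF// (minn_idPl _); last exact: ltnW.
by rewrite /chain_weight natrB// -natr1 opprD addrA addrAC.
Qed.

Lemma chain_weight_next d (i : 'I_n) :
  d + chain_weight d i = n%:R * normal_weight d i.+1.
Proof.
rewrite chain_weightE normal_weightS// mulrDr addrC; congr (_ + _).
by rewrite mulrC divfK// gt_eqF.
Qed.

Lemma normal_weight_last d : n%:R * normal_weight d n = 1 + d.
Proof.
rewrite /normal_weight mulrC divfK ?gt_eqF// minnn.
by rewrite addrAC subrr add0r mulrN mulr1 opprK.
Qed.

(** Before division by [n], the weight is affine in the index, with values [1 - d * (n - 1)] at the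
    first one and [1 + d] at index [n]. The hypothesis on [d] says exactly that both are positive,
    and both are at most [n]; [E] writes the weight as their convex combination, up to a factor
    [n]. *)
Lemma normal_weight_bounds d : -1 < d < (n%:R - 1)^-1 ->
  exists2 w : R, 0 < w & forall k, w <= normal_weight d k <= 1.
Proof.
move=> /andP[d1 d2].
have n1 : 0 < n%:R - 1 :> R by have := n2; lra.
have d3 : d * (n%:R - 1) < 1 by rewrite -ltr_pdivlMr// div1r.
have d4 : d < 1.
  by apply: lt_le_trans d2 _; rewrite invf_le1//; have := n2; lra.
pose a := 1 - d * (n%:R - 1); pose b := 1 + d.
have a0 : 0 < a by rewrite /a; lra.
have b0 : 0 < b by rewrite /b; lra.
pose m := Num.min a b.
have m0 : 0 < m by rewrite lt_min a0 b0.
have ma : m <= a by rewrite ge_min lexx.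
have mb : m <= b by rewrite ge_min lexx orbT.
have an : a <= n%:R.
  have : - d * (n%:R - 1) <= 1 * (n%:R - 1) by rewrite ler_pM2r//; lra.
  by rewrite /a; lra.
have bn : b <= n%:R by rewrite /b; have := n2; lra.
exists (m / n%:R); first by rewrite divr_gt0.
move=> k; rewrite /normal_weight; set j := (minn k n)%:R : R.
have j0 : 0 <= j by rewrite ler0n.
have jn : j <= n%:R by rewrite ler_nat geq_minr.
have E : n%:R * (1 - d * (n%:R - 1 - j)) = (n%:R - j) * a + j * b.
  by rewrite /a /b; ring.
have nj : 0 <= n%:R - j by lra.
have h1 : (n%:R - j) * m + j * m <= (n%:R - j) * a + j * b.
  by apply: lerD; rewrite ler_wpM2l.
have h2 : (n%:R - j) * a + j * b <= (n%:R - j) * n%:R + j * n%:R.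
  by apply: lerD; rewrite ler_wpM2l.
have h3 : n%:R * m <= n%:R * (1 - d * (n%:R - 1 - j)) by rewrite E; lra.
have h4 : n%:R * (1 - d * (n%:R - 1 - j)) <= n%:R * n%:R by rewrite E; lra.
rewrite ler_pM2l// in h3; rewrite ler_pM2l// in h4.
by rewrite ler_pM2r ?invr_gt0// h3 ler_pdivrMr// mul1r.
Qed.

End Weights.

Theorem theorem5p1 (R : realType) (n : nat) (hn : (2 <= n)%N) (d0 doo : R)
    (hd0 : -1 < d0 < (n%:R - 1)^-1) (hdoo : -1 < doo < (n%:R - 1)^-1) :
  exists (phi phi0 phioo : 'cV[R]_n -> R)
         (K K0 Koo : 'cV[R]_n -> 'cV[R]_n),
    [/\ homogeneous_bilimit (chain_weight d0) (1 + d0) phi0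
          (chain_weight doo) (1 + doo) phioo phi,
        vf_homogeneous_bilimit (chain_weight d0) d0 K0
          (chain_weight doo) doo Koo K &
        forall L : R, 0 < L ->
          [/\ GAS_at_0 (closed_loop hn L phi K),
              GAS_at_0 (closed_loop hn L phi0 K0) &
              GAS_at_0 (closed_loop hn L phioo Koo)]].
Proof.
have [wa wa0 Ha] := normal_weight_bounds hn hd0.
have [wb wb0 Hb] := normal_weight_bounds hn hdoo.
(* Gains depend on [w] and [n] only, so a common lower bound of the two families of weights lets the
   approximations share them. *)
pose w := Num.min wa wb.
have w0 : 0 < w by rewrite lt_min wa0.
pose a := normal_weight n d0; pose b := normal_weight n doo.
have wal k : w <= a k <= 1.
  by have /andP[h ->] := Ha k; rewrite andbT (le_trans _ h)// ge_min lexx.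
have wbl k : w <= b k <= 1.
  by have /andP[h ->] := Hb k; rewrite andbT (le_trans _ h)// ge_min lexx orbT.
have n0 : 0 < n%:R :> R by rewrite ltr0n ltnW.
have n2 : 2 <= n%:R :> R by rewrite ler_nat.
have dn (d : R) : -1 < d < (n%:R - 1)^-1 -> -1 <= d / n%:R <= 1.
  move=> /andP[d1 d2].
  have n1 : 0 < n%:R - 1 :> R by lra.
  have d3 : d < 1.
    by apply: lt_le_trans d2 _; rewrite invf_le1//; lra.
  by rewrite ler_pdivlMr// ler_pdivrMr//; lra.
have aS := @normal_weightS R n hn d0; have bS := @normal_weightS R n hn doo.
have a_gt0 k : 0 < a k by have := wal k; lra.
have b_gt0 k : 0 < b k by have := wbl k; lra.
have ra0 (i : 'I_n) : 0 < chain_weight d0 i by rewrite chain_weightE// mulr_gt0.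
have rb0 (i : 'I_n) : 0 < chain_weight doo i by rewrite chain_weightE// mulr_gt0.
have [da [da0 Hda]] : exists d, 0 < d /\ forall x : 'cV[R]_n, `|x| < d ->
    feedback w a b x = feedback w a a x.
  by have [d] := @feedback_near0 R w n hn a b w0 wal; exists d.
exists (feedback w a b), (feedback w a a), (feedback w b b),
  (injection w a b), (injection w a a), (injection w b b); split.
- split.
    apply: (homogeneous_0_limit_of_eq ra0 _ _ _ _ _ da0 Hda).
    + exact: (feedback_continuous w0 wal wbl).
    + exact: (feedback_continuous w0 wal wal).
    + exact: (feedback_neq0 hn a w0 wal).
    + move=> l x l0; rewrite -(normal_weight_last hn d0).
      by apply: (feedback_homogeneous hn w0 wal x _ l0) => // i; exact: chain_weightE.
    + by case/andP: hd0 => h _; lra.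
  have [D HD] := @feedback_bounded_diff R w n hn a b w0 wal wbl.
  apply: (homogeneous_oo_limit_of_bounded rb0 _ _ _ _ _ HD).
  + exact: (feedback_continuous w0 wal wbl).
  + exact: (feedback_continuous w0 wbl wbl).
  + exact: (feedback_neq0 hn b w0 wbl).
  + move=> l x l0; rewrite -(normal_weight_last hn doo).
    by apply: (feedback_homogeneous hn w0 wbl x _ l0) => // i; exact: chain_weightE.
  + by case/andP: hdoo => h _; lra.
- split => i; rewrite chain_weight_next//.
    split; first by rewrite mulr_ge0 ?ltW.
    apply: (homogeneous_0_limit_of_eq ra0 _ _ _ _ _ ltr01).
    + exact: (@injection_continuous _ _ _ _ _ w0 wal wbl i).
    + exact: (@injection_continuous _ _ _ _ _ w0 wal wal i).
    + exact: (injection_neq0 hn w0 wal wal i).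
    + move=> l x l0.
      by apply: (injection_homogeneous w0 wal x i _ l0) => // j; exact: chain_weightE.
    + by rewrite mulr_ge0 ?ltW.
    + by move=> x x1; exact: (injection_near0 w0 wal wbl).
  split; first by rewrite mulr_ge0 ?ltW.
  have [D HD] := @injection_bounded_diff R w n a b w0 wal wbl i.
  apply: (homogeneous_oo_limit_of_bounded rb0 _ _ _ _ _ HD).
  + exact: (@injection_continuous _ _ _ _ _ w0 wal wbl i).
  + exact: (@injection_continuous _ _ _ _ _ w0 wbl wbl i).
  + exact: (injection_neq0 hn w0 wbl wbl i).
  + move=> l x l0.
    by apply: (injection_homogeneous w0 wbl x i _ l0) => // j; exact: chain_weightE.
  + by rewrite mulr_gt0.
- move=> L L0; split.
  + exact: (GAS_closed_loop hn w0 wal wbl aS bS (dn _ hd0) (dn _ hdoo) L0).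
  + exact: (GAS_closed_loop hn w0 wal wal aS aS (dn _ hd0) (dn _ hd0) L0).
  + exact: (GAS_closed_loop hn w0 wbl wbl bS bS (dn _ hdoo) (dn _ hdoo) L0).
Qed.
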